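(* Let $\Omega\subset\mathbb{P}(\mathbb{R}^d)$ be a divisible properly convex domain with exposed boundary and let $c:[0,\infty)\to\Omega$ be a projective geodesic ray. Suppose that a sequence $\{\gamma_n\}$ in $\mathrm{Aut}(\Omega)$ $R$-tracks $c$ with respect to $x_0\in\Omega$. If $\{\gamma_n\}$ is strongly uniformly $k$-regular for $k=1$ and for $k=d-1$, then $c$ is $M$-Morse for some Morse gauge $M$. Moreover, $M$ can be chosen to depend only on $x_0$, $R$, and the constants in the definition of strong uniform $k$-regularity (for the given domain $\Omega$).
   Context: A properly convex domain $\Omega\subset\mathbb{P}(\mathbb{R}^d)$ is a nonempty open convex set whose closure is a bounded convex subset of some affine chart. $\mathrm{Aut}(\Omega)\subset\mathrm{PGL}(d,\mathbb{R})$ is the group of projective transformations preserving $\Omega$. $\Omega$ is divisible if some discrete subgroup $\Gamma\subseteq\mathrm{Aut}(\Omega)$ acts cocompactly on $\Omega$. The Hilbert metric is $d_\Omega(x,y)=\frac12\log\frac{|a-y||b-x|}{|a-x||b-y|}$, where $a,b\in\partial\Omega$ are the points where the projective line through $x,y$ meets $\partial\Omega$, ordered $a,x,y,b$. A projective geodesic ray is a unit-speed geodesic ray $c:[0,\infty)\to\Omega$ whose image is a projective line segment $[x,y)$ with $x\in\Omega$, $y\in\partial\Omega$. Exposed boundary: a supporting hyperplane of $\Omega$ is a projective hyperplane meeting $\overline\Omega$ but not $\Omega$. A face of $\Omega$ is an equivalence class in $\partial\Omega$ of the relation $x\sim y$ iff $x=y$ or some open projective segment in $\partial\Omega$ contains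 both $x$ and $y$. A face $F$ is exposed if there is a supporting hyperplane $H$ with $H\cap\partial\Omega=\overline F$. $\Omega$ has exposed boundary if every point of $\partial\Omega$ lies in an exposed face. Morse: a Morse gauge is any function $M:\mathbb{R}_{\ge0}\times\mathbb{R}_{\ge0}\to\mathbb{R}_{\ge0}$; a geodesic $\ell$ is $M$-Morse if every $(\lambda,a)$-quasi-geodesic with endpoints on $\ell$ lies in the $M(\lambda,a)$-neighborhood of $\ell$. Tracking: $\{\gamma_n\}$ $R$-tracks $c$ with respect to $x_0$ if $d_\Omega(x_0,\gamma_n^{-1}c(n))<R$ for all $n\in\mathbb{N}$. For $g$ with singular values $\sigma_1(g)\ge\dots\ge\sigma_d(g)$, $\mu_{i,j}(g)=\log\frac{\sigma_i(g)}{\sigma_j(g)}$, well defined on $\mathrm{PGL}(d,\mathbb{R})$. For $1\le k<d$, a sequence $\{g_n\}$ is strongly uniformly $k$-regular if it is divergent (leaves every compact set of the group) and there are constants $C,N>0$ such that for all $n,m\in\mathbb{N}$ with $m>N$, $\frac{\mu_{k,k+1}(g_n^{-1}g_{n+m})}{\mu_{1,d}(g_n^{-1}g_{n+m})}>C$. *)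

(* Defs.v *)
From HB Require Import structures.
From mathcomp Require Import all_boot all_order all_algebra.
From mathcomp Require Import all_classical all_reals all_analysis.
Set Implicit Arguments.
Unset Strict Implicit.
Unset Printing Implicit Defensive.
Import Order.TTheory GRing.Theory Num.Theory.
Import numFieldNormedType.Exports.
Local Open Scope classical_set_scope.
Local Open Scope ring_scope.
Local Open Scope quotient_scope.

Section Proportional.
Context (R : realType) (V : normedModType R) (A : set V).

Definition proportional (u v : A) : bool :=
  `[< exists2 k : R, k != 0 & val u = k *: val v >].

Lemma proportional_refl : reflexive proportional.
Proof. by move=> u; apply/asboolP; exists 1; rewrite ?oner_eq0 ?scale1r. Qed.

Lemma proportional_sym : symmetric proportional.
Proof.
suff imp u v : proportional u v -> proportional v u.
  by move=> u v; apply/idP/idP; exact: imp.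
move=> /asboolP[k k0 e]; apply/asboolP; exists k^-1; first by rewrite invr_eq0.
by rewrite e scalerA mulVf ?scale1r.
Qed.

Lemma proportional_trans : transitive proportional.
Proof.
move=> v u w /asboolP[k k0 e] /asboolP[l l0 f]; apply/asboolP.
by exists (k * l); rewrite ?mulf_neq0 // e f scalerA.
Qed.

Canonical proportional_equiv :=
  EquivRel proportional proportional_refl proportional_sym proportional_trans.

End Proportional.

Definition nonzero_vector (R : realType) (d : nat) : set 'cV[R]_d :=
  [set v | v != 0].
Arguments nonzero_vector : clear implicits.

Definition GL (R : realType) (d : nat) : set 'M[R]_d := [set g | g \in unitmx].
Arguments GL : clear implicits.

Definition proj_space (R : realType) (d : nat) : Type :=
  quotient_topology {eq_quot (proportional_equiv (nonzero_vector R d))}.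

HB.instance Definition _ (R : realType) (d : nat) :=
  Topological.on (proj_space R d).
HB.instance Definition _ (R : realType) (d : nat) :=
  Quotient.on (proj_space R d).

Definition PGL (R : realType) (d : nat) : Type :=
  quotient_topology {eq_quot (proportional_equiv (GL R d))}.

HB.instance Definition _ (R : realType) (d : nat) := Topological.on (PGL R d).
HB.instance Definition _ (R : realType) (d : nat) := Quotient.on (PGL R d).

Section Group.
Context (R : realType) (d : nat).
Implicit Types (a b c : GL R d) (g h : PGL R d).

Lemma GL_unit a : val a \in unitmx.
Proof. by case: a => a /= /set_mem. Qed.

Definition GL_elt (a : 'M[R]_d) (ua : a \in unitmx) : GL R d :=
  SigSub (mem_set ua : a \in GL R d).

Lemma GL_mul_subproof a b : val a *m val b \in unitmx.
Proof. by rewrite unitmx_mul !GL_unit. Qed.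

Lemma GL_inv_subproof a : invmx (val a) \in unitmx.
Proof. by rewrite unitmx_inv GL_unit. Qed.

Definition GL_mul a b : GL R d := GL_elt (GL_mul_subproof a b).
Definition GL_inv a : GL R d := GL_elt (GL_inv_subproof a).
Definition GL_one : GL R d := GL_elt (@unitmx1 R d).

Definition PGL_mul g h : PGL R d := \pi_(PGL R d) (GL_mul (repr g) (repr h)).
Definition PGL_inv g : PGL R d := \pi_(PGL R d) (GL_inv (repr g)).
Definition PGL_one : PGL R d := \pi_(PGL R d) GL_one.

Lemma PGL_eqP a b :
  reflect (exists2 k : R, k != 0 & val a = k *: val b)
          (\pi_(PGL R d) a == \pi_(PGL R d) b).
Proof.
apply: (iffP eqP) => [/eqmodP/asboolP //|ab].
by apply/eqmodP/asboolP.
Qed.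

Lemma repr_PGL a :
  exists2 k : R, k != 0 & val (repr (\pi_(PGL R d) a)) = k *: val a.
Proof. by apply/PGL_eqP; rewrite reprK. Qed.

Lemma PGL_mulE a b :
  PGL_mul (\pi_(PGL R d) a) (\pi_(PGL R d) b) = \pi_(PGL R d) (GL_mul a b).
Proof.
have [k k0 ak] := repr_PGL a; have [l l0 bl] := repr_PGL b.
apply/eqP/PGL_eqP; exists (k * l); first by rewrite mulf_neq0.
by rewrite /= ak bl -scalemxAl -scalemxAr scalerA.
Qed.

Lemma PGL_invE a : PGL_inv (\pi_(PGL R d) a) = \pi_(PGL R d) (GL_inv a).
Proof.
have [k k0 ak] := repr_PGL a.
apply/eqP/PGL_eqP; exists k^-1; first by rewrite invr_eq0.
by rewrite /= ak invmxZ // -ak GL_unit.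
Qed.

Lemma PGL_mulA : associative PGL_mul.
Proof.
move=> g h f; rewrite -(reprK g) -(reprK h) -(reprK f).
move: (repr g) (repr h) (repr f) => a b c.
rewrite (PGL_mulE b c) (PGL_mulE a b) (PGL_mulE a) (PGL_mulE _ c).
by congr (\pi_(PGL R d) _); apply: val_inj; rewrite /= mulmxA.
Qed.

Lemma PGL_mul1 : left_id PGL_one PGL_mul.
Proof.
move=> g; rewrite -(reprK g) (PGL_mulE GL_one (repr g)).
by congr (\pi_(PGL R d) _); apply: val_inj; rewrite /= mul1mx.
Qed.

Lemma PGL_mulr1 : right_id PGL_one PGL_mul.
Proof.
move=> g; rewrite -(reprK g) (PGL_mulE (repr g) GL_one).
by congr (\pi_(PGL R d) _); apply: val_inj; rewrite /= mulmx1.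
Qed.

Lemma PGL_mulV : left_inverse PGL_one PGL_inv PGL_mul.
Proof.
move=> g; rewrite -(reprK g); move: (repr g) => a.
rewrite (PGL_invE a) (PGL_mulE (GL_inv a) a).
by congr (\pi_(PGL R d) _); apply: val_inj; rewrite /= mulVmx ?GL_unit.
Qed.

Lemma PGL_mulrV : right_inverse PGL_one PGL_inv PGL_mul.
Proof.
move=> g; rewrite -(reprK g); move: (repr g) => a.
rewrite (PGL_invE a) (PGL_mulE a (GL_inv a)).
by congr (\pi_(PGL R d) _); apply: val_inj; rewrite /= mulmxV ?GL_unit.
Qed.

HB.instance Definition _ := isGroup.Build (PGL R d)
  PGL_mulA PGL_mul1 PGL_mulr1 PGL_mulV PGL_mulrV.

End Group.

Section Projective.
Context (R : realType) (d : nat).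
Implicit Types (x y p : proj_space R d) (u v : 'cV[R]_d) (phi : 'rV[R]_d).
Implicit Types (Omega F S : set (proj_space R d)).

Definition vec p : 'cV[R]_d := val (repr p).

Lemma vec_neq0 p : vec p != 0.
Proof. by rewrite /vec; case: (repr p) => v /= /set_mem. Qed.

Definition proj_class v (v0 : v != 0) : proj_space R d :=
  \pi_(proj_space R d) (SigSub (mem_set v0 : v \in nonzero_vector R d)).

Definition represents v p := exists v0 : v != 0, p = proj_class v0.

Lemma PGL_act_subproof (g : PGL R d) p : val (repr g) *m vec p != 0.
Proof.
apply/eqP => gp0; have /eqP := vec_neq0 p; apply.
by rewrite -[vec p]mul1mx -(mulVmx (GL_unit (repr g))) -mulmxA gp0 mulmx0.
Qed.

Definition PGL_act (g : PGL R d) p : proj_space R d :=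
  proj_class (PGL_act_subproof g p).

Lemma proj_classP u v (u0 : u != 0) (v0 : v != 0) :
  proj_class u0 = proj_class v0 <-> exists2 k : R, k != 0 & u = k *: v.
Proof.
by split=> [/eqmodP/asboolP //|uv]; apply/eqmodP/asboolP.
Qed.

Lemma PGL_actE (a : GL R d) v (v0 : v != 0) :
  represents (val a *m v) (PGL_act (\pi_(PGL R d) a) (proj_class v0)).
Proof.
have [k k0 ak] := repr_PGL a.
have [l l0 vl] : exists2 l : R, l != 0 & vec (proj_class v0) = l *: v.
  by apply/(proj_classP (vec_neq0 _) v0); rewrite -[RHS]reprK /proj_class;
     congr (\pi_(proj_space R d) _); apply: val_inj.
have av0 : val a *m v != 0.
  apply/eqP => av; move/eqP: (v0); apply.
  by rewrite -[v]mul1mx -(mulVmx (GL_unit a)) -mulmxA av mulmx0.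
exists av0; apply/proj_classP; exists (k * l); first by rewrite mulf_neq0.
by rewrite ak vl -scalemxAl -scalemxAr scalerA.
Qed.

Definition form phi v : R := (phi *m v) 0 0.

Definition hyperplane phi : set (proj_space R d) :=
  [set p | form phi (vec p) = 0].

Definition affine_chart phi : set (proj_space R d) := ~` hyperplane phi.

(* The chart [affine_chart phi] is identified with the affine hyperplane
   [form phi v = 1] of R^d. *)
Definition affine_coord phi p : 'cV[R]_d := (form phi (vec p))^-1 *: vec p.

Definition properly_convex Omega :=
  [/\ Omega !=set0, open Omega & exists phi,
    [/\ phi != 0, closure Omega `<=` affine_chart phi,
        convex_set (affine_coord phi @` Omega : set (convex_lmodType 'cV[R]_d)),
        convex_set
          (affine_coord phi @` closure Omega : set (convex_lmodType 'cV[R]_d)) &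
        bounded_set (affine_coord phi @` closure Omega)]].

Definition boundary Omega : set (proj_space R d) :=
  closure Omega `\` interior Omega.

Definition Aut Omega : set (PGL R d) :=
  [set g | PGL_act g @` Omega = Omega].

Definition is_subgroup (Gamma : set (PGL R d)) :=
  [/\ Gamma 1%g,
      forall g h, Gamma g -> Gamma h -> Gamma (g * h)%g &
      forall g, Gamma g -> Gamma (g^-1)%g].

Definition is_discrete (Gamma : set (PGL R d)) := Gamma `<=` isolated Gamma.

Definition acts_cocompactly (Gamma : set (PGL R d)) Omega :=
  exists K : set (proj_space R d), [/\ compact K, K `<=` Omega &
    \bigcup_(g in Gamma) (PGL_act g @` K) = Omega].

Definition divisible Omega := exists Gamma : set (PGL R d),
  [/\ is_subgroup Gamma, Gamma `<=` Aut Omega, is_discrete Gamma &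
      acts_cocompactly Gamma Omega].

(* Two distinct points [u], [v] bound two segments of their projective line;
   they correspond to the pairs of representatives (u, v) and (u, - v). *)
Definition open_segment u v : set (proj_space R d) :=
  [set p | exists s t : R, [/\ 0 < s, 0 < t & represents (s *: u + t *: v) p]].

Definition half_open_segment u v : set (proj_space R d) :=
  [set p | exists s t : R, [/\ 0 < s, 0 <= t & represents (s *: u + t *: v) p]].

Definition is_open_segment S := exists x y u v,
  [/\ x <> y, represents u x, represents v y & S = open_segment u v].

Definition supporting_hyperplane Omega phi :=
  [/\ phi != 0, hyperplane phi `&` closure Omega !=set0 &
      hyperplane phi `&` Omega = set0].

Definition same_face Omega x y :=
  x = y \/ exists S, [/\ is_open_segment S, S `<=` boundary Omega, S x & S y].

Definition is_face Omega F := exists2 x, boundary Omega x &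
  F = [set y | boundary Omega y /\ same_face Omega x y].

Definition exposed_face Omega F := is_face Omega F /\
  exists2 phi, supporting_hyperplane Omega phi &
    hyperplane phi `&` boundary Omega = closure F.

Definition exposed_boundary Omega := forall x, boundary Omega x ->
  exists2 F, exposed_face Omega F & F x.

(* The cross ratio is computed in any affine chart containing the closure of
   [Omega]; collinear points enter it through ratios of distances along one
   line only, so it does not depend on the norm. The parameters [s <= t] place
   x and y on the segment from a to b, in the order a, x, y, b. When x = y any
   chord through x will do, and the value is 0. *)
Definition is_hilbert_dist Omega x y (r : R) :=
  exists phi a b (s t : R),
    let A := affine_coord phi a in let B := affine_coord phi b in
    let X := affine_coord phi x in let Y := affine_coord phi y in
    [/\ closure Omega `<=` affine_chart phi,
        boundary Omega a /\ boundary Omega b,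
        [/\ 0 < s, s <= t & t < 1],
        X = (1 - s) *: A + s *: B /\ Y = (1 - t) *: A + t *: B &
        r = 2^-1 * ln ((`|A - Y| * `|B - X|) / (`|A - X| * `|B - Y|))].

Definition hilbert_dist Omega x y : R :=
  xget 0 [set r | is_hilbert_dist Omega x y r].

Definition proj_geodesic_ray Omega (c : R -> proj_space R d) :=
  [/\ forall t, 0 <= t -> Omega (c t),
      forall s t, 0 <= s -> 0 <= t -> hilbert_dist Omega (c s) (c t) = `|s - t| &
      exists x y u v, [/\ Omega x, boundary Omega y, represents u x,
        represents v y & c @` `[0, +oo[ = half_open_segment u v]].

Definition quasi_geodesic Omega (lambda a : R) (q : R -> proj_space R d)
    (alpha beta : R) :=
  [/\ alpha <= beta,
      forall t, t \in `[alpha, beta] -> Omega (q t) &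
      forall s t, s \in `[alpha, beta] -> t \in `[alpha, beta] ->
        lambda^-1 * `|s - t| - a <= hilbert_dist Omega (q s) (q t)
          <= lambda * `|s - t| + a].

Definition morse_gauge (M : R -> R -> R) :=
  forall lambda a, 0 <= lambda -> 0 <= a -> 0 <= M lambda a.

Definition morse Omega (M : R -> R -> R) (ell : set (proj_space R d)) :=
  forall (lambda a : R) q alpha beta, 1 <= lambda -> 0 <= a ->
    quasi_geodesic Omega lambda a q alpha beta ->
    ell (q alpha) -> ell (q beta) ->
    forall t, t \in `[alpha, beta] ->
      exists2 p, ell p & hilbert_dist Omega (q t) p < M lambda a.

Definition tracks Omega (r : R) x0 (gamma : nat -> PGL R d)
    (c : R -> proj_space R d) :=
  forall n : nat, hilbert_dist Omega x0 (PGL_act (gamma n)^-1%g (c n%:R)) < r.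

End Projective.

Section Regularity.
Context (R : realType) (d : nat).

Definition is_singular_values (a : 'M[R]_d) (s : seq R) :=
  [/\ sorted >=%R s, all (fun x => 0 <= x) s &
      char_poly (a^T *m a) = \prod_(x <- s) ('X - (x ^+ 2)%:P)].

Definition singular_values (a : 'M[R]_d) : seq R :=
  xget [::] [set s | is_singular_values a s].

(* Singular values are numbered from 1. *)
Definition sigma (i : nat) (a : 'M[R]_d) : R := nth 0 (singular_values a) i.-1.

Definition mu (i j : nat) (g : PGL R d) : R :=
  ln (sigma i (val (repr g)) / sigma j (val (repr g))).

Definition divergent (g : nat -> PGL R d) :=
  forall K : set (PGL R d), compact K -> \forall n \near \oo, ~ K (g n).

Definition strongly_uniformly_regular_with (k : nat) (C N : R)
    (g : nat -> PGL R d) :=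
  [/\ divergent g, 0 < C, 0 < N & forall n m : nat, N < m%:R ->
    C < mu k k.+1 ((g n)^-1 * g (n + m)%N)%g / mu 1 d ((g n)^-1 * g (n + m)%N)%g].

Definition strongly_uniformly_regular (k : nat) (g : nat -> PGL R d) :=
  exists C N : R, strongly_uniformly_regular_with k C N g.

End Regularity.

(* Main.v *)
(* Let C be the open cone over Omega. The Hilbert distance of x, y in C is half the logarithm of
   the least product s t with x <= s y and y <= t x, where u <= v means that v - u lies in the
   closure of C.

   Translate the ray by the inverse of gamma_m, so that its point at time m stays near x0. Strong
   regularity makes mu_(1,2) and mu_(d-1,d) of the matrices g of gamma_m^-1 gamma_n tend to
   infinity with |n - m|, so that, normalized, g and g^-1 become rank one in the limit. The ray
   approaches a limit a of its far points through points z comparable with g x0. Every vector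
   w <= a satisfies w <= z, hence lies in the range of the rank one limit of g, so a is extreme.
   Every functional that is nonnegative on C and vanishes at a lies in the row space of the rank
   one limit of g^-1, so the supporting hyperplane at a is unique. Since the face of a, which is a,
   is exposed, the open segment from a to any other point of the closure of Omega lies in Omega.

   Consequently points whose nearest points on the ray are far apart are joined by segments
   passing near the ray, with uniform constants, because otherwise the previous paragraph applied
   along an ultrafilter would produce a contradiction. So the rays contract uniformly, and a
   contracting ray is Morse. *)

(* The gauge may depend on the ray only through x0, R and the regularity constants, so contraction
   cannot be proved ray by ray. If every constant fails, a sequence of different rays arises, each
   recentred at its own index m; what they share is the function J of [tracked_ray], telling how far
   from m the matrices are of rank one up to a given error. J exists because the displacement of x0
   by g is at most half of log(|g| |g^-1|) up to a constant, hence bounds mu_(1,d) from below, and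
   it is at least |n - m| - 2R. One ultrafilter makes all bounded sequences converge at once.

   The far points c_k of the rays tend to a but need not dominate a in the order of the cone. Hence
   z_k = c_k + eps_k y_k, with y_k the base point and eps_k slightly more than a large multiple of
   |c_k - a|. Then a <= z_k, which serves the extremality of a, while a nonnegative functional
   vanishing at a is O(eps_k) on z_k, which places it in the row space. As z_k is on the ray up to
   scale, it is still comparable with some g_k x0. *)
From Pilot Require Import Defs.
From mathcomp Require Import all_boot all_order all_algebra.
From mathcomp Require Import all_classical all_reals all_analysis.
From mathcomp Require Import ring lra.
Set Implicit Arguments.
Unset Strict Implicit.
Unset Printing Implicit Defensive.
Import Order.TTheory GRing.Theory Num.Theory.
Import numFieldNormedType.Exports.
Local Open Scope classical_set_scope.
Local Open Scope ring_scope.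
Local Open Scope quotient_scope.

(* The unqualified [form] is the one of sesquilinear. *)
Local Notation form := Pilot.Defs.form.

(** * Singular values and matrices close to rank one *)

Section SingularValues.
Context (R : realType).
Implicit Types (d : nat) (s : seq R).

Lemma poly_eq_pos (p q : {poly R}) :
  (forall t, 0 < t -> p.[t] = q.[t]) -> p = q.
Proof.
move=> pq; apply/eqP; rewrite -subr_eq0; apply/negPn/negP => pq0.
pose rs := [seq i.+1%:R : R | i <- iota 0 (size (p - q))].
have urs : uniq rs.
  by rewrite map_inj_uniq ?iota_uniq// => i j /eqP; rewrite eqr_nat => /eqP[].
have/max_poly_roots : all (root (p - q)) rs.
  apply/allP => _ /mapP[i _ ->].
  by rewrite rootE hornerD hornerN pq ?subrr.
by move=> /(_ pq0 urs); rewrite size_map size_iota ltnn.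
Qed.

Lemma horner_char_poly d (M : 'M[R]_d) t : (char_poly M).[t] = \det (t%:M - M).
Proof.
rewrite /char_poly -[LHS]/(horner_eval t _) -det_map_mx; congr (\det _).
apply/matrixP => i j; rewrite !mxE/= /horner_eval !hornerE.
by case: (i == j); rewrite ?mulr1n ?mulr0n ?hornerX ?hornerE.
Qed.

Lemma horner_prod_XsubC s t :
  (\prod_(x <- s) ('X - x%:P)).[t] = \prod_(x <- s) (t - x).
Proof. by rewrite horner_prod; apply: eq_bigr => x _; rewrite !hornerE. Qed.

Lemma size_char_roots d (M : 'M[R]_d) s :
  char_poly M = \prod_(x <- s) ('X - x%:P) -> size s = d.
Proof. by move=> /(congr1 (size \o val))/=; rewrite size_char_poly size_prod_XsubC => -[]. Qed.

Lemma trace_char_roots d (M : 'M[R]_d) s : (0 < d)%N ->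
  char_poly M = \prod_(x <- s) ('X - x%:P) -> \tr M = \sum_(x <- s) x.
Proof.
move=> d0 Ms; have sd := size_char_roots Ms.
have s0 : size s != 0%N by rewrite sd -lt0n.
have := char_poly_trace M d0; rewrite Ms.
have -> : d.-1 = (size s).-1 by rewrite sd.
by rewrite coefPn_prod_XsubC// => /oppr_inj.
Qed.

Lemma prod_oppB s (a : R) :
  \prod_(x <- s) (- a - x) = (-1) ^+ size s * \prod_(x <- s) (a + x).
Proof.
elim: s => [|x s ih]; first by rewrite !big_nil mulr1.
by rewrite !big_cons ih/= exprS; ring.
Qed.

Lemma char_roots_sq d (M : 'M[R]_d) s :
  char_poly M = \prod_(x <- s) ('X - x%:P) ->
  char_poly (M *m M) = \prod_(x <- [seq x ^+ 2 | x <- s]) ('X - x%:P).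
Proof.
move=> Ms; have sd := size_char_roots Ms.
apply: poly_eq_pos => t t0; rewrite horner_prod_XsubC big_map horner_char_poly.
(* Agreement at t > 0 suffices, so t has a root a, and t - M^2 = -(a - M)(-a - M) reduces to the
   characteristic polynomial of M at a and -a. *)
set a := Num.sqrt t.
have at2 : t = a * a by rewrite -expr2 sqr_sqrtr ?ltW.
have -> : t%:M - M *m M = - ((a%:M - M) *m ((- a)%:M - M)).
  rewrite mulmxBl !mulmxBr !mul_scalar_mx mul_mx_scalar scale_scalar_mx mulrN -at2.
  rewrite raddfN/= scaleNr opprB opprD !opprK addrACA addrC.
  by rewrite -addrA addNKr addrC.
rewrite -scaleN1r detZ det_mulmx -!horner_char_poly Ms !horner_prod_XsubC.
rewrite prod_oppB sd mulrCA signrMK -big_split/=.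
by apply: eq_bigr => x _; rewrite at2; ring.
Qed.

Lemma char_roots_inv d (M : 'M[R]_d) s : M \in unitmx ->
  char_poly M = \prod_(x <- s) ('X - x%:P) ->
  char_poly (invmx M) = \prod_(x <- [seq x^-1 | x <- s]) ('X - x%:P).
Proof.
move=> uM Ms; have sd := size_char_roots Ms.
have dM : \det M = \prod_(x <- s) x.
  have := char_poly_det M; rewrite Ms -horner_coef0 horner_prod_XsubC.
  have := prod_oppB s 0; rewrite oppr0 => ->.
  under eq_bigr do rewrite add0r.
  by rewrite sd => /(can_inj (signrMK _)).
have : \det M != 0 by rewrite -unitfE -unitmxE.
rewrite dM => s0.
have {}s0 : all (fun x => x != 0) s.
  by apply/allP => x xs; apply: contraNneq s0 => x0; rewrite prodf_seq_eq0; apply/hasP;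
    exists x => //=; rewrite x0 eqxx.
apply: poly_eq_pos => t t0; rewrite horner_prod_XsubC big_map horner_char_poly.
have -> : t%:M - invmx M = (- t) *: (invmx M *m (t^-1%:M - M)).
  rewrite mulmxBr mulVmx// mul_mx_scalar scalerBr scalerA mulNr divff ?gt_eqF//.
  by rewrite scaleN1r scalemx1 raddfN/= opprK addrC.
rewrite detZ det_mulmx det_inv dM -horner_char_poly Ms horner_prod_XsubC.
move: s0; rewrite -sd; elim: s {Ms sd dM} => [|x s ih]/=; first by rewrite !big_nil;
  rewrite invr1 !mulr1.
move=> /andP[x0 /ih sx]; rewrite !big_cons -sx.
rewrite exprS invfM; set P := (\prod_(j <- s) j)^-1; field.
by rewrite x0 gt_eqF.
Qed.


(** * Approximate rank one, measured by two-by-two minors *)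

Definition minor2 m n (a : 'M[R]_(m, n)) i j k l := a i k * a j l - a i l * a j k.

(** Both sides are quadratic in the entries, so the condition is invariant under scaling. It is
    therefore meaningful on PGL and passes to limits of normalized matrices, where e = 0 says rank
    at most one. *)
Definition nearly_rank1 (e : R) m n (a : 'M[R]_(m, n)) :=
  forall i j k l, `|minor2 a i j k l| <= e * `|a| ^+ 2.

Lemma ler_coord_norm m n (a : 'M[R]_(m, n)) i j : `|a i j| <= `|a|.
Proof.
have -> : `|a| = mx_norm a by [].
rewrite mx_normrE; exact: (@le_bigmax _ _ _ _ (fun ij => `|a ij.1 ij.2|) (i, j)).
Qed.

Lemma mx_norm_le m n (a : 'M[R]_(m, n)) (e : R) : 0 <= e ->
  (forall i j, `|a i j| <= e) -> `|a| <= e.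
Proof.
move=> e0 ae; have -> : `|a| = mx_norm a by [].
by rewrite mx_normrE; apply/bigmax_leP; split => // -[i j] _; exact: ae.
Qed.

(** The squared Frobenius norm, which is also the sum of the squared singular values. It links these
    to [|a|], the largest absolute value of an entry. *)
Lemma mxtrace_gram m n (a : 'M[R]_(m, n)) :
  \tr (a^T *m a) = \sum_j \sum_i a i j ^+ 2.
Proof. by apply: eq_bigr => j _; rewrite mxE; apply: eq_bigr => i _; rewrite mxE. Qed.

Lemma mxtrace_gram_le m n (a : 'M[R]_(m, n)) :
  \tr (a^T *m a) <= (m * n)%:R * `|a| ^+ 2.
Proof.
rewrite mxtrace_gram mulnC natrM -mulrA -[n in n%:R]card_ord -sum1_card natr_sum mulr_suml.
apply: ler_sum => j _; rewrite mul1r -[m in m%:R]card_ord -sum1_card natr_sum mulr_suml.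
apply: ler_sum => i _; rewrite mul1r -real_normK ?num_real// lerXn2r ?nnegrE//.
exact: ler_coord_norm.
Qed.

Lemma mxtrace_gram_ge m n (a : 'M[R]_(m, n)) : `|a| ^+ 2 <= \tr (a^T *m a).
Proof.
have t0 : 0 <= \tr (a^T *m a).
  by rewrite mxtrace_gram; apply: sumr_ge0 => j _; apply: sumr_ge0 => i _; exact: sqr_ge0.
rewrite -(sqr_sqrtr t0) lerXn2r ?nnegrE ?sqrtr_ge0//.
apply: mx_norm_le => [|i j]; first exact: sqrtr_ge0.
rewrite -sqrtr_sqr ler_wsqrtr// mxtrace_gram.
rewrite (bigD1 j)//= (bigD1 i)//= -addrA lerDl.
rewrite addr_ge0//; first by apply: sumr_ge0 => k _; exact: sqr_ge0.
by apply: sumr_ge0 => k _; apply: sumr_ge0 => l _; exact: sqr_ge0.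
Qed.

(* Lagrange's identity, summed over all pairs of columns. *)
Lemma sum_minor2_sq m n (a : 'M[R]_(m, n)) (S := a^T *m a) :
  \sum_k \sum_l \sum_i \sum_j minor2 a i j k l ^+ 2 =
  2 * (\tr S ^+ 2 - \tr (S *m S)).
Proof.
have -> : \tr S ^+ 2 - \tr (S *m S) = \sum_k \sum_l (S k k * S l l - S k l ^+ 2).
  transitivity (\sum_k (S k k * \sum_l S l l - (S *m S) k k)).
    by rewrite sumrB expr2 /mxtrace big_distrl.
  apply: eq_bigr => k _.
  rewrite big_distrr/= sumrB; congr (_ - _).
  by rewrite mxE; apply: eq_bigr => l _; rewrite expr2; congr (_ * _); rewrite !mxE;
    apply: eq_bigr => i _; rewrite !mxE mulrC.
rewrite big_distrr/=; apply: eq_bigr => k _; rewrite big_distrr/=; apply: eq_bigr => l _.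
have Sij p q : S p q = \sum_i a i p * a i q.
  by rewrite mxE; apply: eq_bigr => i _; rewrite mxE.
have -> : 2 * (S k k * S l l - S k l ^+ 2) =
   S k k * S l l + S l l * S k k - (S k l * S k l) *+ 2 by ring.
rewrite !Sij !big_distrl/= -!big_split/= -sumrMnl -sumrB; apply: eq_bigr => i _.
rewrite !big_distrr/= -!big_split/= -sumrMnl -sumrB; apply: eq_bigr => j _.
rewrite /minor2; ring.
Qed.

(** Here x and y are the two largest squared singular values. By Lagrange's identity the squared
    minors sum to 2((x + T)^2 - x^2 - T2), where T and T2 are the sums of the other roots and of
    their squares. As T <= d y, this is at most 2(2d + d^2) x y <= ((2d + 2) e x)^2, and x <= tr(a^T
    a) <= d^2 |a|^2. *)
Lemma nearly_rank1_char_roots d (a : 'M[R]_d) x y s (e : R) :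
  char_poly (a^T *m a) = \prod_(z <- [:: x, y & s]) ('X - z%:P) ->
  (forall z, z \in y :: s -> 0 <= z <= y) -> y <= x -> 0 <= e ->
  y <= e ^+ 2 * x -> nearly_rank1 ((2 * d%:R + 2) * (d * d)%:R * e) a.
Proof.
move=> ch ys yx e0 yex i j k l.
have sd := size_char_roots ch.
have d0 : (0 < d)%N by rewrite -sd.
have y0 : 0 <= y by have /andP[] := ys y (mem_head _ _).
have x0 : 0 <= x by exact: le_trans yx.
have trS := trace_char_roots d0 ch.
have trSS := trace_char_roots d0 (char_roots_sq ch).
have h := sum_minor2_sq a; cbv zeta in h.
rewrite trSS trS big_map !(big_cons _ _ x) /= in h.
have T0 : 0 <= \sum_(z <- y :: s) z.
  by rewrite big_seq; apply: sumr_ge0 => z /ys/andP[].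
have Ty : \sum_(z <- y :: s) z <= d%:R * y.
  apply: (@le_trans _ _ (\sum_(z <- y :: s) y)).
    by rewrite big_seq [leRHS]big_seq; apply: ler_sum => z /ys/andP[].
  by rewrite big_const_seq count_predT iter_addr_0 -[y *+ _]mulr_natl ler_wpM2r// ler_nat -sd.
have T2 : 0 <= \sum_(z <- y :: s) z ^+ 2.
  by apply: sumr_ge0 => z _; exact: sqr_ge0.
have m2 : minor2 a i j k l ^+ 2 <= (2 * (2 * d%:R + d%:R ^+ 2)) * (x * y).
  apply: (@le_trans _ _ (2 * ((x + \sum_(z <- y :: s) z) ^+ 2
      - (x ^+ 2 + \sum_(z <- y :: s) z ^+ 2)))); last first.
    have Tx : \sum_(z <- y :: s) z <= d%:R * x.
      by apply: le_trans Ty _; rewrite ler_wpM2l.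
    have : (\sum_(z <- y :: s) z) ^+ 2 <= (d%:R * x) * (d%:R * y).
      by rewrite expr2 ler_pM.
    have : x * \sum_(z <- y :: s) z <= x * (d%:R * y) by rewrite ler_wpM2l.
    set T := \sum_(z <- _) z; set T' := \sum_(z <- _) _; rewrite -/T' in T2.
    by nra.
  rewrite -h (bigD1 k)//= (bigD1 l)//= (bigD1 i)//= (bigD1 j)//= -!addrA lerDl.
  by rewrite !addr_ge0//; repeat (apply: sumr_ge0 => ? _); exact: sqr_ge0.
have xa : x <= (d * d)%:R * `|a| ^+ 2.
  apply: le_trans (mxtrace_gram_le a); rewrite trS big_cons lerDl//.
have exy : x * y <= (e * x) ^+ 2.
  by rewrite exprMn [x ^+ 2]expr2 mulrA [leRHS]mulrC ler_wpM2l.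
rewrite -ler_sqr ?nnegrE ?real_normK ?num_real//; last first.
  by rewrite !mulr_ge0 ?addr_ge0 ?mulr_ge0 ?ler0n ?sqr_ge0.
apply: le_trans m2 _.
apply: (@le_trans _ _ (((2 * d%:R + 2) * (e * x)) ^+ 2)).
  rewrite exprMn ler_pM ?mulr_ge0 ?addr_ge0 ?sqr_ge0//.
  by have : 0 <= d%:R :> R by []; nra.
rewrite lerXn2r ?nnegrE ?mulr_ge0 ?addr_ge0 ?mulr_ge0 ?sqr_ge0//.
rewrite -!mulrA ler_wpM2l ?addr_ge0 ?mulr_ge0//.
by rewrite mulrCA ler_wpM2l.
Qed.


Lemma nearly_rank1_le m n (a : 'M[R]_(m, n)) (e e' : R) :
  e <= e' -> nearly_rank1 e a -> nearly_rank1 e' a.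
Proof.
move=> ee' ae i j k l; apply: le_trans (ae i j k l) _.
by rewrite ler_wpM2r ?exprn_ge0.
Qed.

Lemma nearly_rank1Z m n (a : 'M[R]_(m, n)) (e k : R) :
  nearly_rank1 e a -> nearly_rank1 e (k *: a).
Proof.
move=> ae i j p q; rewrite normrZ exprMn mulrCA.
have -> : minor2 (k *: a) i j p q = k ^+ 2 * minor2 a i j p q.
  by rewrite /minor2 !mxE; ring.
by rewrite normrM normrX ler_wpM2l ?exprn_ge0.
Qed.

Lemma nearly_rank1_tr m n (a : 'M[R]_(m, n)) (e : R) :
  nearly_rank1 e a^T -> nearly_rank1 e a.
Proof.
move=> ae i j k l; have := ae k l i j.
have -> : `|a^T| = `|a|.
  by apply/eqP; rewrite eq_le; apply/andP; split; apply: mx_norm_le => // p q;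
    rewrite ?mxE ?ler_coord_norm//; have := ler_coord_norm a^T q p; rewrite mxE.
by rewrite /minor2 !mxE [a j k * _]mulrC.
Qed.

Lemma invmx_mul d (a b : 'M[R]_d) : a \in unitmx -> b \in unitmx ->
  invmx (a *m b) = invmx b *m invmx a.
Proof.
move=> ua ub; apply: (can_inj (mulKmx (_ : a *m b \in unitmx))).
  by rewrite unitmx_mul ua.
by rewrite mulmxV ?unitmx_mul ?ua// mulmxA mulmxK// mulmxV.
Qed.

Definition rank1_cst d : R := (2 * d%:R + 2) * (d * d)%:R.

Lemma sorted_sv_bounds s x0 : sorted >=%R s -> (forall x, x \in s -> 0 < x) ->
  forall i j, (i <= j < size s)%N -> 0 < nth x0 s j <= nth x0 s i.
Proof.
move=> ss s0 i j /andP[ij js]; apply/andP; split; first by apply/s0/mem_nth.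
by apply: (sorted_leq_nth ge_trans ge_refl) => //; rewrite inE ?(leq_ltn_trans ij).
Qed.

(** L is mu_(1,d). The hypotheses say that sigma_2/sigma_1 < exp(-C1 L) and sigma_d/sigma_(d-1) <
    exp(-C2 L), and the inverse has the singular values 1/sigma_i in reverse order. The last clause
    turns a lower bound for |a| |a^-1| into one for L. *)
Lemma mu_ratio_nearly_rank1 d (a : 'M[R]_d) (C1 C2 L : R) :
  L = ln (sigma 1 a / sigma d a) -> (1 < d)%N -> a \in unitmx ->
  0 < C1 -> 0 < C2 ->
  C1 < ln (sigma 1 a / sigma 2 a) / L ->
  C2 < ln (sigma d.-1 a / sigma d a) / L ->
  [/\ nearly_rank1 (rank1_cst d * expR (- (C1 * L))) a,
      nearly_rank1 (rank1_cst d * expR (- (C2 * L))) (invmx a) &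
      `|a| * `|invmx a| <= d%:R * expR L].
Proof.
case: d a => [|[|d]]// a LE _ ua C10 C20 h1 h2.
rewrite /sigma/= in LE h1 h2.
(* Existence of singular values is read off the hypothesis: [singular_values] defaults to the empty
   list, every [sigma] is then 0, and C1 < 0 would follow. *)
have svP : is_singular_values a (singular_values a).
  have [svE|nsv] := pselect ([set s | is_singular_values a s] !=set0).
    exact: xgetPex svE.
  move: h1; rewrite LE /singular_values xgetPN ?nth_nil; last first.
    by move=> s svs; apply: nsv; exists s.
  by rewrite !mul0r !ln0// invr0 mulr0 ltNge ltW.
set s := singular_values a in svP LE h1 h2 *; case: svP => ss s0 ch.
have {}ch : char_poly (a^T *m a) = \prod_(x <- [seq x ^+ 2 | x <- s]) ('X - x%:P).
  by rewrite big_map.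
have sz : size s = d.+2 by rewrite -(size_char_roots ch) size_map.
have uS : a^T *m a \in unitmx by rewrite unitmx_mul unitmx_tr ua.
have {}s0 x : x \in s -> 0 < x.
  move=> xs; rewrite lt0r (allP s0 _ xs) andbT; apply/negP => /eqP x0.
  move: uS; rewrite unitmxE unitfE => /negP; apply.
  have : (char_poly (a^T *m a)).[0] == 0.
    by rewrite ch -rootE root_prod_XsubC; apply/mapP; exists x => //; rewrite x0 expr0n.
  by rewrite horner_char_poly raddf0 sub0r -scaleN1r detZ mulf_eq0 signr_eq0.
have sb := @sorted_sv_bounds s 0 ss s0.
have s1s : (0 < size s)%N by rewrite sz.
have /andP[sd0 sd1] : 0 < nth 0 s d.+1 <= nth 0 s 0 by rewrite sb// sz leqnn.
(* If L = 0 the quotients by L are 0, against C1 > 0. *)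
have L0 : 0 < L.
  have : 0 <= L by rewrite LE ln_ge0// ler_pdivlMr// mul1r.
  rewrite le_eqVlt => /predU1P[L0|//].
  by move: h1; rewrite -L0 invr0 mulr0 ltNge ltW.
have ratio (C x y : R) : 0 < y -> y <= x -> C < ln (x / y) / L -> y ^+ 2 <= expR (- (C * L)) ^+ 2
  * x ^+ 2.
  move=> y0 yx; have x0 := lt_le_trans y0 yx.
  rewrite ltr_pdivlMr// => h.
  rewrite -exprMn lerXn2r ?nnegrE ?mulr_ge0 ?expR_ge0 ?(ltW y0) ?(ltW x0)//.
  rewrite -ler_pdivrMr// -[y / x]lnK ?posrE ?divr_gt0// ler_expR -invf_div lnV ?posrE ?divr_gt0//.
  by rewrite lerN2 ltW.
have /andP[s10 s11] : 0 < nth 0 s 1 <= nth 0 s 0 by rewrite sb// sz.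
have /andP[se0 se1] : 0 < nth 0 s d.+1 <= nth 0 s d by rewrite sb// sz leqnSn ltnSn.
have behead_bounds (t : seq R) : sorted >=%R t -> forall z, z \in drop 1 t -> z <= nth 0 t 1.
  move=> st z /(nthP 0)[i]; rewrite size_drop ltn_subRL => it <-.
  rewrite nth_drop; apply: (sorted_leq_nth ge_trans ge_refl) => //; rewrite inE//.
  by apply: leq_ltn_trans it.
have drop2 (t : seq R) : size t = d.+2 -> t = [:: nth 0 t 0, nth 0 t 1 & drop 2 t].
  by case: t => [|x [|y t]]//= _; rewrite drop0.
have drop1E (t : seq R) : size t = d.+2 -> drop 1 t = nth 0 t 1 :: drop 2 t.
  by case: t => [|x [|y t]]//= _; rewrite drop0.
have le_sq (x y : R) : 0 < y -> y <= x -> y ^+ 2 <= x ^+ 2.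
  by move=> y0 yx; rewrite lerXn2r ?nnegrE ?(ltW y0)// ltW// (lt_le_trans y0).
split.
- pose t := [seq x ^+ 2 | x <- s].
  have st : size t = d.+2 by rewrite size_map.
  have te i : (i < size s)%N -> nth 0 t i = nth 0 s i ^+ 2 by move=> i2; rewrite (nth_map 0).
  have sorted_t : sorted >=%R t.
    rewrite sorted_map; apply: (sub_in_sorted (P := [in s]) _ (allss s) ss) => x y /s0 x0 /s0 y0
      /= yx.
    by rewrite lerXn2r ?nnegrE ?(ltW x0) ?(ltW y0).
  move: ch; rewrite -/t (drop2 t st) => ch; apply: nearly_rank1_char_roots ch _ _ _ _.
  + move=> z zt; rewrite behead_bounds ?drop1E// andbT.
    have : z \in t by rewrite [t](drop2 t st) inE zt orbT.
    by move=> /mapP[x _ ->]; rewrite sqr_ge0.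
  + by rewrite !te ?sz// le_sq.
  + exact: expR_ge0.
  + by rewrite !te ?sz//; exact: ratio.
- pose t := rev [seq (x ^+ 2)^-1 | x <- s].
  have st : size t = d.+2 by rewrite size_rev size_map.
  have te i : (i < size s)%N -> nth 0 t i = (nth 0 s (d.+1 - i) ^+ 2)^-1.
    by move=> i2; rewrite nth_rev ?size_map// (nth_map 0) ?sz ?subSS ?ltnS ?leq_subr.
  have sorted_t : sorted >=%R t.
    rewrite rev_sorted sorted_map;
      apply: (sub_in_sorted (P := [in s]) _ (allss s) ss) => x y /s0 x0 /s0 y0 /= yx.
    by rewrite lef_pV2 ?posrE ?exprn_gt0// lerXn2r ?nnegrE ?(ltW x0) ?(ltW y0).
  (* The Gram matrix of a^-T is the inverse of a^T a, while that of a^-1 is the inverse of a a^T;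
     hence the detour through the transpose. *)
  apply: nearly_rank1_tr; rewrite trmx_inv.
  have : char_poly (((invmx a^T)^T) *m invmx a^T) = \prod_(x <- t) ('X - x%:P).
    rewrite trmx_inv trmxK -invmx_mul ?unitmx_tr// (char_roots_inv uS ch) -map_comp.
    by apply: perm_big; rewrite perm_sym perm_rev.
  rewrite -/t (drop2 t st) => ch'; apply: nearly_rank1_char_roots ch' _ _ _ _.
  + move=> z zt; rewrite behead_bounds ?drop1E// andbT.
    have : z \in t by rewrite [t](drop2 t st) inE zt orbT.
    by rewrite mem_rev => /mapP[x _ ->]; rewrite invr_ge0 sqr_ge0.
  + by rewrite !te ?sz// subn0 subn1/= lef_pV2 ?posrE ?exprn_gt0 ?(lt_le_trans se0)// le_sq.
  + exact: expR_ge0.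
  + rewrite !te ?sz// subn0 subn1/= -!exprVn; apply: ratio.
    * by rewrite invr_gt0 (lt_le_trans se0).
    * by rewrite lef_pV2 ?posrE// (lt_le_trans se0).
    * by rewrite invrK [X in ln X]mulrC.
- have n1 : `|a| ^+ 2 <= d.+2%:R * nth 0 s 0 ^+ 2.
    apply: le_trans (mxtrace_gram_ge a) _.
    rewrite (trace_char_roots _ ch)// big_map (big_nth 0) big_mkord.
    apply: le_trans (_ : \sum_(i < size s) nth 0 s 0 ^+ 2 <= _).
      apply: ler_sum => i _; have /andP[z0 z1] := sb 0%N i (ltn_ord i).
      exact: le_sq.
    by rewrite sumr_const card_ord sz mulr_natl.
  have n2 : `|invmx a| ^+ 2 <= d.+2%:R * (nth 0 s d.+1)^-1 ^+ 2.
    apply: le_trans (mxtrace_gram_ge _) _.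
    have ch' := char_roots_inv uS ch.
    have -> : \tr ((invmx a)^T *m invmx a) = \tr (invmx (a^T *m a)).
      by rewrite mxtrace_mulC invmx_mul ?unitmx_tr// trmx_inv.
    rewrite (trace_char_roots _ ch')// !big_map (big_nth 0) big_mkord.
    apply: le_trans (_ : \sum_(i < size s) (nth 0 s d.+1)^-1 ^+ 2 <= _).
      apply: ler_sum => i _.
      have li : (i < d.+2)%N by rewrite -[X in (_ < X)%N]sz.
      have /andP[z0 z1] : 0 < nth 0 s d.+1 <= nth 0 s i.
        by apply: sb; rewrite -ltnS li sz /=.
      by rewrite exprVn lef_pV2 ?posrE ?exprn_gt0 ?(lt_le_trans z0)// le_sq.
    by rewrite sumr_const card_ord sz mulr_natl.
  rewrite -ler_sqr ?nnegrE ?mulr_ge0 ?expR_ge0// [leLHS]exprMn.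
  apply: le_trans (ler_pM _ _ n1 n2) _; rewrite ?exprn_ge0//.
  by rewrite LE lnK ?posrE ?divr_gt0 ?(lt_le_trans sd0)// exprMn expr_div_n exprVn mulrACA.
Qed.
End SingularValues.

(** * Open proper cones and the Hilbert metric *)

Section MatrixLimits.
Context (R : realType).

Lemma cvg_mxP T (F : set_system T) {FF : Filter F} m n
    (f : T -> 'M[R]_(m, n)) (l : 'M[R]_(m, n)) :
  f @ F --> l <-> forall i j, f t i j @[t --> F] --> l i j.
Proof.
split=> [fl i j|fl].
  by apply: (@cvg_comp _ _ _ f (fun M : 'M[R]_(m, n) => M i j) _ _ _ fl); exact: coord_continuous.
move=> A [P lP PA]; apply: (filterS (P := [set t | forall i j, P i j (f t i j)])).
  by move=> t Pt; exact: PA.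
apply: filter_forall => i; apply: filter_forall => j; exact: fl (lP i j).
Qed.

Lemma cvg_mulmx T (F : set_system T) {FF : Filter F} m n p
    (f : T -> 'M[R]_(m, n)) (g : T -> 'M[R]_(n, p)) (a : 'M[R]_(m, n)) (b : 'M[R]_(n, p)) :
  f @ F --> a -> g @ F --> b -> f t *m g t @[t --> F] --> a *m b.
Proof.
move=> /cvg_mxP fa /cvg_mxP gb; apply/cvg_mxP => i j; rewrite mxE.
under eq_fun do rewrite mxE.
apply: cvg_big => [|k _]; first exact: add_continuous.
by apply: cvgM; [exact: fa|exact: gb].
Qed.

Lemma cvg_form T (F : set_system T) {FF : Filter F} d (phi : 'rV[R]_d)
    (f : T -> 'cV[R]_d) (v : 'cV[R]_d) :
  f @ F --> v -> form phi (f t) @[t --> F] --> form phi v.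
Proof. by move=> fv; apply: (cvg_mxP _ _).1 (cvg_mulmx _ fv) 0 0; exact: cvg_cst. Qed.

(** Limits along an ultrafilter replace the extraction of successive subsequences: every bounded
    sequence converges along the same U. *)
Lemma ultra_cvg_segment (U : set_system nat) (f : nat -> R) (B : R) :
  UltraFilter U -> (\forall k \near U, `|f k| <= B) -> exists l : R, f @ U --> l.
Proof.
move=> UU fB; have Bc : compact `[- B, B] by exact: segment_compact.
have [l [_ cl]] : `[- B, B] `&` cluster (f @ U) !=set0.
  by apply: Bc; apply: filterS fB => k /=; rewrite in_itv/= ler_norml.
exists l => A lA; have [//|UA] := in_ultra_setVsetC (f @^-1` A) UU.
by have [x [/= nA /nA]] := cl (~` A) A UA lA.
Qed.

Lemma ultra_cvg_bounded (U : set_system nat) m n (f : nat -> 'M[R]_(m, n)) (B : R) :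
  UltraFilter U -> (\forall k \near U, `|f k| <= B) -> exists l : 'M[R]_(m, n), f @ U --> l.
Proof.
move=> UU fB.
have /choice[l lP] (ij : 'I_m * 'I_n) : exists l : R, f t ij.1 ij.2 @[t --> U] --> l.
  apply: (@ultra_cvg_segment _ _ B); apply: filterS fB => k; apply: le_trans.
  exact: ler_coord_norm.
exists (\matrix_(i, j) l (i, j)); apply/cvg_mxP => i j; rewrite mxE.
exact: lP (i, j).
Qed.

End MatrixLimits.

Section Form.
Context (R : realType) (d : nat).
Implicit Types (phi : 'rV[R]_d) (u v : 'cV[R]_d).

Lemma lformD phi u v : form phi (u + v) = form phi u + form phi v.
Proof. by rewrite /form mulmxDr mxE. Qed.

Lemma lformZ phi k v : form phi (k *: v) = k * form phi v.
Proof. by rewrite /form -scalemxAr mxE. Qed.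

Lemma lformN phi v : form phi (- v) = - form phi v.
Proof. by rewrite /form mulmxN mxE. Qed.

Lemma lformB phi u v : form phi (u - v) = form phi u - form phi v.
Proof. by rewrite lformD lformN. Qed.

Lemma lform0 phi : form phi 0 = 0.
Proof. by rewrite /form mulmx0 mxE. Qed.

Lemma lformNl phi v : form (- phi) v = - form phi v.
Proof. by rewrite /form mulNmx mxE. Qed.

End Form.

(* For a nonempty open convex cone, this is its topological closure. *)
Definition closed_cone (R : realType) d (Co : set 'cV[R]_d) : set 'cV[R]_d :=
  [set v | forall w, Co w -> Co (v + w)].

(** [cone_form] and [cone_norm] together say that the slice [form phi = 1] is bounded. This excludes
    lines in the closure and makes normalized sequences converge. *)
Record proper_cone (R : realType) d (Co : set 'cV[R]_d) (phi : 'rV[R]_d) : Prop :=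
  ProperCone {
    cone_nonempty : Co !=set0;
    cone_open : open Co;
    cone_add : forall u v, Co u -> Co v -> Co (u + v);
    cone_scale : forall k v, 0 < k -> Co v -> Co (k *: v);
    cone_form : forall v, Co v -> 0 < form phi v;
    cone_norm : exists K, forall v, Co v -> `|v| <= K * form phi v }.

Definition cone_aut (R : realType) d (Co : set 'cV[R]_d) (a : 'M[R]_d) :=
  a \in unitmx /\ forall v, Co (a *m v) <-> Co v.

Lemma mulr2_half (R : realType) (x : R) : 2 * x / 2 = x.
Proof. by rewrite mulrAC mulfV ?mul1r// pnatr_eq0. Qed.

Section Cone.
Context (R : realType) (d : nat) (Co : set 'cV[R]_d) (phi : 'rV[R]_d).
Hypothesis pc : proper_cone Co phi.
Local Notation Cb := (closed_cone Co).
Implicit Types (u v w x y z : 'cV[R]_d) (a : 'M[R]_d).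

Lemma cone_ball w : Co w -> exists2 e : R, 0 < e & forall v, `|v| < e -> Co (w + v).
Proof.
move=> Cw; have := cone_open pc; rewrite openE => /(_ _ Cw) /nbhs_ballP[e e0 eC].
exists e => // v ve; apply: eC; rewrite -ball_normE /ball_/=.
by rewrite opprD addrA subrr sub0r normrN.
Qed.

Lemma cone_small w v : Co w -> exists2 e : R, 0 < e & Co (w - e *: v).
Proof.
move=> /cone_ball[e e0 ew].
have v0 : 0 < 1 + `|v| by have := normr_ge0 v; lra.
exists (e / (1 + `|v|)); first by rewrite divr_gt0.
apply: ew; rewrite normrN normrZ ger0_norm ?divr_ge0 ?ltW//.
by rewrite mulrAC ltr_pdivrMr// ltr_pM2l// ltrDr.
Qed.

Lemma closed_cone_Co v : Co v -> Cb v.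
Proof. by move=> Cv w; exact: (cone_add pc). Qed.

Lemma closed_cone0 : Cb 0.
Proof. by move=> w; rewrite add0r. Qed.

Lemma closed_coneD u v : Cb u -> Cb v -> Cb (u + v).
Proof. by move=> Cu Cv w Cw; rewrite -addrA; exact/Cu/Cv. Qed.

Lemma closed_coneZ k v : 0 <= k -> Cb v -> Cb (k *: v).
Proof.
rewrite le_eqVlt => /predU1P[<- _|k0 Cv w Cw]; first by rewrite scale0r; exact: closed_cone0.
have -> : k *: v + w = k *: (v + k^-1 *: w).
  by rewrite scalerDr scalerA divff ?scale1r// gt_eqF.
by apply: (cone_scale pc) => //; apply: Cv; apply: (cone_scale pc); rewrite ?invr_gt0.
Qed.

Lemma closed_cone_eps v y : (forall e, 0 < e -> Cb (v + e *: y)) -> Cb v.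
Proof.
move=> vy w Cw; have [e e0 we] := cone_small y Cw.
by have := vy e e0 _ we; rewrite addrACA subrr addr0.
Qed.

Lemma closed_cone_cvg T (F : set_system T) {FF : ProperFilter F} (f : T -> 'cV[R]_d) v :
  f @ F --> v -> (\forall t \near F, Cb (f t)) -> Cb v.
Proof.
move=> fv fC w Cw; have [e e0 we] := cone_ball Cw.
have /cvgrPdist_lt/(_ e e0) fe := fv.
have [t [tC te]] := filter_ex (filterI fC fe).
rewrite -[v](subrKC (f t)) -addrA; apply: tC.
by rewrite addrC; apply: we.
Qed.

Lemma closed_cone_bound : exists2 K, 0 < K & forall v, Cb v -> `|v| <= K * form phi v.
Proof.
have [K KP] := cone_norm pc; exists (1 + `|K|) => [|v Cv]; first by rewrite ltr_pwDl.
have [e Ce] := cone_nonempty pc.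
have K' w : Co w -> `|w| <= (1 + `|K|) * form phi w.
  move=> Cw; apply: le_trans (KP _ Cw) _.
  rewrite ler_wpM2r ?(ltW (cone_form pc Cw))//.
  by apply: le_trans (ler_norm _) _; rewrite lerDr.
apply/ler_addgt0Pr => t t0.
pose c := `|e| + (1 + `|K|) * form phi e.
have c0 : 0 <= c by rewrite addr_ge0// mulr_ge0 ?addr_ge0// ltW// (cone_form pc).
pose s := t / (1 + c).
have s0 : 0 < s by rewrite divr_gt0// ltr_pwDl.
have /K' : Co (v + s *: e) by apply: Cv; exact: (cone_scale pc).
rewrite lformD lformZ => h.
have : `|v| <= `|v + s *: e| + s * `|e|.
  have -> : s * `|e| = `|s *: e| by rewrite normrZ gtr0_norm.
  by rewrite -{1}[v](addrK (s *: e)) ler_normB.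
have : s * c <= t by rewrite /s mulrAC ler_pdivrMr ?ltr_pwDl// ler_wpM2l ?ltW// ltrDr.
by rewrite /c; nra.
Qed.

Lemma closed_cone_form v : Cb v -> 0 <= form phi v.
Proof.
have [K K0 KP] := closed_cone_bound => /KP vK.
by rewrite -(pmulr_rge0 _ K0) (le_trans _ vK).
Qed.

Lemma closed_cone_eq0 v : Cb v -> form phi v = 0 -> v = 0.
Proof.
have [K K0 KP] := closed_cone_bound => /KP + v0.
by rewrite v0 mulr0 normr_le0 => /eqP.
Qed.

Lemma closed_cone_anti v : Cb v -> Cb (- v) -> v = 0.
Proof.
move=> Cv /closed_cone_form; rewrite lformN oppr_ge0 => v0.
by apply: closed_cone_eq0 => //; apply/le_anti; rewrite v0 closed_cone_form.
Qed.

Lemma cone_neq0 v : Co v -> v != 0.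
Proof. by move=> /(cone_form pc); apply: contraTneq => ->; rewrite lform0 ltxx. Qed.

Lemma cone_closedD u v : Co u -> Cb v -> Co (u + v).
Proof. by move=> Cu Cv; rewrite addrC; exact: Cv. Qed.

Lemma closed_cone_le k l v : k <= l -> Cb v -> Cb (l *: v - k *: v).
Proof. by move=> kl Cv; rewrite -scalerBl; apply: closed_coneZ; rewrite ?subr_ge0. Qed.

Lemma closed_cone_trans y x z : Cb (y - x) -> Cb (z - y) -> Cb (z - x).
Proof. by move=> xy yz; rewrite -(subrKA y); exact: closed_coneD. Qed.

(** Interior points are order units: if the ball of radius t about e lies in Co, then k = 2/t works.
    This turns norm estimates into inequalities for the order of the cone. *)
Lemma cone_unit_bound e : Co e ->
  exists2 k : R, 0 < k & forall v, Cb ((k * `|v|) *: e - v).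
Proof.
move=> /cone_ball[t t0 et]; exists (2 / t) => [|v]; first by rewrite divr_gt0.
have [->|v0] := eqVneq v 0; first by rewrite normr0 mulr0 scale0r subr0; exact: closed_cone0.
have nv : 0 < `|v| by rewrite normr_gt0.
have -> : (2 / t * `|v|) *: e - v = (2 / t * `|v|) *: (e - (t / 2 / `|v|) *: v).
  rewrite scalerBr scalerA -[X in _ - X = _]scale1r; congr (_ - _ *: _).
  by field; rewrite !gt_eqF.
apply/closed_cone_Co/(cone_scale pc); first by rewrite !mulr_gt0 ?invr_gt0.
apply: et; rewrite normrN normrZ gtr0_norm ?divr_gt0// divfK ?gt_eqF//; lra.
Qed.

Lemma cone_cvg_near T (F : set_system T) {FF : Filter F} (f : T -> 'cV[R]_d) y e :
  Co y -> f @ F --> y -> exists2 t : R, 0 < t & \forall k \near F, Co (f k - t *: e).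
Proof.
move=> Cy fy; have [t t0 yt] := cone_small e Cy; exists t => //.
have [r r0 ry] := cone_ball yt; have /cvgrPdist_lt/(_ r r0) := fy.
apply: filterS => k fk; have -> : f k - t *: e = y - t *: e + (f k - y).
  by rewrite addrAC addrCA subrr addr0.
by apply: ry; rewrite distrC.
Qed.

(** * Gauges and the Hilbert metric of a cone *)

Definition gauge x y : R := inf [set s : R | Cb (s *: y - x)].

Lemma gaugeP x y : Co x -> Co y ->
  [/\ Cb (gauge x y *: y - x), 0 < gauge x y &
      forall s, Cb (s *: y - x) -> gauge x y <= s].
Proof.
move=> Cx Cy; set A := [set s : R | Cb (s *: y - x)].
have Alb s : A s -> form phi x / form phi y <= s.
  move=> /closed_cone_form; rewrite lformB lformZ subr_ge0.
  by rewrite ler_pdivrMr// (cone_form pc).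
have A0 : A !=set0.
  by have [k _ kP] := cone_unit_bound Cy; exists (k * `|x|); exact: kP.
have Ainf : has_inf A by split => //; exists (form phi x / form phi y) => s /Alb.
have gle s : A s -> gauge x y <= s by move=> As; apply: ge_inf => //; case: Ainf.
split => //.
- apply: (@closed_cone_eps _ y) => t t0.
  have [s As sg] := inf_adherent t0 Ainf.
  have := closed_coneD (closed_cone_le (ltW sg) (closed_cone_Co Cy)) As.
  by rewrite subrKA scalerDl addrAC.
- apply: lt_le_trans (_ : form phi x / form phi y <= _).
    by rewrite divr_gt0// (cone_form pc).
  by apply: lb_le_inf => // s /Alb.
Qed.

Definition hd x y : R := ln (gauge x y * gauge y x) / 2.

Lemma hdC x y : hd x y = hd y x.
Proof. by rewrite /hd [gauge x y * _]mulrC. Qed.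

Lemma gauge_ge1 x y : Co x -> Co y -> 1 <= gauge x y * gauge y x.
Proof.
move=> Cx Cy; have [g1 g0 _] := gaugeP Cx Cy; have [h1 h0 _] := gaugeP Cy Cx.
have : Cb ((gauge x y * gauge y x) *: x - x).
  by rewrite -scalerA; apply: closed_cone_trans g1 _; rewrite -scalerBr; exact/closed_coneZ/h1/ltW.
move/closed_cone_form; rewrite lformB lformZ -{2}[form phi x]mul1r -mulrBl.
by rewrite pmulr_lge0 ?subr_ge0// (cone_form pc).
Qed.

Lemma hd_ge0 x y : Co x -> Co y -> 0 <= hd x y.
Proof. by move=> Cx Cy; rewrite /hd divr_ge0// ln_ge0// gauge_ge1. Qed.

Lemma hd_le x y s t : Co x -> Co y -> Cb (s *: y - x) -> Cb (t *: x - y) ->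
  hd x y <= ln (s * t) / 2.
Proof.
move=> Cx Cy xy yx; have [_ g0 /(_ _ xy) gs] := gaugeP Cx Cy.
have [_ h0 /(_ _ yx) ht] := gaugeP Cy Cx.
rewrite /hd ler_pM2r ?invr_gt0// ler_ln ?posrE ?mulr_gt0 ?(lt_le_trans g0 gs) ?(lt_le_trans h0
  ht)//.
exact: (ler_pM (ltW g0) (ltW h0)).
Qed.

Lemma hdP x y : Co x -> Co y -> exists s t, [/\ 0 < s, 0 < t,
  Cb (s *: y - x), Cb (t *: x - y) & s * t = expR (2 * hd x y)].
Proof.
move=> Cx Cy; have [g1 g0 _] := gaugeP Cx Cy; have [h1 h0 _] := gaugeP Cy Cx.
exists (gauge x y), (gauge y x); split=> //.
by rewrite /hd [2 * _]mulrC divfK// lnK// posrE mulr_gt0.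
Qed.

Lemma hdxx x : Co x -> hd x x = 0.
Proof.
move=> Cx; apply/le_anti; rewrite hd_ge0// andbT.
have C0 : Cb (1 *: x - x) by rewrite scale1r subrr; exact: closed_cone0.
by apply: le_trans (hd_le Cx Cx C0 C0) _; rewrite mulr1 ln1 mul0r.
Qed.

Lemma hd_trans y x z : Co x -> Co y -> Co z -> hd x z <= hd x y + hd y z.
Proof.
move=> Cx Cy Cz; have [s [t [s0 t0 xy yx st]]] := hdP Cx Cy.
have [s' [t' [s'0 t'0 yz zy st']]] := hdP Cy Cz.
apply: le_trans (hd_le (s := s * s') (t := t' * t) Cx Cz _ _) _.
- by rewrite -scalerA; apply: closed_cone_trans xy _; rewrite -scalerBr; exact/closed_coneZ/yz/ltW.
- by rewrite -scalerA; apply: closed_cone_trans zy _; rewrite -scalerBr; exact/closed_coneZ/yx/ltW.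
have -> : s * s' * (t' * t) = (s * t) * (s' * t') by ring.
rewrite st st' -expRD expRK -mulrDr mulr2_half; exact: lexx.
Qed.

Lemma hdZl k x y : 0 < k -> Co x -> Co y -> hd (k *: x) y = hd x y.
Proof.
move=> k0 Cx Cy; have Ckx := cone_scale pc k0 Cx.
have h l u : 0 < l -> Co u -> hd (l *: u) u <= 0.
  move=> l0 Cu; apply: le_trans (hd_le (s := l) (t := l^-1) (cone_scale pc l0 Cu) Cu _ _) _.
  - by rewrite subrr; exact: closed_cone0.
  - by rewrite scalerA mulVf ?gt_eqF// scale1r subrr; exact: closed_cone0.
  - by rewrite divff ?gt_eqF// ln1 mul0r.
apply/le_anti/andP; split.
  by apply: le_trans (hd_trans Ckx Cx Cy) _; rewrite gerDr h.
by apply: le_trans (hd_trans Cx Ckx Cy) _; rewrite hdC gerDr h.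
Qed.

Lemma hdZr k x y : 0 < k -> Co x -> Co y -> hd x (k *: y) = hd x y.
Proof. by move=> k0 Cx Cy; rewrite hdC (hdZl k0 Cy Cx); exact: hdC. Qed.

Lemma cone_aut_closed a v : cone_aut Co a -> Cb (a *m v) <-> Cb v.
Proof.
move=> [ua aC]; split=> Cv w Cw.
  by apply/aC; rewrite mulmxDr; apply: Cv; apply/aC.
by rewrite -(mulKVmx ua w) -mulmxDr; apply/aC/Cv/aC; rewrite mulKVmx.
Qed.

Lemma cone_autV a : cone_aut Co a -> cone_aut Co (invmx a).
Proof.
move=> [ua aC]; split=> [|v]; first by rewrite unitmx_inv.
by rewrite -aC mulKVmx.
Qed.

Lemma hd_aut a x y : cone_aut Co a -> Co x -> Co y -> hd (a *m x) (a *m y) = hd x y.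
Proof.
suff h b u v : cone_aut Co b -> Co u -> Co v -> hd (b *m u) (b *m v) <= hd u v.
  move=> ca Cx Cy; apply/le_anti; rewrite h//=.
  have := h _ (a *m x) (a *m y) (cone_autV ca); case: ca => ua aC.
  by rewrite !mulKmx//; apply; apply/aC.
move=> cb Cu Cv; have [s [t [s0 t0 uv vu st]]] := hdP Cu Cv; have [ub bC] := cb.
apply: le_trans (hd_le (s := s) (t := t) _ _ _ _) _; try exact/bC.
- by rewrite scalemxAr -mulmxBr; apply/cone_aut_closed.
- by rewrite scalemxAr -mulmxBr; apply/cone_aut_closed.
- rewrite st expRK mulr2_half; exact: lexx.
Qed.

(** Segments are geodesics. If g and h are least with x <= g y and y <= h x, then z = s x + t y
    satisfies x <= g/(t + s g) z, z <= (s + t h) x, z <= (t + s g) y and y <= h/(s + t h) z, and the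
    four factors multiply to g h. *)
Lemma hd_segment x y s t : Co x -> Co y -> 0 <= s -> 0 <= t -> Co (s *: x + t *: y) ->
  hd x (s *: x + t *: y) + hd (s *: x + t *: y) y <= hd x y.
Proof.
move=> Cx Cy s0 t0; set z := _ + _ => Cz.
have [g1 g0 _] := gaugeP Cx Cy; have [h1 h0 _] := gaugeP Cy Cx.
rewrite {3}/hd; set g := gauge x y in g1 g0 *; set h := gauge y x in h1 h0 *.
have st : 0 < s + t.
  rewrite lt0r addr_ge0// andbT; apply/negP => /eqP st0.
  have sE : s = 0 by lra. have tE : t = 0 by lra.
  by have := cone_neq0 Cz; rewrite /z sE tE !scale0r addr0 eqxx.
have p0 : 0 < t + s * g by nra.
have q0 : 0 < s + t * h by nra.
have h1z : hd x z <= ln (g / (t + s * g) * (s + t * h)) / 2.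
  apply: hd_le => //.
    have -> : g / (t + s * g) *: z - x = (t / (t + s * g)) *: (g *: y - x).
      rewrite /z scalerDr scalerBr !scalerA addrAC -[x in - x]scale1r -scalerBl addrC.
      rewrite -scaleNr; congr (_ *: _ + _ *: _); field; exact: lt0r_neq0.
    by apply: closed_coneZ => //; rewrite divr_ge0// ltW.
  have -> : (s + t * h) *: x - z = t *: (h *: x - y).
    by rewrite /z scalerDl scalerBr scalerA opprD addrACA subrr add0r.
  exact: closed_coneZ.
have h2z : hd z y <= ln ((t + s * g) * (h / (s + t * h))) / 2.
  apply: hd_le => //.
    have -> : (t + s * g) *: y - z = s *: (g *: y - x).
      by rewrite /z [_ + s * g]addrC scalerDl scalerBr scalerA opprD addrACA subrr addr0.
    exact: closed_coneZ.
  have -> : h / (s + t * h) *: z - y = (s / (s + t * h)) *: (h *: x - y).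
    rewrite /z scalerDr scalerBr !scalerA -addrA -[y in - y]scale1r -scalerBl.
    rewrite -scaleNr; congr (_ *: _ + _ *: _); field; exact: lt0r_neq0.
  by apply: closed_coneZ => //; rewrite divr_ge0// ltW.
apply: le_trans (lerD h1z h2z) _.
rewrite -mulrDl -lnM ?posrE ?mulr_gt0 ?invr_gt0//.
have -> // : g / (t + s * g) * (s + t * h) * ((t + s * g) * (h / (s + t * h))) = g * h.
by field; rewrite !lt0r_neq0.
Qed.

End Cone.

(** * Separation and limits of rank one *)

Section RankOne.
Context (R : realType).

Lemma cvg_minor2 T (F : set_system T) {FF : Filter F} m n
    (f : T -> 'M[R]_(m, n)) (a : 'M[R]_(m, n)) i j k l :
  f @ F --> a -> minor2 (f t) i j k l @[t --> F] --> minor2 a i j k l.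
Proof. by move=> /cvg_mxP fa; apply: cvgB; apply: cvgM; exact: fa. Qed.

Lemma cvg_mx_unique T (F : set_system T) {FF : ProperFilter F} m n
    (f : T -> 'M[R]_(m, n)) (a b : 'M[R]_(m, n)) :
  f @ F --> a -> f @ F --> b -> a = b.
Proof. by apply: cvg_unique; exact: norm_hausdorff. Qed.

(** Normalized matrices have norm one, so their limit is nonzero; [nearly_rank1] is scale invariant
    and minors are continuous. *)
Lemma ultra_rank1_limit (U : set_system nat) m n (g : nat -> 'M[R]_(m, n)) :
  UltraFilter U -> (forall k, g k != 0) ->
  (forall e : R, 0 < e -> \forall k \near U, nearly_rank1 e (g k)) ->
  exists P : 'M[R]_(m, n), [/\ P != 0, `|g k|^-1 *: g k @[k --> U] --> P &
    forall i j k l, minor2 P i j k l = 0].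
Proof.
move=> UU g0 gn.
have n1 k : `| `|g k|^-1 *: g k | = 1.
  by rewrite normrZ normfV normr_id mulVf// normr_eq0.
have [P fP] : exists P : 'M[R]_(m, n), `|g k|^-1 *: g k @[k --> U] --> P.
  by apply: (@ultra_cvg_bounded _ _ _ _ _ 1); apply: nearW => k; rewrite n1.
exists P; split => //.
  have h : `| `|g k|^-1 *: g k| @[k --> U] --> `|P| by exact: cvg_norm.
  rewrite -normr_gt0; apply: lt_le_trans ltr01 _.
  by apply: (cvgr_to_ge h); apply: nearW => k; rewrite n1.
move=> i j k l; apply/normr0_eq0/le_anti; rewrite normr_ge0 andbT.
apply/ler_addgt0Pr => e e0; rewrite add0r.
have h : `|minor2 (`|g t|^-1 *: g t) i j k l| @[t --> U] --> `|minor2 P i j k l|.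
  by apply: cvg_norm; exact: cvg_minor2.
apply: (cvgr_to_le h); apply: filterS (gn e e0) => t /(nearly_rank1Z (`|g t|^-1)) /(_ i j k l).
by rewrite n1 expr1n mulr1.
Qed.

Lemma minor2_mul m n p (P : 'M[R]_(m, n)) (u : 'M[R]_(n, p)) i j k l :
  (forall q r, minor2 P i j q r = 0) -> minor2 (P *m u) i j k l = 0.
Proof.
move=> P0; apply/eqP; rewrite /minor2 subr_eq0 !mxE !big_distrl/=; apply/eqP.
rewrite (eq_bigr (fun q => \sum_r P i q * u q k * (P j r * u r l))); last first.
  by move=> q _; rewrite big_distrr.
rewrite exchange_big/=; apply: eq_bigr => r _; rewrite big_distrr/=.
apply: eq_bigr => q _; have /eqP := P0 q r; rewrite subr_eq0 => /eqP Pqr.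
by rewrite mulrACA Pqr; ring.
Qed.

Lemma minor2_tr m n (P : 'M[R]_(m, n)) i j k l : minor2 P^T k l i j = minor2 P i j k l.
Proof. by rewrite /minor2 !mxE [P j k * _]mulrC. Qed.

(** Vanishing minors pass to the matrix with columns P u and P v by [minor2_mul], so the range of P
    is a line. *)
Lemma rank1_col m n (P : 'M[R]_(m, n)) (u v : 'cV[R]_n) :
  (forall i j k l, minor2 P i j k l = 0) -> P *m u != 0 ->
  exists t, P *m v = t *: (P *m u).
Proof.
move=> P0 Pu0; have /cV0Pn[i ui0] := Pu0.
exists ((P *m v) i 0 / (P *m u) i 0); apply/colP => j; rewrite [RHS]mxE.
have : minor2 (P *m row_mx u v) i j (lshift 1 0) (rshift 1 0) = 0 by exact: minor2_mul.
rewrite mul_mx_row /minor2 !row_mxEl !row_mxEr => /eqP; rewrite subr_eq0 => /eqP h.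
by rewrite mulrAC -h mulrAC mulfV// mul1r.
Qed.

Lemma rank1_row m n (P : 'M[R]_(m, n)) (u v : 'rV[R]_m) :
  (forall i j k l, minor2 P i j k l = 0) -> u *m P != 0 ->
  exists t, v *m P = t *: (u *m P).
Proof.
move=> P0 uP0.
have [||t tE] := @rank1_col _ _ P^T u^T v^T.
- by move=> i j k l; rewrite minor2_tr.
- by rewrite -trmx_mul trmx_eq0.
by exists t; apply: trmx_inj; rewrite linearZ/= !trmx_mul.
Qed.

End RankOne.

(** * Separation from a closed cone *)

Section Separation.
Context (R : realType) (d : nat) (Co : set 'cV[R]_d) (phi : 'rV[R]_d).
Hypothesis pc : proper_cone Co phi.
Local Notation Cb := (closed_cone Co).
Implicit Types (u v w x y z : 'cV[R]_d) (psi : 'rV[R]_d).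

Lemma form_nonneg_closed psi :
  (forall v, Co v -> 0 <= form psi v) -> forall v, Cb v -> 0 <= form psi v.
Proof.
move=> psiC v Cv; have [e Ce] := cone_nonempty pc.
apply/ler_addgt0Pr => t t0.
have pe := psiC _ Ce.
pose s := t / (1 + form psi e).
have s0 : 0 < s by rewrite divr_gt0//; lra.
have := psiC _ (Cv _ (cone_scale pc s0 Ce)).
rewrite lformD lformZ => /le_trans; apply; rewrite lerD2l.
rewrite /s mulrAC ler_pdivrMr; last lra.
by rewrite ler_wpM2l ?(ltW t0)//; lra.
Qed.

(** A Euclidean product is needed beside the maximum norm [|u|]: the first-order condition at a
    nearest point comes from a quadratic expansion. *)
Let dot u v := form u^T v.

Let dotE u v : dot u v = \sum_i u i 0 * v i 0.
Proof. by rewrite /dot /form mxE; apply: eq_bigr => i _; rewrite mxE. Qed.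

Let dot_norm u : `|u| ^+ 2 <= dot u u.
Proof.
apply: le_trans (mxtrace_gram_ge u) _.
by rewrite mxtrace_gram big_ord1 dotE; apply: ler_sum => i _; rewrite expr2.
Qed.

Let dot_gt0 u : u != 0 -> 0 < dot u u.
Proof. by move=> u0; apply: lt_le_trans (dot_norm u); rewrite exprn_gt0// normr_gt0. Qed.

Let dot_cvg T (F : set_system T) {FF : Filter F} (f : T -> 'cV[R]_d) v :
  f @ F --> v -> dot (f t) (f t) @[t --> F] --> dot v v.
Proof.
move=> fv; rewrite dotE; under eq_fun do rewrite dotE.
move/cvg_mxP in fv; apply: cvg_big => [|k _]; first exact: add_continuous.
by apply: cvgM; exact: fv.
Qed.

(* [v - p], for [v] the point of the closed cone nearest to [p]. *)
Lemma closed_cone_separation p : ~ Cb p ->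
  exists psi, [/\ psi != 0, forall v, Cb v -> 0 <= form psi v & form psi p < 0].
Proof.
move=> nCp; have [U [UU sU]] := ultraFilterLemma (@eventually_filter).
pose A := [set dot (p - v) (p - v) | v in Cb].
have A0 : A !=set0 by exists (dot (p - 0) (p - 0)), 0 => //; exact: closed_cone0.
have dge0 u : 0 <= dot u u by apply: le_trans (dot_norm u); rewrite exprn_ge0.
have Ainf : has_inf A by split => //; exists 0 => _ [v _ <-].
have /choice[f fP] (k : nat) : exists v, Cb v /\ dot (p - v) (p - v) < inf A + k.+1%:R^-1.
  have k0 : 0 < k.+1%:R^-1 :> R by rewrite invr_gt0.
  by have [_ [v Cv <-] vk] := inf_adherent k0 Ainf; exists v.
have inv1 (k : nat) : k.+1%:R^-1 <= 1 :> R by rewrite invf_le1 ?ler1n.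
have fB k : `|p - f k| <= inf A + 2.
  have [_ fk] := fP k.
  have I0 : 0 <= inf A by apply: lb_le_inf => // _ [v _ <-].
  have := inv1 k; have := dot_norm (p - f k) => dk ik.
  rewrite leNgt; apply/negP => /ltW h; have I2 : 0 <= inf A + 2 by lra.
  have := ler_pM I2 I2 h h; move: dk fk ik; rewrite expr2.
  by move: (k.+1%:R^-1) (dot _ _) (_ * `|_|) => *; nra.
have [v fv] : exists v : 'cV[R]_d, f @ U --> v.
  apply: (@ultra_cvg_bounded _ _ _ _ _ (`|p| + (inf A + 2))).
  apply: nearW => k; apply: le_trans (_ : `|p| + `|p - f k| <= _).
    by have := ler_normB p (p - f k); rewrite opprB addrC subrK.
  by rewrite lerD2l.
have Cv : Cb v by apply: (closed_cone_cvg pc fv); apply: nearW => k; have [] := fP k.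
have vmin w : Cb w -> dot (p - v) (p - v) <= dot (p - w) (p - w).
  move=> Cw; apply: le_trans (_ : inf A <= _); last first.
    by apply: ge_inf; [case: Ainf|exists w].
  have h : inf A + k.+1%:R^-1 @[k --> U] --> inf A + 0.
    apply: cvgD; first exact: cvg_cst.
    by move=> N /cvg_harmonic; exact: sU.
  rewrite -[inf A]addr0; apply: (ler_cvg_to (dot_cvg (cvgB (cvg_cst p) fv)) h).
  by apply: nearW => k; apply/ltW; have [] := fP k.
have expand w s : dot (p - (v + s *: w)) (p - (v + s *: w)) =
    dot (p - v) (p - v) - s * 2 * dot (p - v) w + s ^+ 2 * dot w w.
  rewrite !dotE !mulr_sumr -sumrB -big_split/=.
  by apply: eq_bigr => i _; rewrite !mxE; ring.
have first_order (x y : R) : 0 <= y -> (forall s, 0 < s -> s < 1 -> 0 <= - s * 2 * x + s ^+ 2 *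
  y) -> x <= 0.
  move=> y0 h; rewrite leNgt; apply/negP => x0.
  have s0 : 0 < x / (1 + x + y) by rewrite divr_gt0//; lra.
  have s1 : x / (1 + x + y) < 1 by rewrite ltr_pdivrMr; lra.
  have := h _ s0 s1; set s := _ / _ in s0 s1 *.
  have sy : s * (1 + x + y) = x by rewrite /s divfK// gt_eqF//; lra.
  by nra.
have pv w : Cb w -> dot (p - v) w <= 0.
  move=> Cw; apply: (first_order _ (dot w w)) => // s s0 _.
  have := vmin (v + s *: w); rewrite expand => h.
  have : Cb (v + s *: w) by apply: (closed_coneD Cv); apply: (closed_coneZ pc) => //; exact: ltW.
  by move=> /h; lra.
(* Moving from v towards 0 stays in the cone, which gives the inequality opposite to [pv]. *)
have pvv : dot (p - v) v = 0.
  apply/le_anti; rewrite pv//= -oppr_le0 -[- _]mul1r.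
  apply: (first_order _ (dot v v)) => // s s0 s1.
  have := vmin (v + (- s) *: v); rewrite expand => h.
  have : Cb (v + - s *: v).
    by rewrite -[v in v + _]scale1r -scalerDl; apply: (closed_coneZ pc) => //; lra.
  by move=> /h; nra.
have pv0 : p - v != 0 by apply/eqP => /subr0_eq pE; apply: nCp; rewrite pE.
exists (- (p - v)^T); split.
- by rewrite oppr_eq0 trmx_eq0.
- by move=> w /pv; rewrite lformNl oppr_ge0.
- rewrite lformNl oppr_lt0 -/(dot _ _).
  by have := dot_gt0 pv0; rewrite [dot _ _]lformB -/(dot _ v) -/(dot _ p) pvv subr0.
Qed.

(** As z is not interior, z - e/(k + 1) is outside the closed cone for interior e. The functionals
    separating these points, normalized, have a nonzero limit, which is nonpositive at z. *)
Lemma closed_cone_support z : Cb z -> ~ Co z ->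
  exists psi, [/\ psi != 0, forall v, Cb v -> 0 <= form psi v & form psi z = 0].
Proof.
move=> Cz nCz; have [U [UU sU]] := ultraFilterLemma (@eventually_filter).
have [e Ce] := cone_nonempty pc.
have /choice[f fP] (k : nat) : exists psi : 'rV[R]_d, [/\ psi != 0,
    forall v, Cb v -> 0 <= form psi v & form psi (z - k.+1%:R^-1 *: e) < 0].
  apply: closed_cone_separation => C; apply: nCz.
  rewrite -(subrK (k.+1%:R^-1 *: e) z); apply: C.
  by apply: (cone_scale pc) => //; rewrite invr_gt0.
pose g k := `|f k|^-1 *: f k.
have f0 k : 0 < `|f k| by have [f0 _ _] := fP k; rewrite normr_gt0.
have g1 k : `|g k| = 1 by rewrite normrZ normfV normr_id mulVf// gt_eqF.
have gZ k v : form (g k) v = `|f k|^-1 * form (f k) v.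
  by rewrite /form /g -scalemxAl mxE.
have [psi gpsi] : exists psi : 'rV[R]_d, g @ U --> psi.
  by apply: (@ultra_cvg_bounded _ _ _ _ _ 1); apply: nearW => k; rewrite g1.
have cvg_g (h : nat -> 'cV[R]_d) v : h @ U --> v -> form (g k) (h k) @[k --> U] --> form psi v.
  by move=> hv; apply: (cvg_mxP _ _).1 (cvg_mulmx gpsi hv) 0 0.
have psiC v : Cb v -> 0 <= form psi v.
  move=> Cv; apply: (cvgr_to_ge (cvg_g _ _ (cvg_cst v))); apply: nearW => k.
  by rewrite gZ mulr_ge0 ?invr_ge0 ?(ltW (f0 k))//; have [_ h _] := fP k; exact: h.
exists psi; split => //.
  rewrite -normr_gt0; apply: lt_le_trans ltr01 _.
  have h : `|g k| @[k --> U] --> `|psi| by exact: cvg_norm.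
  by apply: (cvgr_to_ge h); apply: nearW => k; rewrite g1.
apply/le_anti; rewrite psiC// andbT.
have hz : z - k.+1%:R^-1 *: e @[k --> U] --> z.
  rewrite -[X in _ --> X]subr0 -(scale0r e); apply: cvgB; first exact: cvg_cst.
  apply: cvgZr_tmp; by move=> N /cvg_harmonic; exact: sU.
apply: (cvgr_to_le (cvg_g _ _ hz)); apply: nearW => k.
rewrite gZ mulr_ge0_le0 ?invr_ge0 ?(ltW (f0 k))//.
by have [_ _ /ltW] := fP k.
Qed.

End Separation.

(** * Orbits converging conically to the boundary *)

Section ConicalLimits.
Context (R : realType) (d : nat) (Co : set 'cV[R]_d) (phi : 'rV[R]_d).
Hypothesis pc : proper_cone Co phi.
Local Notation Cb := (closed_cone Co).
Implicit Types (u v w x y z e : 'cV[R]_d) (psi : 'rV[R]_d).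
Variable U : set_system nat.
Context {UU : UltraFilter U}.

Lemma near_form_gt (f : nat -> 'cV[R]_d) v psi (c : R) : f @ U --> v ->
  c < form psi v -> \forall k \near U, c < form psi (f k).
Proof.
move=> fv; have h : form psi (f k) @[k --> U] --> form psi v by exact: cvg_form.
exact: (cvgr_gt _ h).
Qed.

Lemma near_form_lt (f : nat -> 'cV[R]_d) v psi (c : R) : f @ U --> v ->
  form psi v < c -> \forall k \near U, form psi (f k) < c.
Proof.
move=> fv; have h : form psi (f k) @[k --> U] --> form psi v by exact: cvg_form.
exact: (cvgr_lt _ h).
Qed.

Lemma cone_aut_neq0 a : cone_aut Co a -> a != 0.
Proof.
move=> [ua aC]; have [e Ce] := cone_nonempty pc.
by apply: contraPneq Ce => a0; rewrite -aC a0 mul0mx => /(cone_neq0 pc); rewrite eqxx.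
Qed.

Lemma cone_autZ k a : 0 < k -> cone_aut Co a -> cone_aut Co (k *: a).
Proof.
move=> k0 [ua aC]; have kC v : Co (k *: v) <-> Co v.
  split; last exact: (cone_scale pc).
  rewrite -{2}[v]scale1r -(mulVf (lt0r_neq0 k0)) -scalerA.
  by apply: (cone_scale pc); rewrite invr_gt0.
by split=> [|v]; rewrite ?unitmxZ ?unitfE ?lt0r_neq0// -scalemxAl kC.
Qed.

(** Suppose P v = 0 for an interior v. Every w satisfies w <= k |w| v, hence P w <= 0; using this
    for w and -w, pointedness of the cone gives P = 0. *)
Lemma limit_aut_form_gt0 (f : nat -> 'M[R]_d) (P : 'M[R]_d) v : (forall k, cone_aut Co (f k)) ->
  f @ U --> P -> P != 0 -> Co v -> 0 < form phi (P *m v).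
Proof.
move=> fC fP P0 Cv.
have PC w : Cb w -> Cb (P *m w).
  move=> Cw; apply: (closed_cone_cvg pc (cvg_mulmx fP (cvg_cst w))).
  by apply: nearW => k; apply/cone_aut_closed.
have Cv' := closed_cone_Co pc Cv.
rewrite lt0r (closed_cone_form pc (PC _ Cv'))// andbT; apply: contra P0 => /eqP Pv.
have {}Pv := closed_cone_eq0 pc (PC _ Cv') Pv.
have [k k0 kP] := cone_unit_bound pc Cv.
have Pw w : Cb (- (P *m w)).
  by have := PC _ (kP w); rewrite mulmxBr -scalemxAr Pv scaler0 sub0r.
apply/eqP/matrixP => p q; have : col q P = 0.
  rewrite colE; apply: (closed_cone_anti pc) => //.
  by have := Pw (- delta_mx q 0); rewrite mulmxN opprK.
by move=> /colP/(_ p); rewrite !mxE.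
Qed.

Variables (g : nat -> 'M[R]_d) (e : 'cV[R]_d) (z : nat -> 'cV[R]_d) (a : 'cV[R]_d).
Variables (t : nat -> R) (r : R).
Hypothesis Ce : Co e.
Hypothesis gC : forall k, cone_aut Co (g k).
Hypothesis t0 : forall k, 0 < t k.
Hypothesis zg : forall k, Cb (z k - t k *: (g k *m e)).
Hypothesis gz : forall k, Cb ((r * t k) *: (g k *m e) - z k).
Hypothesis za : z @ U --> a.

Let r_ge0 : 0 <= r.
Proof.
have := closed_coneD (zg 0%N) (gz 0%N); rewrite addrC subrKA -scalerBl.
move/(closed_cone_form pc); rewrite lformZ pmulr_lge0; last first.
  by apply: (cone_form pc); have [_ ->] := gC 0%N.
by rewrite -{2}[t 0%N]mul1r -mulrBl pmulr_lge0//; lra.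
Qed.

(** Let f_k = g_k/|g_k|, with limit P, and T_k = t_k |g_k|. The T_k are bounded, since T_k f_k e <=
    z_k, z_k tends to a, and phi(P e) > 0. Then w <= z_k <= r T_k f_k e, so f_k^-1 w <= r T_k e is
    bounded and has a limit v along U, and w = f_k (f_k^-1 w) tends to P v. *)
Lemma conical_primal_range :
  (forall s : R, 0 < s -> \forall k \near U, nearly_rank1 s (g k)) ->
  exists2 P : 'M[R]_d, (forall i j k l, minor2 P i j k l = 0) &
    forall w, Cb w -> (\forall k \near U, Cb (z k - w)) -> exists v, w = P *m v.
Proof.
move=> gn; have [|P [P0 fP Pm]] := @ultra_rank1_limit _ U _ _ g _ _ gn.
  by move=> k; exact: cone_aut_neq0.
exists P => // w Cw wz.
pose f k := `|g k|^-1 *: g k; rewrite -/f in fP.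
have g0 k : 0 < `|g k| by rewrite normr_gt0 cone_aut_neq0.
have fC k : cone_aut Co (f k) by apply: cone_autZ; rewrite ?invr_gt0.
pose T k := t k * `|g k|.
have gf k s : (s * t k) *: (g k *m e) = (s * T k) *: (f k *m e).
  by rewrite /f -scalemxAl scalerA /T mulrA mulfK ?gt_eqF.
have Pe := limit_aut_form_gt0 fC fP P0 Ce.
have [K K0 KP] := closed_cone_bound pc.
pose c := form phi (P *m e) / 2; pose B := form phi a + 1.
have cP : \forall k \near U, c < form phi (f k *m e).
  apply: (near_form_gt (v := P *m e)); first by apply: cvg_mulmx => //; exact: cvg_cst.
  by rewrite /c; lra.
have BP : \forall k \near U, form phi (z k) < B.
  by apply: (near_form_lt za); rewrite /B; lra.
have c0 : 0 < c by rewrite /c; lra.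
have TB : \forall k \near U, T k <= B / c.
  near=> k; have ck : c < form phi (f k *m e) by near: k.
  have Bk : form phi (z k) < B by near: k.
  have := closed_cone_form pc (zg k); rewrite -[t k]mul1r gf mul1r lformB lformZ subr_ge0 => h.
  rewrite ler_pdivlMr//; apply: le_trans (ltW Bk); apply: le_trans h.
  by rewrite ler_wpM2l ?ltW// /T mulr_gt0.
pose w' k := invmx (f k) *m w.
have w'C k : Cb (w' k) by apply/cone_aut_closed => //; exact: cone_autV.
have [v w'v] : exists v : 'cV[R]_d, w' @ U --> v.
  apply: (@ultra_cvg_bounded _ _ _ _ _ (K * (r * (B / c) * form phi e))).
  near=> k; apply: le_trans (KP _ (w'C k)) _; rewrite ler_wpM2l ?(ltW K0)//.
  apply: (@le_trans _ _ (r * T k * form phi e)); last first.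
    rewrite ler_wpM2r ?(ltW (cone_form pc Ce))// ler_wpM2l//.
    by near: k.
  have [uf _] := fC k.
  have : Cb ((r * T k) *: (f k *m e) - w).
    by rewrite -gf; apply: closed_cone_trans (gz k); near: k.
  move/(cone_aut_closed _ (cone_autV (fC k))); rewrite mulmxBr -scalemxAr mulKmx//.
  by move/(closed_cone_form pc); rewrite lformB lformZ subr_ge0.
exists v; apply: (cvg_mx_unique (F := U) (f := fun=> w)); first exact: cvg_cst.
rewrite (_ : (fun=> w) = (fun k => f k *m w' k)); first exact: cvg_mulmx.
by apply/funext => k; rewrite mulKVmx//; have [] := fC k.
Unshelve. all: by end_near. Qed.

(** Let h_k = g_k^-1/|g_k^-1|, with limit Q. Since psi = kap_k h_k for kap_k = psi h_k^-1, and kap_k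
    is nonnegative on the cone, it is enough to bound kap_k(e). With T_k = t_k/|g_k^-1|, the
    inequality T_k h_k^-1 e <= z_k gives T_k kap_k(e) <= C eps_k. Applying h_k to eps_k y_k <= z_k
    <= r T_k h_k^-1 e gives eps_k = O(T_k), because phi(h_k y_k) tends to phi(Q b) > 0. *)
Lemma conical_dual_range (y : nat -> 'cV[R]_d) (b : 'cV[R]_d) (eps : nat -> R) :
  (forall s : R, 0 < s -> \forall k \near U, nearly_rank1 s (invmx (g k))) ->
  y @ U --> b -> Co b -> (forall k, 0 < eps k) ->
  (forall k, Cb (z k - eps k *: y k)) ->
  exists2 Q : 'M[R]_d, (forall i j k l, minor2 Q i j k l = 0) &
    forall psi, (forall v, Cb v -> 0 <= form psi v) ->
      (exists C, \forall k \near U, form psi (z k) <= C * eps k) ->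
      exists kappa, psi = kappa *m Q.
Proof.
move=> gn yb Cbb eps0 zy.
have [|Q [Q0 hQ Qm]] := @ultra_rank1_limit _ U _ _ (fun k => invmx (g k)) _ _ gn.
  by move=> k; apply: cone_aut_neq0; exact: cone_autV.
exists Q => // psi psiC [C zC].
pose h k := `|invmx (g k)|^-1 *: invmx (g k); rewrite -/h in hQ.
have g0 k : 0 < `|invmx (g k)| by rewrite normr_gt0 cone_aut_neq0//; exact: cone_autV.
have hC k : cone_aut Co (h k).
  by apply: cone_autZ; rewrite ?invr_gt0//; exact: cone_autV.
have hV k : invmx (h k) = `|invmx (g k)| *: g k.
  by have [uh _] := hC k; rewrite invmxZ// invrK invmxK.
pose T k := t k / `|invmx (g k)|.
have T0 k : 0 < T k by rewrite divr_gt0.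
have gf k s : (s * t k) *: (g k *m e) = (s * T k) *: (invmx (h k) *m e).
  by rewrite hV -scalemxAl scalerA /T -mulrA divfK ?gt_eqF.
pose c := form phi (Q *m b) / 2.
have Qb := limit_aut_form_gt0 hC hQ Q0 Cbb.
have c0 : 0 < c by rewrite /c; lra.
have cP : \forall k \near U, c < form phi (h k *m y k).
  apply: (near_form_gt (v := Q *m b)); first exact: cvg_mulmx.
  by rewrite /c; lra.
pose kap k := psi *m invmx (h k).
have kapE k v : form (kap k) v = form psi (invmx (h k) *m v) by rewrite /form mulmxA.
have kapC k v : Cb v -> 0 <= form (kap k) v.
  by move=> Cv; rewrite kapE; apply: psiC; apply/cone_aut_closed => //; exact: cone_autV.
have fe := cone_form pc Ce.
have kape : \forall k \near U, form (kap k) e <= `|C| * (r * form phi e / c).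
  near=> k; have ck : c < form phi (h k *m y k) by near: k.
  have zk : form psi (z k) <= C * eps k by near: k.
  have h1 : T k * form (kap k) e <= C * eps k.
    apply: le_trans zk; rewrite -subr_ge0 kapE -lformZ -lformB; apply: psiC.
    by have := zg k; rewrite -[t k]mul1r gf mul1r.
  have h2 : eps k * form phi (h k *m y k) <= r * T k * form phi e.
    rewrite -!lformZ -subr_ge0 -lformB; apply: (closed_cone_form pc).
    have /(cone_aut_closed _ (hC k)) := closed_cone_trans (zy k) (gz k).
    by rewrite gf mulmxBr -!scalemxAr mulKVmx//; have [] := hC k.
  have h3 : eps k * c <= r * T k * form phi e.
    by apply: le_trans h2; rewrite ler_wpM2l ?ltW.
  have h4 : eps k <= r * T k * form phi e / c by rewrite ler_pdivlMr.
  have h5 : T k * form (kap k) e <= `|C| * (r * T k * form phi e / c).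
    apply: le_trans h1 _; apply: le_trans (_ : `|C| * eps k <= _).
      by rewrite ler_wpM2r ?ler_norm// ltW.
    by rewrite ler_wpM2l.
  rewrite -(ler_pM2l (T0 k)); apply: le_trans h5 _.
  by rewrite le_eqVlt; apply/orP; left; apply/eqP; ring.
have [K K0 KP] := cone_unit_bound pc Ce.
have [kappa kapk] : exists kappa : 'rV[R]_d, kap @ U --> kappa.
  apply: (@ultra_cvg_bounded _ _ _ _ _ (K * (`|C| * (r * form phi e / c)))).
  near=> k; have kek : form (kap k) e <= `|C| * (r * form phi e / c) by near: k.
  have ke0 := kapC k _ (closed_cone_Co pc Ce).
  apply: mx_norm_le => [|i j].
    by rewrite mulr_ge0 ?(ltW K0)//; exact: le_trans kek.
  apply: le_trans (_ : K * form (kap k) e <= _); last by rewrite ler_wpM2l ?(ltW K0).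
  have kd v : `|v| <= 1 -> form (kap k) v <= K * form (kap k) e.
    move=> v1; have := kapC k _ (KP v); rewrite lformB lformZ subr_ge0 => /le_trans; apply.
    by rewrite ler_wpM2r// ler_piMr// ltW.
  have -> : kap k i j = form (kap k) (delta_mx j 0).
    by rewrite /form -colE [RHS]mxE [i]ord1.
  have nd : `|delta_mx j 0 : 'cV[R]_d| <= 1.
    by apply: mx_norm_le => // p q; rewrite mxE; case: (_ && _); rewrite ?normr1 ?normr0.
  rewrite ler_norml kd// andbT lerNl -lformN; apply: kd; by rewrite normrN.
exists kappa; apply: (cvg_mx_unique (F := U) (f := fun=> psi)); first exact: cvg_cst.
rewrite (_ : (fun=> psi) = (fun k => kap k *m h k)); first exact: cvg_mulmx.
by apply/funext => k; rewrite /kap mulmxKV//; have [] := hC k.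
Unshelve. all: by end_near. Qed.

End ConicalLimits.

(** * Visible endpoints *)

(** The linear form of exposed boundary at faces that are single points: the last hypothesis on a
    says that it spans an extreme ray. *)
Definition exposed_cone (R : realType) d (Co : set 'cV[R]_d) := forall a,
  closed_cone Co a -> ~ Co a -> a != 0 ->
  (forall w, closed_cone Co w -> closed_cone Co (a - w) -> exists t, w = t *: a) ->
  exists psi : 'rV[R]_d, [/\ psi != 0, forall v, closed_cone Co v -> 0 <= form psi v,
    form psi a = 0 & forall v, closed_cone Co v -> form psi v = 0 -> exists t, v = t *: a].

(** The third clause keeps conic combinations of two points of the ray on the ray, up to scale; it
    is what makes the perturbed points z k of [ray_endpoint] points of the ray. The fourth matches
    the order in time with the order on the line. *)
Definition cone_ray (R : realType) d (Co : set 'cV[R]_d) (phi : 'rV[R]_d) (Y : R -> 'cV[R]_d) :=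
  [/\ forall t, 0 <= t -> Co (Y t) /\ form phi (Y t) = 1,
      forall s t, 0 <= s -> 0 <= t -> hd Co (Y s) (Y t) = `|s - t|,
      forall s u x y, 0 <= s -> 0 <= u -> 0 <= x -> 0 <= y -> Co (x *: Y s + y *: Y u) ->
        exists2 t, 0 <= t & exists2 k, 0 < k & Y t = k *: (x *: Y s + y *: Y u) &
      forall s t u, 0 <= s -> s <= t -> t <= u ->
        exists x y, [/\ 0 <= x, 0 <= y & Y t = x *: Y s + y *: Y u]].

(** The ray is already translated so that its time m is near e, and G n stands for a matrix of
    gamma_m^-1 gamma_n preserving the cone. J is a parameter so that a single J can serve a whole
    sequence of rays. *)
Definition tracked_ray (R : realType) d (Co : set 'cV[R]_d) e (r : R) (J : R -> R)
    (Y : R -> 'cV[R]_d) (m : nat) :=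
  hd Co e (Y m%:R) <= r /\
  exists G : nat -> 'M[R]_d, forall n, [/\ cone_aut Co (G n), hd Co (G n *m e) (Y n%:R) <= r &
    forall s, 0 < s -> J s <= `|n%:R - m%:R| ->
      nearly_rank1 s (G n) /\ nearly_rank1 s (invmx (G n))].

Section Endpoints.
Context (R : realType) (d : nat) (Co : set 'cV[R]_d) (phi : 'rV[R]_d).
Hypothesis pc : proper_cone Co phi.
Hypothesis exposedC : exposed_cone Co.
Local Notation Cb := (closed_cone Co).
Local Notation hd := (hd Co).
Implicit Types (u v w x : 'cV[R]_d) (psi : 'rV[R]_d).
Variable U : set_system nat.
Context {UU : UltraFilter U}.

(** Because a <= z k, every w <= a satisfies w <= z k; because |c k - a| <= eps k, nonnegative
    functionals vanishing at a are of order eps k on z k. A functional supporting the cone at p + a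
    vanishes at p and at a, so the functional exposing a is proportional to it, hence vanishes at p,
    which puts p on the line of a. *)
Lemma visible_limit (g : nat -> 'M[R]_d) e (c y z : nat -> 'cV[R]_d) a b
    (t eps : nat -> R) (r : R) :
  Co e -> (forall k, cone_aut Co (g k)) -> (forall k, 0 < t k) ->
  (forall k, Cb (z k - t k *: (g k *m e))) ->
  (forall k, Cb ((r * t k) *: (g k *m e) - z k)) ->
  (forall s : R, 0 < s -> \forall k \near U, nearly_rank1 s (g k)) ->
  (forall s : R, 0 < s -> \forall k \near U, nearly_rank1 s (invmx (g k))) ->
  (forall k, z k = c k + eps k *: y k) -> (forall k, Cb (c k)) ->
  (forall k, Cb (z k - a)) -> (forall k, `|c k - a| <= eps k) ->
  (forall k, 0 < eps k) -> z @ U --> a -> y @ U --> b -> Co b ->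
  Cb a -> ~ Co a -> a != 0 ->
  forall p, Cb p -> ~ Co (p + a) -> exists s, p = s *: a.
Proof.
move=> Ce gC t0 zg gz gn gVn zE Cc za' ca eps0 za yb Cbb Ca nCa a0.
have [P Pm PP] := conical_primal_range pc Ce gC t0 zg gz za gn.
have a_ext w : Cb w -> Cb (a - w) -> exists s, w = s *: a.
  move=> Cw aw.
  have [v aE] : exists v, a = P *m v by apply: PP => //; exact: nearW.
  have [v' wE] : exists v, w = P *m v.
    by apply: PP => //; apply: nearW => k; exact: closed_cone_trans aw (za' k).
  by have := rank1_col v' Pm (_ : P *m v != 0); rewrite -aE -wE; apply.
have [psi [psi0 psiC psia psiv]] := exposedC Ca nCa a0 a_ext.
have [Q Qm QQ] : exists2 Q : 'M[R]_d, (forall i j k l, minor2 Q i j k l = 0) &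
    forall psi, (forall v, Cb v -> 0 <= form psi v) ->
      (exists C, \forall k \near U, form psi (z k) <= C * eps k) ->
      exists kappa, psi = kappa *m Q.
  apply: (conical_dual_range pc Ce gC t0 zg gz gVn yb Cbb eps0) => k.
  by rewrite zE addrK.
have [K K0 KP] := cone_unit_bound pc Ce.
have QQ' psi' : (forall v, Cb v -> 0 <= form psi' v) -> form psi' a = 0 ->
    exists kappa, psi' = kappa *m Q.
  move=> psi'C psi'a; apply: (QQ _ psi'C).
  have e0 := psi'C _ (closed_cone_Co pc Ce).
  (* The first term bounds psi' at c k, through c k - a <= K |c k - a| e; the second bounds psi' at
     y k. *)
  exists (K * form psi' e + (form psi' b + 1)).
  have yk : \forall k \near U, form psi' (y k) < form psi' b + 1.
    by apply: (near_form_lt yb); lra.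
  near=> k; have ykb : form psi' (y k) < form psi' b + 1 by near: k.
  rewrite zE lformD lformZ mulrDl; apply: lerD; last first.
    by rewrite mulrC ler_wpM2r// ltW.
  rewrite -[form _ (c k)]subr0 -psi'a -lformB.
  apply: le_trans (_ : (K * `|c k - a|) * form psi' e <= _).
    by rewrite -lformZ -subr_ge0 -lformB; exact: psi'C.
  by rewrite mulrAC ler_wpM2l// mulr_ge0// ltW.
move=> p Cp npa.
have [psi' [psi'0 psi'C psi'pa]] := closed_cone_support pc (closed_coneD Cp Ca) npa.
have [psi'p psi'a] : form psi' p = 0 /\ form psi' a = 0.
  by move: psi'pa (psi'C _ Cp) (psi'C _ Ca); rewrite lformD; lra.
have [kap kE] := QQ' _ psiC psia; have [kap' k'E] := QQ' _ psi'C psi'a.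
have k'Q : kap' *m Q != 0 by rewrite -k'E.
have [s sE] := rank1_row kap Qm k'Q.
apply: psiv => //; move: sE; rewrite -kE -k'E => ->.
by rewrite /form -scalemxAl mxE -/(form psi' p) psi'p mulr0.
Unshelve. all: by end_near. Qed.

(** Fixes the scale left free in [hdP]: there t is at least phi(y)/phi(x), so s is at most exp(2 r)
    phi(x)/phi(y). *)
Lemma hd_lower x y (r : R) : Co x -> Co y -> hd x y <= r ->
  Cb ((expR (2 * r) * form phi x) *: y - form phi y *: x).
Proof.
move=> Cx Cy xyr; have [s [t [s0 t0 xy yx st]]] := hdP pc Cx Cy.
have fx := cone_form pc Cx; have fy := cone_form pc Cy.
have tl : form phi y <= t * form phi x.
  by rewrite -lformZ -subr_ge0 -lformB; exact: closed_cone_form yx.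
apply: (closed_cone_trans (y := (form phi y * s) *: y)).
  by rewrite -scalerA -scalerBr; apply: (closed_coneZ pc) => //; exact: ltW.
apply: (closed_cone_le pc) (closed_cone_Co pc Cy).
apply: le_trans (_ : t * form phi x * s <= _); first by rewrite ler_wpM2r// ltW.
rewrite mulrAC [t * s]mulrC st ler_wpM2r ?(ltW fx)// ler_expR.
by rewrite ler_pM2l.
Qed.

(** In the limit, [hd_lower] shows that a dominates a positive multiple of the interior vector b. *)
Lemma hd_bounded_limit (y z : nat -> 'cV[R]_d) a b (B : R) :
  (forall k, Co (y k)) -> (forall k, Co (z k)) ->
  y @ U --> b -> Co b -> z @ U --> a -> 0 < form phi a ->
  (\forall k \near U, hd (y k) (z k) <= B) -> Co a.
Proof.
move=> Cy Cz yb Cb' za a0 yzB.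
have fb := cone_form pc Cb'.
have h : Cb ((expR (2 * B) * form phi b) *: a - form phi a *: b).
  apply: (closed_cone_cvg pc (F := U) (f := fun k => (expR (2 * B) * form phi (y k)) *: z k -
    form phi (z k) *: y k)).
    apply: cvgB; apply: cvgZ => //; last exact: cvg_form.
    by apply: cvgM; [exact: cvg_cst|exact: cvg_form].
  by apply: filterS yzB => k; exact: hd_lower.
pose c := expR (2 * B) * form phi b.
have c0 : 0 < c by rewrite mulr_gt0// expR_gt0.
have -> : a = c^-1 *: (c *: a - form phi a *: b + form phi a *: b).
  by rewrite subrK scalerA mulVf ?scale1r// gt_eqF.
apply: (cone_scale pc); first by rewrite invr_gt0.
by apply: h; exact: (cone_scale pc).
Qed.

Lemma hd_near_bounded (x y : nat -> 'cV[R]_d) a b :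
  (forall k, Co (x k)) -> (forall k, Co (y k)) ->
  x @ U --> a -> y @ U --> b -> Co a -> Co b ->
  exists A, \forall k \near U, hd (x k) (y k) <= A.
Proof.
move=> Cx Cy xa yb Ca Cbb; have [e Ce] := cone_nonempty pc.
have [K K0 KP] := cone_unit_bound pc Ce.
have one (f h : nat -> 'cV[R]_d) u v : h @ U --> v -> f @ U --> u -> Co u ->
    exists S, \forall k \near U, Cb (S *: f k - h k).
  move=> hv fu Cu; have [t t0 ft] := cone_cvg_near pc e Cu fu.
  exists (K * (`|v| + 1) / t).
  have hB : \forall k \near U, `|h k| < `|v| + 1 by apply: (cvgr_norm_lt _ hv); lra.
  near=> k; apply: closed_cone_trans (KP _) _.
  have hk : `|h k| < `|v| + 1 by near: k.
  apply: (closed_cone_trans (y := (K * (`|v| + 1)) *: e)).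
    by apply: (closed_cone_le pc) (closed_cone_Co pc Ce); rewrite ler_wpM2l// ltW.
  have -> : (K * (`|v| + 1)) *: e = (K * (`|v| + 1) / t) *: (t *: e).
    by rewrite scalerA divfK// gt_eqF.
  rewrite -scalerBr.
  apply: (closed_coneZ pc); last by apply: (closed_cone_Co pc); near: k.
  by rewrite divr_ge0 ?mulr_ge0 ?addr_ge0// ltW.
have [S SP] := one y x b a xa yb Cbb; have [T TP] := one x y a b yb xa Ca.
exists (ln (S * T) / 2); near=> k.
by apply: (hd_le pc) => //; near: k.
Unshelve. all: by end_near. Qed.

End Endpoints.

(** * Projections to tracked rays *)

(** The arithmetic of [nearest_limit]: x1, x2, x3 are the distances from p to Y(s), to Y(m) and to a
    point w close to Y(m); x4 and x5 are those from w to Y(s) and Y(m); x6 is |s - m|. They give x4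
    <= b + 1, hence x6 <= 2 b + 1. *)
Lemma excursion_bound (R : realDomainType) (b x1 x2 x3 x4 x5 x6 : R) :
  x5 <= b -> 2 * b + 2 <= x6 -> x1 <= x2 + 1 ->
  x3 + x4 <= x1 -> x2 <= x3 + x5 -> x6 <= x4 + x5 -> False.
Proof. by lra. Qed.

(** The arithmetic of [no_long_shortcut]: x1, x2, x3 are the distances from p to Y(s), Y(m) and a
    point z of the segment from p to q; x4 and x5 are those from z to q and Y(m); x6 is that from p
    to q. *)
Lemma shortcut_bound (R : realDomainType) (b k x1 x2 x3 x4 x5 x6 : R) :
  x5 <= b -> b + 2 <= k -> x1 <= x2 + 1 -> x3 + x4 <= x6 -> x2 <= x3 + x5 ->
  0 <= x4 -> x6 <= x1 - k -> False.
Proof. by lra. Qed.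

Section RaySequences.
Context (R : realType) (d : nat) (Co : set 'cV[R]_d) (phi : 'rV[R]_d).
Hypothesis pc : proper_cone Co phi.
Hypothesis exposedC : exposed_cone Co.
Local Notation Cb := (closed_cone Co).
Local Notation hd := (hd Co).
Implicit Types (u v w x : 'cV[R]_d) (psi : 'rV[R]_d).
Variable U : set_system nat.
Context {UU : UltraFilter U}.
Hypothesis sU : \oo `<=` U.
Variables (e : 'cV[R]_d) (r : R) (J : R -> R) (Y : nat -> R -> 'cV[R]_d) (m : nat -> nat).
Hypothesis Ce : Co e.
Hypothesis rayY : forall k, cone_ray Co phi (Y k).
Hypothesis trackY : forall k, tracked_ray Co e r J (Y k) (m k).

Definition escapes (s : nat -> R) :=
  forall B : R, \forall k \near U, B <= `|s k - (m k)%:R|.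

Lemma ultra_cvg_normalized (f : nat -> 'cV[R]_d) :
  (forall k, Co (f k)) -> (forall k, form phi (f k) = 1) ->
  exists v : 'cV[R]_d, [/\ f @ U --> v, Cb v & form phi v = 1].
Proof.
move=> fC f1; have [K K0 KP] := closed_cone_bound pc.
have [v fv] : exists v : 'cV[R]_d, f @ U --> v.
  apply: (@ultra_cvg_bounded _ _ _ _ _ K); apply: nearW => k.
  by have := KP _ (closed_cone_Co pc (fC k)); rewrite f1 mulr1.
exists v; split => //.
  by apply: (closed_cone_cvg pc fv); apply: nearW => k; exact: (closed_cone_Co pc).
have h : form phi (f k) @[k --> U] --> form phi v by exact: cvg_form.
apply/esym; apply: (cvg_unique (@Rhausdorff R) _ h).
rewrite (_ : (fun k => form phi (f k)) = cst 1); first exact: cvg_cst.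
by apply/funext => k; rewrite f1.
Qed.

Let Yc k t : 0 <= t -> Co (Y k t).
Proof. by move=> t0; have [/(_ t t0)[]] := rayY k. Qed.

Let Y1 k t : 0 <= t -> form phi (Y k t) = 1.
Proof. by move=> t0; have [/(_ t t0)[]] := rayY k. Qed.

Let Yd k s t : 0 <= s -> 0 <= t -> hd (Y k s) (Y k t) = `|s - t|.
Proof. by have [_ + _ _] := rayY k; apply. Qed.

Let base_lower k : Cb ((expR (2 * r) * form phi e) *: Y k (m k)%:R - e).
Proof.
have [hr _] := trackY k; have := hd_lower pc Ce (Yc k (ler0n _ (m k))) hr.
by rewrite Y1// scale1r.
Qed.

Lemma base_limit : exists b : 'cV[R]_d,
  [/\ Y k (m k)%:R @[k --> U] --> b, Co b & form phi b = 1].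
Proof.
have [b [yb _ b1]] := ultra_cvg_normalized (fun k => Yc k (ler0n _ (m k))) (fun k => Y1 k (ler0n
  _ (m k))).
exists b; split => //.
pose S := expR (2 * r) * form phi e.
have S0 : 0 < S by rewrite mulr_gt0 ?expR_gt0// (cone_form pc).
have : Cb (S *: b - e).
  apply: (closed_cone_cvg pc (F := U) (f := fun k => S *: Y k (m k)%:R - e)).
    by apply: cvgB; [apply: cvgZ => //; exact: cvg_cst|exact: cvg_cst].
  by apply: nearW => k; exact: base_lower.
move=> /(_ _ Ce); rewrite subrK => /(cone_scale pc (v := S *: b) (k := S^-1)).
by rewrite scalerA mulVf ?gt_eqF// scale1r invr_gt0; apply.
Qed.

Lemma escape_not_interior (z : nat -> 'cV[R]_d) (a : 'cV[R]_d) :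
  (forall k, Co (z k)) -> z @ U --> a ->
  (forall B, \forall k \near U, B <= hd (z k) (Y k (m k)%:R)) -> ~ Co a.
Proof.
move=> Cz za zesc Ca; have [b [yb Cbb _]] := base_limit.
have [A AP] := hd_near_bounded pc Cz (fun k => Yc k (ler0n _ (m k))) za yb Ca Cbb.
have [k [h1 h2]] := filter_ex (filterI AP (zesc (A + 1))).
by have := le_trans h2 h1; lra.
Qed.

Lemma interior_not_escape (z : nat -> 'cV[R]_d) (a : 'cV[R]_d) :
  (forall k, Co (z k)) -> z @ U --> a -> 0 < form phi a -> ~ Co a ->
  forall B, \forall k \near U, B <= hd (z k) (Y k (m k)%:R).
Proof.
move=> Cz za a0 nCa B; have [b [yb Cbb _]] := base_limit.
have [//|UB] := in_ultra_setVsetC [set k | B <= hd (z k) (Y k (m k)%:R)] UU.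
exfalso; apply: nCa.
apply: (hd_bounded_limit (B := B) pc (fun k => Yc k (ler0n _ (m k))) Cz yb Cbb za a0).
by apply: filterS UB => k /= /negP; rewrite -ltNge (hdC _ (Y k _)) => /ltW.
Qed.

(** The last clause is visibility: since p may be rescaled, it says that the open segment from a to
    a point of the closed cone off the line of a lies in Co. *)
Lemma ray_endpoint (s : nat -> R) (a : 'cV[R]_d) : (forall k, 0 <= s k) -> escapes s ->
  Y k (s k) @[k --> U] --> a ->
  [/\ Cb a, form phi a = 1, ~ Co a & forall p, Cb p -> ~ Co (p + a) -> exists t, p = t *: a].
Proof.
move=> s0 sesc Ya.
pose c k := Y k (s k); pose y k := Y k (m k)%:R.
have Cc k : Co (c k) by exact: Yc.
have Cy k : Co (y k) by exact: Yc.
have [a' [Ya' Ca a1]] := ultra_cvg_normalized Cc (fun k => Y1 k (s0 k)).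
have aa' := cvg_mx_unique Ya Ya'; rewrite -{a' Ya'}aa' in Ca a1.
have [b [yb Cbb _]] := base_limit.
have a0 : a != 0 by apply/eqP => a0; move/eqP: a1; rewrite a0 lform0 eq_sym oner_eq0.
have nCa : ~ Co a.
  apply: (escape_not_interior Cc Ya) => B; apply: filterS (sesc B) => k.
  by rewrite Yd.
split => //.
have [K K0 KP] := cone_unit_bound pc Ce.
pose S := expR (2 * r) * form phi e.
have S0 : 0 < S by rewrite mulr_gt0 ?expR_gt0// (cone_form pc).
(* The summand 1 gives |c k - a| <= eps k. The summand K S gives a <= z k, since a - c k <= K |c k -
   a| e and e <= S y k. The harmonic term keeps eps k positive. *)
pose eps k := (1 + K * S) * (`|c k - a| + k.+1%:R^-1).
have KS : 0 < 1 + K * S by have := mulr_gt0 K0 S0; lra.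
have k1 k : 0 < k.+1%:R^-1 :> R by rewrite invr_gt0.
have eps0 k : 0 < eps k by rewrite mulr_gt0// ltr_wpDl.
have epscvg : eps k @[k --> U] --> 0.
  have -> : 0 = (1 + K * S) * (`|a - a| + 0) by rewrite subrr normr0 addr0 mulr0.
  apply: cvgM; first exact: cvg_cst.
  apply: cvgD; last by move=> N /cvg_harmonic; exact: sU.
  by apply: cvg_norm; apply: cvgB => //; exact: cvg_cst.
have epsca k : `|c k - a| <= eps k.
  rewrite /eps; have := normr_ge0 (c k - a); have := k1 k; have := mulr_gt0 K0 S0.
  by move: `|_| (_^-1) (K * S) => *; nra.
pose z k := c k + eps k *: y k.
have Cz k : Co (z k) by apply: (cone_add pc) => //; exact: (cone_scale pc).
have za : z @ U --> a.
  rewrite -[a]addr0 -(scale0r b); apply: cvgD => //; exact: cvgZ.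
have za' k : Cb (z k - a).
  have h1 : Cb (c k - a + (K * `|c k - a|) *: e).
    by have := KP (a - c k); rewrite distrC opprB addrC.
  have h2 : Cb (eps k *: y k - (K * `|c k - a|) *: e).
    apply: (closed_cone_trans (y := (K * `|c k - a| * S) *: y k)).
      rewrite -scalerA -scalerBr; apply: (closed_coneZ pc); last exact: base_lower.
      by rewrite mulr_ge0// ltW.
    apply: (closed_cone_le pc) (closed_cone_Co pc (Cy k)).
    rewrite /eps; have := normr_ge0 (c k - a); have := k1 k; have := mulr_gt0 K0 S0.
    by rewrite mulrAC; move: `|_| (_^-1) (K * S) => *; nra.
  by have := closed_coneD h1 h2; rewrite addrACA subrr addr0 /z addrAC.
have zesc := interior_not_escape Cz za (eq_ind_r (fun q => 0 < q) ltr01 a1) nCa.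
(* Up to scale z k is a point of the ray; tau k is its time. *)
have /choice[tau tauP] k : exists t, 0 <= t /\ exists2 q, 0 < q & Y k t = q *: z k.
  have [_ _ R1 _] := rayY k.
  have := R1 (s k) (m k)%:R 1 (eps k) (s0 k) (ler0n _ _) ler01 (ltW (eps0 k)).
  by rewrite scale1r => /(_ (Cz k))[t t0 tP]; exists t.
have tau0 k : 0 <= tau k by have [] := tauP k.
have tauz k v : Co v -> hd (Y k (tau k)) v = hd (z k) v.
  by move=> Cv; have [_ [q q0 ->]] := tauP k; rewrite (hdZl pc).
(* Tracking is known at integer times only; rounding costs 1, hence r + 1 below. *)
pose n k := Num.truncn (tau k).
have ntau k : `|(n k)%:R - tau k| <= 1.
  have /andP[h1 h2] := truncn_itv (tau0 k).
  by rewrite distrC ger0_norm ?subr_ge0// lerBlDl natr1 ltW.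
have nesc (B : R) : \forall k \near U, B <= `|(n k)%:R - (m k)%:R|.
  apply: filterS (zesc (B + 1)) => k; rewrite -(tauz _ _ (Cy k)) Yd// => h.
  have := ler_distD (n k)%:R (tau k) (m k)%:R; rewrite (distrC (tau k) (n k)%:R).
  by have := ntau k; lra.
have /choice[g gP] k : exists g, [/\ cone_aut Co g, hd (g *m e) (Y k (n k)%:R) <= r &
    forall s, 0 < s -> J s <= `|(n k)%:R - (m k)%:R| ->
      nearly_rank1 s g /\ nearly_rank1 s (invmx g)].
  by have [_ [G GP]] := trackY k; exists (G (n k)).
have gC k : cone_aut Co (g k) by have [] := gP k.
have gn (q : R) : 0 < q -> \forall k \near U, nearly_rank1 q (g k) /\ nearly_rank1 q (invmx (g k)).
  by move=> q0; apply: filterS (nesc (J q)) => k h; have [_ _] := gP k; apply.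
have Cge k : Co (g k *m e) by have [_ ->] := gC k.
have hgz k : hd (g k *m e) (z k) <= r + 1.
  have Cn : Co (Y k (n k)%:R) by apply: Yc.
  apply: le_trans (hd_trans pc (y := Y k (n k)%:R) _ _ _) _ => //.
  rewrite [X in _ + X](hdC Co) -tauz// Yd//.
  by have [_ h _] := gP k; have := ntau k; rewrite distrC => h'; exact: lerD.
(* The two factors of [hdP] have product at most exp(2(r + 1)); t is the inverse of the first. *)
have /choice[t tP] k : exists t, [/\ 0 < t, Cb (z k - t *: (g k *m e)) &
    Cb ((expR (2 * (r + 1)) * t) *: (g k *m e) - z k)].
  have [x [t [x0 t0 xz zx xt]]] := hdP pc (Cge k) (Cz k).
  exists x^-1; split; first by rewrite invr_gt0.
    rewrite -[z k]scale1r -(mulVf (lt0r_neq0 x0)) -scalerA -scalerBr.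
    by apply: (closed_coneZ pc) => //; rewrite invr_ge0 ltW.
  apply: closed_cone_trans zx _; apply: (closed_cone_le pc) (closed_cone_Co pc (Cge k)).
  by rewrite ler_pdivlMr// mulrC xt ler_expR ler_pM2l.
apply: (visible_limit pc exposedC (g := g) (c := c) (y := y) (z := z) (b := b) (t := t) (eps := eps)
   (r := expR (2 * (r + 1))) Ce) => //.
- by move=> k; have [] := tP k.
- by move=> k; have [] := tP k.
- by move=> k; have [] := tP k.
- by move=> q q0; apply: filterS (gn q q0) => k [].
- by move=> q q0; apply: filterS (gn q q0) => k [].
- by move=> k; exact: (closed_cone_Co pc).
Qed.

Definition nearly_nearest k p (s : R) :=
  forall t, 0 <= t -> hd p (Y k s) <= hd p (Y k t) + 1.

(** Otherwise visibility from a makes the segment from p k to Y k (s k) pass at bounded distance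
    from the base point Y k (m k). The base point is then almost as near to p k as Y k (s k), which
    leaves no room for the long stretch between the two. *)
Lemma nearest_limit (s : nat -> R) (p : nat -> 'cV[R]_d) (a : 'cV[R]_d) :
  (forall k, 0 <= s k) -> escapes s -> Y k (s k) @[k --> U] --> a ->
  (forall k, Co (p k)) -> (forall k, form phi (p k) = 1) ->
  (forall k, nearly_nearest k (p k) (s k)) -> p @ U --> a.
Proof.
move=> s0 sesc Ya Cp p1 near_ps.
have [q [pq Cq q1]] := ultra_cvg_normalized Cp p1.
have [Ca a1 nCa avis] := ray_endpoint s0 sesc Ya.
suff -> : a = q by [].
have [Cqa|nCqa] := pselect (Co (q + a)); last first.
  have [t qE] := avis _ Cq nCqa.
  by move: q1; rewrite qE lformZ a1 mulr1 => ->; rewrite scale1r.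
exfalso; have [b [yb Cbb _]] := base_limit.
pose w k := p k + Y k (s k).
have Cc k : Co (Y k (s k)) by exact: Yc.
have Cy k : Co (Y k (m k)%:R) by exact: Yc.
have Cw k : Co (w k) by exact: (cone_add pc).
have [A AP] := hd_near_bounded pc Cw Cy (cvgD pq Ya) yb Cqa Cbb.
have [k [h1 h2]] := filter_ex (filterI AP (sesc (2 * A + 2))).
have n1 := near_ps k _ (ler0n _ (m k)).
have n2 := hd_segment pc (s := 1) (t := 1) (Cp k) (Cc k) ler01 ler01.
rewrite !scale1r in n2; have {}n2 := n2 (Cw k); rewrite -/(w k) in n2.
have n3 := hd_trans pc (Cp k) (Cw k) (Cy k).
have n4 := hd_trans pc (Cc k) (Cw k) (Cy k).
rewrite Yd// (hdC Co _ (w k)) in n4.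
exact: excursion_bound h1 h2 n1 n2 n3 n4.
Qed.

(** The segment from p k to q k passes at bounded distance from the base point, so its length is at
    least the distance from p k to the ray up to a constant; a saving of k is impossible for large
    k. *)
Lemma no_long_shortcut (s t : nat -> R) (p q : nat -> 'cV[R]_d) :
  (forall k, 0 <= s k) -> (forall k, 0 <= t k) -> escapes s -> escapes t ->
  (forall k, (s k <= (m k)%:R <= t k) \/ (t k <= (m k)%:R <= s k)) ->
  (forall k, Co (p k)) -> (forall k, form phi (p k) = 1) ->
  (forall k, Co (q k)) -> (forall k, form phi (q k) = 1) ->
  (forall k, nearly_nearest k (p k) (s k)) ->
  (forall k, nearly_nearest k (q k) (t k)) ->
  (forall k, hd (p k) (q k) <= hd (p k) (Y k (s k)) - k%:R) -> False.
Proof.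
move=> s0 t0 sesc tesc mid Cp p1 Cq q1 near_ps near_qt short.
have [a [Ya _ _]] := ultra_cvg_normalized (fun k => Yc k (s0 k)) (fun k => Y1 k (s0 k)).
have [a' [Ya' _ _]] := ultra_cvg_normalized (fun k => Yc k (t0 k)) (fun k => Y1 k (t0 k)).
have pa := nearest_limit s0 sesc Ya Cp p1 near_ps.
have qa' := nearest_limit t0 tesc Ya' Cq q1 near_qt.
have [b [yb Cbb _]] := base_limit.
have Cy k : Co (Y k (m k)%:R) by exact: Yc.
have /choice[xy xyP] k : exists xy : R * R, [/\ 0 <= xy.1, 0 <= xy.2, xy.1 + xy.2 = 1 &
    Y k (m k)%:R = xy.1 *: Y k (s k) + xy.2 *: Y k (t k)].
  have [_ _ _ btw] := rayY k.
  have [x [y [x0 y0 E]]] : exists x y : R, [/\ 0 <= x, 0 <= y & Y k (m k)%:R = x *: Y k (s k) + y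
    *: Y k (t k)].
    case: (mid k) => /andP[h1 h2]; first exact: btw.
    by have [x [y [x0 y0 E]]] := btw _ _ _ (t0 k) h1 h2; exists y, x; rewrite addrC.
  exists (x, y); split => //=.
  by have := Y1 k (ler0n _ (m k)); rewrite E lformD !lformZ !Y1// !mulr1.
have xy1 k i : `|(if i then (xy k).1 else (xy k).2)| <= 1.
  by have [x0 y0 ? _] := xyP k; case: i; rewrite ger0_norm//; lra.
have [x xk] := @ultra_cvg_segment _ U (fun k => (xy k).1) 1 UU (nearW _ (xy1^~ true)).
have [y yk] := @ultra_cvg_segment _ U (fun k => (xy k).2) 1 UU (nearW _ (xy1^~ false)).
(* The coefficients that place the base point between Y k (s k) and Y k (t k) are used between p k
   and q k. These have the same limits a and a', so z k tends to b as well. *)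
pose z k := (xy k).1 *: p k + (xy k).2 *: q k.
have Cz k : Co (z k).
  have [x0 y0 xy1' _] := xyP k; rewrite /z.
  have [x00|x00] := eqVneq (xy k).1 0.
    rewrite x00 scale0r add0r; have -> : (xy k).2 = 1 by lra.
    by rewrite scale1r.
  apply: (cone_closedD (Co := Co)); first by apply: (cone_scale pc) => //; rewrite lt0r x00.
  by apply: (closed_coneZ pc) => //; exact: (closed_cone_Co pc).
have zb : z @ U --> b.
  have -> : b = x *: a + y *: a'.
    apply: (cvg_mx_unique yb).
    rewrite (_ : (fun k => Y k (m k)%:R) = fun k => (xy k).1 *: Y k (s k) + (xy k).2 *: Y k (t k)).
      by apply: cvgD; exact: cvgZ.
    by apply/funext => k; have [] := xyP k.
  by apply: cvgD; exact: cvgZ.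
have [A AP] := hd_near_bounded pc Cz Cy zb yb Cbb Cbb.
have big : \forall k \near U, A + 2 <= k%:R.
  by apply: sU; exact: nbhs_infty_ger.
have [k [h1 h2]] := filter_ex (filterI AP big).
have [x0 y0 _ _] := xyP k.
have n1 := near_ps k _ (ler0n _ (m k)).
have n2 := hd_segment pc (Cp k) (Cq k) x0 y0 (Cz k).
have n3 := hd_trans pc (Cp k) (Cz k) (Cy k).
have n4 := hd_ge0 pc (Cz k) (Cq k).
have n5 := short k.
exact: shortcut_bound h1 h2 n1 n2 n3 n4 n5.
Qed.

End RaySequences.

(** * Contracting rays are Morse *)

(** The slack 1 makes existence immediate from the infimum, without compactness. *)
Definition almost_nearest (R : realType) (T : Type) (h : T -> T -> R) (c : R -> T) p (s : R) :=
  0 <= s /\ forall t, 0 <= t -> h p (c s) <= h p (c t) + 1.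

Lemma exists_almost_nearest (R : realType) (T : Type) (h : T -> T -> R) (c : R -> T) p :
  (forall t, 0 <= t -> 0 <= h p (c t)) -> exists s, almost_nearest h c p s.
Proof.
move=> h_ge0; pose A := [set h p (c t) | t in [set t | 0 <= t]].
have A0 : A !=set0 by exists (h p (c 0)), 0 => //=.
have Ainf : has_inf A.
  by split => //; exists 0 => _ [t t0 <-]; exact: h_ge0.
have [_ [s s0 <-] hs] := inf_adherent ltr01 Ainf.
exists s; split => // t t0; apply: le_trans (ltW hs) _; rewrite lerD2r.
by apply: ge_inf; [case: Ainf|exists t].
Qed.

(* Along an excursion of a quasi-geodesic outside the [contracting_radius]-neighbourhood of a
   contracting ray, [contracting_stride] unit steps move the projection by at most [D]. *)
Definition contracting_stride (R : realType) (D lam : R) := (Num.truncn (2 * lam * D)).+1.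
Definition contracting_radius (R : realType) (D lam a : R) :=
  lam * (contracting_stride D lam)%:R + a + D.
(** An excursion has at most 2 lam (2 H + 3 D + a) unit steps, H being the radius, and the exit is
    at most one time unit further. The upper quasi-geodesic bound turns this time into a distance, H
    leads from the exit to the ray, and the final 1 makes the inequality strict. *)
Definition contracting_gauge (R : realType) (D lam a : R) :=
  lam * (2 * lam * (2 * contracting_radius D lam a + 3 * D + a) + 1) + a
  + contracting_radius D lam a + 1.

Lemma contracting_gauge_ge0 (R : realType) (D lam a : R) :
  0 <= D -> 0 <= lam -> 0 <= a -> 0 <= contracting_gauge D lam a.
Proof.
move=> D0 l0 a0; have H0 : 0 <= contracting_radius D lam a by rewrite !addr_ge0// mulr_ge0.
by rewrite /contracting_gauge !(addr_ge0, mulr_ge0).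
Qed.

(** Outside the radius, l unit steps move a point by at most its distance to its projection minus D,
    so the projection moves by at most D. In n steps it moves by about (n/l) D <= n/(2 lam), whereas
    the two ends of the excursion, both close to their projections, are at distance at least n/lam -
    a. This bounds n. *)
Lemma contracting_morse (R : realType) (T : Type) (X : set T) (h : T -> T -> R) (c : R -> T)
    (D lam a : R) (q : R -> T) (al be : R) :
  (forall p q, X p -> X q -> 0 <= h p q) ->
  (forall p q, X p -> X q -> h p q = h q p) ->
  (forall p q s, X p -> X q -> X s -> h p s <= h p q + h q s) ->
  (forall p, X p -> h p p = 0) ->
  (forall t, 0 <= t -> X (c t)) ->
  (forall s t, 0 <= s -> 0 <= t -> h (c s) (c t) = `|s - t|) ->
  1 <= D ->
  (forall p q s t, X p -> X q -> almost_nearest h c p s -> almost_nearest h c q t ->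
    h p q <= h p (c s) - D -> `|s - t| <= D) ->
  1 <= lam -> 0 <= a ->
  al <= be -> (forall t, al <= t <= be -> X (q t)) ->
  (forall s t, al <= s <= be -> al <= t <= be ->
    lam^-1 * `|s - t| - a <= h (q s) (q t) <= lam * `|s - t| + a) ->
  (exists2 s, 0 <= s & q al = c s) -> (exists2 s, 0 <= s & q be = c s) ->
  forall t, al <= t <= be -> exists2 s, 0 <= s & h (q t) (c s) < contracting_gauge D lam a.
Proof.
move=> h_ge0 h_sym h_tri h_refl cX c_iso D1 contracting.
move=> lam1 a0 albe qX qq qal qbe t0 /andP[alt0 t0be].
have D0 : 0 < D by exact: lt_le_trans D1.
have lam0 : 0 < lam by exact: lt_le_trans lam1.
set l := contracting_stride D lam; set Hh := contracting_radius D lam a.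
have l1 : 1 <= l%:R :> R by rewrite ler1n.
have lD : 2 * lam * D <= l%:R.
  by rewrite ltW// /l truncnS_gt.
have laml : lam <= lam * l%:R by rewrite ler_peMr// ltW.
have HE : Hh = lam * l%:R + a + D by [].
have H1 : 1 <= Hh by rewrite HE; move: laml lam1 a0 D1; clear; lra.
have /choice[tau tauP] t : exists s, al <= t <= be -> almost_nearest h c (q t) s.
  have [/qX Xt|] := pselect (al <= t <= be); last by exists 0.
  have [s sP] : exists s, almost_nearest h c (q t) s; last by exists s.
  by apply: exists_almost_nearest => s s0; apply: h_ge0 => //; exact: cX.
pose f t := h (q t) (c (tau t)).
have tau0 t : al <= t <= be -> 0 <= tau t by move=> /tauP[].
have fend t : al <= t <= be -> (exists2 s, 0 <= s & q t = c s) -> f t <= Hh.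
  move=> tI [s s0 qs]; have [_ /(_ s s0)] := tauP t tI.
  by rewrite -/(f t) -qs (h_refl _ (qX _ tI)) add0r => /le_trans; apply.
have alI : al <= al <= be by rewrite lexx.
have beI : al <= be <= be by rewrite lexx andbT.
have step s t : al <= s <= be -> al <= t <= be -> `|s - t| <= l%:R -> Hh < f s ->
    `|tau s - tau t| <= D.
  move=> sI tI st fs; apply: (contracting _ _ _ _ (qX _ sI) (qX _ tI) (tauP _ sI) (tauP _ tI)).
  have /andP[_ /le_trans] := qq _ _ sI tI; apply.
  rewrite -/(f s); have : lam * `|s - t| <= lam * l%:R by rewrite ler_wpM2l// ltW.
  by move: fs; rewrite HE; clear; lra.
have t0I : al <= t0 <= be by rewrite alt0.
have [ft0|ft0] := leP (f t0) Hh.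
  exists (tau t0); first exact: tau0.
  rewrite -/(f t0); apply: le_lt_trans ft0 _; rewrite /contracting_gauge -/Hh.
  have : 0 <= lam * (2 * lam * (2 * Hh + 3 * D + a) + 1).
    have p1 : 0 <= 2 * Hh + 3 * D + a by move: H1 D1 a0; clear; lra.
    by rewrite mulr_ge0 ?addr_ge0 ?mulr_ge0// ltW.
  by move: a0; clear; lra.
(* Unit steps from t0, forwards or backwards, as long as the path stays outside the radius. The exit
   t1 is the next step, or the end of the interval if that step leaves it; this end lies on the ray,
   so [fend] applies. *)
have exit (dir : bool) : exists (N : nat) (t1 : R),
    let u i := if dir then t0 + i%:R else t0 - i%:R in
    [/\ al <= t1 <= be, f t1 <= Hh, forall i, (i <= N)%N -> al <= u i <= be /\ Hh < f (u i),
        `|t1 - u N| <= 1 & if dir then t0 + N%:R <= t1 else t1 <= t0 - N%:R].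
  pose u i := if dir then t0 + i%:R else t0 - i%:R.
  pose P i := ~~ (al <= u i <= be) || (f (u i) <= Hh).
  have exP : exists i, P i.
    exists (Num.truncn (be - al)).+1; apply/orP; left.
    have := truncnS_gt (be - al); rewrite /u negb_and -!ltNge.
    by case: dir {u P} => h1; apply/orP; [right|left]; move: h1 alt0 t0be; clear; lra.
  case: (ex_minnP exP) => -[|N] PN Nmin.
    by exfalso; move: PN; rewrite /P /u; case: dir {u P exP Nmin};
      rewrite ?addr0 ?subr0 t0I/= leNgt ft0.
  have uP i : (i <= N)%N -> al <= u i <= be /\ Hh < f (u i).
    move=> iN; have : ~~ P i by apply: contraTN iN => /Nmin; rewrite -ltnNge.
    by rewrite negb_or negbK -ltNge => /andP.
  have [uNI|uNI] := boolP (al <= u N.+1 <= be).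
    exists N, (u N.+1) => /=; split => //.
    - by move: PN; rewrite /P uNI.
    - by rewrite /u; case: dir {u P exP PN Nmin uP uNI}; rewrite -natr1 ler_norml; clear; lra.
    - by rewrite /u; case: dir {u P exP PN Nmin uP uNI}; rewrite -natr1; clear; lra.
  exists N, (if dir then be else al) => /=; have [uN _] := uP N (leqnn N).
  have aux : if dir then t0 + N.+1%:R > be else t0 - N.+1%:R < al.
    move: uNI uN; rewrite /u; case: dir {u P exP PN Nmin uP}; rewrite negb_and -!ltNge => /orP[]//.
      have : 0 <= N.+1%:R :> R by [].
      by move: alt0 t0be; clear; lra.
    have : 0 <= N.+1%:R :> R by [].
    by move: alt0 t0be; clear; lra.
  split => //.
  - by case: dir {u P exP PN Nmin uP uNI uN aux}.
  - by case: dir {u P exP PN Nmin uP uNI uN aux}; apply: fend.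
  - move: aux uN; rewrite /u; case: dir {u P exP PN Nmin uP uNI}; rewrite -natr1 ler_norml;
    move: alt0 t0be; clear; lra.
  - by move: aux uN; rewrite /u; case: dir {u P exP PN Nmin uP uNI}; move: alt0 t0be; clear; lra.
have [N1 [t1 [t1I ft1 u1 t1N t1N']]] := exit false.
have [N2 [t2 [t2I ft2 u2 t2N t2N']]] := exit true.
pose n := (N1 + N2)%N.
pose w j := t0 - N1%:R + j%:R.
have wP j : (j <= n)%N -> al <= w j <= be /\ Hh < f (w j).
  move=> jn; have [jN|jN] := leqP j N1.
    have -> : w j = t0 - (N1 - j)%:R by rewrite /w natrB//; ring.
    by apply: u1; exact: leq_subr.
  have -> : w j = t0 + (j - N1)%:R by rewrite /w natrB ?(ltnW jN)//; ring.
  by apply: u2; rewrite leq_subLR.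
(* Jumps of l steps, the last one cut off at j by the minimum. *)
have chain k i j : (i <= j)%N -> (j <= n)%N -> (j <= i + k * l)%N ->
    `|tau (w i) - tau (w j)| <= k%:R * D.
  elim: k i => [|k ih] i ij jn.
    rewrite mul0n addn0 => ji; have -> : i = j by apply/eqP; rewrite eqn_leq ij.
    by rewrite subrr normr0 mul0r.
  rewrite mulSn addnA => ji; pose i' := minn j (i + l).
  have i'j : (i' <= j)%N by rewrite geq_minl.
  have ii' : (i <= i')%N by rewrite leq_min ij leq_addr.
  have ji' : (j <= i' + k * l)%N by rewrite /i' addn_minl leq_min leq_addr.
  have [wi fi] := wP i (leq_trans ij jn); have [wi' _] := wP i' (leq_trans i'j jn).
  have s1 : `|tau (w i) - tau (w i')| <= D.
    apply: step => //; rewrite /w opprD addrACA subrr add0r distrC -natrB// ger0_norm// ler_nat.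
    by rewrite leq_subLR geq_minr.
  have s2 := ih i' i'j jn ji'.
  have := ler_distD (tau (w i')) (tau (w i)) (tau (w j)).
  by move: s1 s2; rewrite -natr1 mulrDl mul1r; clear; lra.
pose k := (n %/ l).+1.
have nk : (n <= 0 + k * l)%N by rewrite add0n ltnW// ltn_ceil.
have ch := chain k 0%N n (leq0n _) (leqnn _) nk.
have [w0I fw0] := wP 0%N (leq0n _); have [wnI fwn] := wP n (leqnn _).
have wn : w n = t0 + N2%:R by rewrite /w natrD; ring.
have w0 : w 0%N = t0 - N1%:R by rewrite /w addr0.
have e1 : `|tau (w 0%N) - tau t1| <= D.
  by apply: step => //; rewrite distrC w0; exact: le_trans l1.
have e2 : `|tau (w n) - tau t2| <= D.
  by apply: step => //; rewrite distrC wn; exact: le_trans l1.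
have t12 : `|tau t1 - tau t2| <= k%:R * D + 2 * D.
  have := ler_distD (tau (w 0%N)) (tau t1) (tau t2).
  have := ler_distD (tau (w n)) (tau (w 0%N)) (tau t2).
  by move: ch e1 e2; rewrite (distrC (tau t1) (tau (w 0%N))); clear; lra.
have h12 : h (q t1) (q t2) <= 2 * Hh + (k%:R * D + 2 * D).
  have X1 := qX _ t1I; have X2 := qX _ t2I.
  have Xc1 := cX _ (tau0 _ t1I); have Xc2 := cX _ (tau0 _ t2I).
  have i1 := h_tri _ _ _ X1 Xc1 X2; have i2 := h_tri _ _ _ Xc1 Xc2 X2.
  rewrite (c_iso _ _ (tau0 _ t1I) (tau0 _ t2I)) (h_sym _ _ Xc2 X2) in i2.
  move: i1 i2 ft1 ft2 t12; rewrite -/(f t1) -/(f t2); clear; lra.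
have nt12 : n%:R <= `|t1 - t2|.
  by rewrite distrC (le_trans _ (ler_norm _))// /n natrD; move: t1N' t2N'; clear; lra.
have /andP[q12 _] := qq _ _ t1I t2I.
have kl : k%:R * l%:R <= n%:R + l%:R :> R.
  by rewrite -natrM -natrD ler_nat /k mulSn addnC leq_add2r leq_trunc_div.
(* As 2 lam D <= l and k l <= n + l, the term k D is at most n/(2 lam) + D. Half of n is absorbed on
   the left, and the extra D turns 2 D into 3 D. *)
have nB : n%:R <= 2 * lam * (2 * Hh + 3 * D + a).
  have kD : k%:R * (2 * lam * D) <= n%:R + 2 * lam * D.
    have l0 : 0 < l%:R :> R by exact: lt_le_trans l1.
    rewrite -(ler_pM2r l0); have n0 : 0 <= n%:R :> R by [].
    have lD0 : 0 <= 2 * lam * D by rewrite !mulr_ge0// ltW.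
    have p1 : 2 * lam * D * (k%:R * l%:R) <= 2 * lam * D * (n%:R + l%:R) by rewrite ler_wpM2l.
    have p2 : n%:R * (2 * lam * D) <= n%:R * l%:R by rewrite ler_wpM2l.
    by move: p1 p2 kl; clear; nra.
  have : n%:R <= lam * (2 * Hh + (k%:R * D + 2 * D) + a).
    rewrite mulrC -ler_pdivrMr// mulrC; apply: le_trans (_ : lam^-1 * `|t1 - t2| <= _).
      by rewrite ler_wpM2l// invr_ge0 ltW.
    by move: q12 h12; clear; lra.
  by move: kD; clear; lra.
exists (tau t1); first exact: tau0.
have X1 := qX _ t1I; have X0 := qX _ t0I; have Xc1 := cX _ (tau0 _ t1I).
have i1 := h_tri _ _ _ X0 X1 Xc1; rewrite -/(f t1) in i1.
have /andP[_ q01] := qq _ _ t0I t1I.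
have t01 : `|t0 - t1| <= n%:R + 1.
  have : N1%:R <= n%:R :> R by rewrite ler_nat leq_addr.
  have := ler_distD (t0 - N1%:R) t0 t1.
  rewrite subKr (ger0_norm (ler0n _ N1)) (distrC (t0 - N1%:R) t1); move: t1N => /=; clear; lra.
have : lam * `|t0 - t1| <= lam * (2 * lam * (2 * Hh + 3 * D + a) + 1).
  rewrite ler_wpM2l ?(ltW lam0)//; move: t01 nB; clear; lra.
rewrite /contracting_gauge -/Hh; move: i1 q01 ft1; clear; lra.
Qed.

(** * The topology of projective space *)

Section ProjectiveTopology.
Context (R : realType) (d : nat).
Implicit Types (u v : 'cV[R]_d) (p : proj_space R d) (A : set (proj_space R d)).

Lemma represents_vec p : represents (vec p) p.
Proof.
exists (vec_neq0 p); rewrite -[LHS]reprK /proj_class; congr (\pi_(proj_space R d) _).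
exact: val_inj.
Qed.

Lemma represents_neq0 v p : represents v p -> v != 0.
Proof. by case. Qed.

Lemma represents_class v (v0 : v != 0) : represents v (proj_class v0).
Proof. by exists v0. Qed.

Lemma representsP u v p : represents v p ->
  represents u p <-> exists2 k : R, k != 0 & u = k *: v.
Proof.
move=> [v0 ->]; split=> [[u0 /esym/proj_classP//]|[k k0 uE]].
have u0 : u != 0 by rewrite uE scaler_eq0 negb_or k0.
by exists u0; apply/proj_classP; exists k^-1; rewrite ?invr_eq0// uE scalerA mulVf ?scale1r.
Qed.

Lemma representsZ k v p : k != 0 -> represents v p -> represents (k *: v) p.
Proof. by move=> k0 vp; apply/(representsP _ vp); exists k. Qed.

Lemma represents_unique v p p' : represents v p -> represents v p' -> p = p'.
Proof.
move=> [v0 ->] [v0' ->]; apply/proj_classP; exists 1; rewrite ?oner_eq0//.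
by rewrite scale1r.
Qed.

Lemma open_representatives A : open A ->
  open [set v | exists2 p, A p & represents v p].
Proof.
move=> oA; have : open (\pi_(proj_space R d) @^-1` A) by [].
move=> [B oO OE].
have -> : [set v | exists2 p, A p & represents v p] = B `&` ~` [set 0].
  apply/seteqP; split=> v /=.
    move=> [p Ap [v0 pE]]; split; last by apply/eqP.
    have : (set_val @^-1` B) (SigSub (mem_set v0 : v \in nonzero_vector R d)).
      by rewrite OE /= -/(proj_class v0) -pE.
    by rewrite /= set_valE.
  move=> [Ov /eqP v0]; exists (proj_class v0); last exact: represents_class.
  suff : (\pi_(proj_space R d) @^-1` A) (SigSub (mem_set v0 : v \in nonzero_vector R d)) by [].
  by rewrite -OE /= set_valE.
apply: openI => //; apply: closed_openC.
exact: (accessible_closed_set1 (hausdorff_accessible (@norm_hausdorff R 'cV[R]_d))).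
Qed.

Lemma open_scale_saturation (B : set 'cV[R]_d) : open B ->
  open [set v | exists2 k : R, k != 0 & B (k *: v)].
Proof.
move=> oO; have -> : [set v | exists2 k : R, k != 0 & B (k *: v)] =
    \bigcup_(k in [set k : R | k != 0]) ((fun v => k *: v) @^-1` B).
  by apply/seteqP; split=> v [k k0 Ok]; exists k.
apply: bigcup_open => k _; move: oO; apply: (continuousP _).1; exact: scaler_continuous.
Qed.

(** The saturation of an open set is the union of its nonzero multiples, so the projection is an
    open map. *)
Lemma open_projection (B : set 'cV[R]_d) : open B ->
  open [set p : proj_space R d | exists2 v, B v & represents v p].
Proof.
move=> oB; exists [set v | exists2 k : R, k != 0 & B (k *: v)].
  exact: open_scale_saturation.
apply/seteqP; split=> -[v v0] /=; rewrite set_valE /=; set p := \pi_(_) _.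
  have vp : represents v p.
    have v0' : v != 0 by exact: set_mem v0.
    by exists v0'; rewrite /p; congr (\pi_(_) _); exact: val_inj.
  by move=> [k k0 Bk]; exists (k *: v) => //; exact: representsZ.
have vp : represents v p.
  have v0' : v != 0 by exact: set_mem v0.
  by exists v0'; rewrite /p; congr (\pi_(_) _); exact: val_inj.
by move=> [w Bw /(representsP _ vp)[k k0 wE]]; exists k; rewrite -?wE.
Qed.

(** One representative is enough to test closure, because the projection from nonzero vectors is
    both continuous and open. *)
Lemma closure_projP A v p : represents v p ->
  closure A p <-> forall B, nbhs v B -> exists w q, [/\ B w, A q & represents w q].
Proof.
move=> vp; split=> [Ap B|h N].
  rewrite nbhsE => -[B' [oB' B'v] B'B].
  have : nbhs p [set q | exists2 w, B' w & represents w q].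
    by rewrite nbhsE; exists [set q | exists2 w, B' w & represents w q] => //; split;
      [exact: open_projection|exists v].
  by move=> /Ap[q [Aq [w B'w wq]]]; exists w, q; split => //; exact: B'B.
rewrite nbhsE => -[N' [oN' N'p] N'N].
have : nbhs v [set w | exists2 q, N' q & represents w q].
  by rewrite nbhsE; exists [set w | exists2 q, N' q & represents w q] => //; split;
    [exact: open_representatives|exists p].
move=> /h[w [q [[q' N'q' wq'] Aq wq]]]; exists q; split => //; apply: N'N.
by rewrite (represents_unique wq wq').
Qed.

End ProjectiveTopology.

(** * The cone over a convex domain *)

(** The vectors representing points of the domain form two opposite cones; the sign of [phi] selects
    one. *)
Definition cone_over (R : realType) d (Omega : set (proj_space R d)) (phi : 'rV[R]_d) :
  set 'cV[R]_d := [set v | 0 < form phi v /\ exists2 p, Omega p & represents v p].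

Record convex_chart (R : realType) d (Omega : set (proj_space R d)) (phi : 'rV[R]_d) : Prop :=
  ConvexChart {
    chart_nonempty : Omega !=set0;
    chart_open : open Omega;
    chart_closure : closure Omega `<=` affine_chart phi;
    chart_convex : convex_set (affine_coord phi @` Omega : set (convex_lmodType 'cV[R]_d));
    chart_bounded : bounded_set (affine_coord phi @` closure Omega) }.

Section ConeOver.
Context (R : realType) (d : nat) (Omega : set (proj_space R d)) (phi : 'rV[R]_d).
Hypothesis oc : convex_chart Omega phi.
Let Omega_nonempty := chart_nonempty oc.
Let Omega_open := chart_open oc.
Let Omega_chart := chart_closure oc.
Let Omega_convex := chart_convex oc.
Let Omega_bounded := chart_bounded oc.
Local Notation Co := (cone_over Omega phi).
Local Notation Cb := (closed_cone Co).
Local Notation lift := (affine_coord phi).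
Implicit Types (u v w : 'cV[R]_d) (p q x y : proj_space R d).

Lemma liftE v p : represents v p -> form phi v != 0 -> lift p = (form phi v)^-1 *: v.
Proof.
move=> vp v0; have [k k0 pE] := (representsP _ vp).1 (represents_vec p).
rewrite /affine_coord pE lformZ invfM scalerA -mulrA [_ * k]mulrC mulrA mulVf ?mul1r//.
Qed.

Lemma lift_represents p : closure Omega p -> represents (lift p) p.
Proof.
move=> /Omega_chart/eqP h; apply: representsZ (represents_vec p).
by rewrite invr_eq0.
Qed.

Lemma form_lift p : closure Omega p -> form phi (lift p) = 1.
Proof. by move=> /Omega_chart/eqP h; rewrite lformZ mulVf. Qed.

Lemma cone_over_lift p : Omega p -> Co (lift p).
Proof.
move=> Op; have cp := subset_closure Op.
by split; [rewrite form_lift|exists p => //; exact: lift_represents].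
Qed.

Lemma cone_over_rep v p : form phi v != 0 -> represents v p -> v = form phi v *: lift p.
Proof. by move=> v0 vp; rewrite (liftE vp v0) scalerA mulfV// scale1r. Qed.

Lemma cone_overE v : Co v -> exists2 p, Omega p & v = form phi v *: lift p.
Proof.
by move=> [v0 [p Op vp]]; exists p => //; apply: cone_over_rep => //; rewrite gt_eqF.
Qed.

Lemma cone_over_proper : proper_cone Co phi.
Proof.
split.
- by have [p Op] := Omega_nonempty; exists (lift p); exact: cone_over_lift.
- have h : open (form phi @^-1` [set x | 0 < x]).
    have hc : continuous (form phi) by move=> v; apply: (@cvg_form R _ (nbhs v) _ d phi id v);
      exact: cvg_id.
    by move/continuousP: hc; apply; exact: open_gt.
  exact: openI h (open_representatives Omega_open).
- move=> u v Cu Cv; have [[u0 _] [v0 _]] := (Cu, Cv).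
  have [p Op uE] := cone_overE Cu; have [q Oq vE] := cone_overE Cv.
  (* u + v is s times the convex combination of the two lifts with weights phi(u)/s and phi(v)/s. *)
  pose s := form phi u + form phi v; have s0 : 0 < s by rewrite addr_gt0.
  have l0 : 0 <= form phi u / s by rewrite divr_ge0 ?ltW.
  have l1 : form phi u / s <= 1 by rewrite ler_pdivrMr// mul1r lerDl ltW.
  have := Omega_convex (Itv01 l0 l1) (mem_set (ex_intro2 _ _ p Op erefl)) (mem_set (ex_intro2 _ _
    q Oq erefl)).
  move=> /set_mem[t Ot]; rewrite /conv/= => tE.
  have -> : u + v = s *: lift t.
    have -> : lift t = (form phi u / s) *: lift p + (1 - form phi u / s) *: lift q by [].
    rewrite scalerDr scalerA [s *: (_ *: lift q)]scalerA mulrBr mulr1 mulrC divfK ?gt_eqF//.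
    by rewrite [X in X - _]addrC addrK -uE -vE.
  split; first by rewrite lformZ form_lift ?mulr1//; exact: subset_closure.
  by exists t => //; apply: representsZ; [rewrite gt_eqF|exact/lift_represents/subset_closure].
- move=> k v k0 [v0 [p Op vp]]; split; first by rewrite lformZ mulr_gt0.
  by exists p => //; apply: representsZ => //; rewrite gt_eqF.
- by move=> v [].
- have [M [_ /(_ (M + 1))]] := Omega_bounded; rewrite ltrDl ltr01 => /(_ isT) h.
  exists (M + 1) => v Cv; have [p Op vE] := cone_overE Cv; have [v0 _] := Cv.
  rewrite vE {1}normrZ gtr0_norm// lformZ form_lift; last exact: subset_closure.
  rewrite mulr1 mulrC ler_wpM2r ?(ltW v0)//; apply: h.
  by exists p => //; exact: subset_closure.
Qed.

Let pc := cone_over_proper.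

Lemma closed_cone_over_closure v p : Cb v -> represents v p -> closure Omega p.
Proof.
move=> Cv vp; apply/(closure_projP _ vp) => B vB.
have [e Ce] := cone_nonempty pc.
have h : v + k.+1%:R^-1 *: e @[k --> \oo] --> v.
  rewrite -[X in _ --> X]addr0 -(scale0r e); apply: cvgD; first exact: cvg_cst.
  by apply: cvgZr_tmp; exact: cvg_harmonic.
have [k /= Bk] := @filter_ex _ \oo _ [set k : nat | B (v + k.+1%:R^-1 *: e)] (h _ vB).
have [_ [q Oq wq]] : Co (v + k.+1%:R^-1 *: e).
  by apply: Cv; apply: (cone_scale pc) => //; rewrite invr_gt0.
by exists (v + k.+1%:R^-1 *: e), q.
Qed.

Lemma boundary_of_cone v p : Cb v -> ~ Co v -> represents v p -> boundary Omega p.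
Proof.
move=> Cv nCv vp; split; first exact: closed_cone_over_closure vp.
move=> /interior_subset Op; apply: nCv; split; last by exists p.
rewrite lt0r (closed_cone_form pc Cv) andbT; apply/negP => /eqP v0.
by have := represents_neq0 vp; rewrite (closed_cone_eq0 pc Cv v0) eqxx.
Qed.

Lemma lift_closure p : closure Omega p -> Cb (lift p).
Proof.
move=> cp; have pp := lift_represents cp.
have p1 := form_lift cp.
have h (n : nat) : exists w, Co w /\ `|lift p - w| < n.+1%:R^-1.
  pose B := ball (lift p) n.+1%:R^-1 `&` [set w | 0 < form phi w].
  have BN : nbhs (lift p) B.
    apply: filterI; first by apply: nbhsx_ballx; rewrite invr_gt0.
    have hc : form phi w @[w --> lift p] --> form phi (lift p).
      by apply: (@cvg_form R _ (nbhs (lift p)) _ d phi id (lift p)); exact: cvg_id.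
    by apply: (cvgr_gt _ hc); rewrite p1.
  have [w [q [[bw w0] Oq wq]]] := (closure_projP _ pp).1 cp _ BN.
  by exists w; split; [split => //; exists q|move: bw; rewrite -ball_normE].
have /choice[w wP] := h.
apply: (closed_cone_cvg pc (F := \oo) (f := w)); last first.
  by apply: nearW => n; have [] := wP n => Cw _; exact: (closed_cone_Co pc).
apply/cvgrPdist_lt => e e0.
have := @cvg_harmonic R; move=> /cvgrPdist_lt/(_ e e0); apply: filterS => n.
rewrite sub0r normrN ger0_norm ?invr_ge0// => hn.
by apply: lt_trans hn; have [] := wP n.
Qed.

Lemma lift_boundary p : boundary Omega p -> Cb (lift p) /\ ~ Co (lift p).
Proof.
move=> [cp nip]; split; first exact: lift_closure.
move=> [_ [q Oq /represents_unique/(_ (lift_represents cp)) qp]]; apply: nip.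
by rewrite (interior_id _).1// -qp.
Qed.

End ConeOver.

(** * Exposed faces and extreme rays *)

Section Bridge.
Context (R : realType) (d : nat) (Omega : set (proj_space R d)) (phi : 'rV[R]_d).
Hypothesis oc : convex_chart Omega phi.
Local Notation Co := (cone_over Omega phi).
Local Notation Cb := (closed_cone Co).
Local Notation lift := (affine_coord phi).
Implicit Types (u v w : 'cV[R]_d) (p q x y : proj_space R d).
Let pc := cone_over_proper oc.

(** If psi u > 0 > psi v, then (- psi v) u + (psi u) v is in S and psi vanishes there. This settles
    the signs of representatives, charts and automorphisms. *)
Lemma lform_sign (psi : 'rV[R]_d) (S : set 'cV[R]_d) :
  (forall u v, S u -> S v -> S (u + v)) -> (forall k v, 0 < k -> S v -> S (k *: v)) ->
  (forall v, S v -> form psi v != 0) ->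
  (forall v, S v -> 0 < form psi v) \/ (forall v, S v -> 0 < form (- psi) v).
Proof.
move=> Sadd Sscale S0.
have [[u [Su u0]]|h] := pselect (exists u, S u /\ 0 < form psi u); last first.
  right=> v Sv; rewrite lformNl oppr_gt0 lt_neqAle S0//= leNgt.
  by apply/negP => v0; apply: h; exists v.
left=> v Sv; rewrite ltNge; apply/negP => v0.
have {}v0 : form psi v < 0 by rewrite lt_neqAle S0.
have nv0 : 0 < - form psi v by rewrite oppr_gt0.
have := S0 _ (Sadd _ _ (Sscale _ _ nv0 Su) (Sscale _ _ u0 Sv)).
by rewrite lformD !lformZ mulNr mulrC addNr eqxx.
Qed.

(** Up to a common sign the sector spanned by u and v lies in the closed cone, and a is a positive
    combination of its edges. Extremality makes both edges proportional to a, so the ends of the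
    segment would coincide. *)
Lemma boundary_extreme_no_segment a S : Cb a -> ~ Co a -> a != 0 ->
  (forall w, Cb w -> Cb (a - w) -> exists t, w = t *: a) ->
  is_open_segment S -> S `<=` boundary Omega -> forall p, represents a p -> ~ S p.
Proof.
move=> Ca nCa a0 aext [x [y [u [v [xy ux vy SE]]]]] SB p ap Sp.
have [s [t [s0 t0 zp]]] : open_segment u v p by rewrite -SE.
have seg0 (s' t' : R) : 0 < s' -> 0 < t' -> s' *: u + t' *: v != 0.
  move=> s'0 t'0; apply/eqP => /eqP; rewrite addr_eq0 => /eqP su.
  apply: xy; apply: (represents_unique ux); apply/(representsP _ vy).
  exists (- (t' / s')); first by rewrite oppr_eq0 mulf_neq0 ?invr_eq0 ?gt_eqF.
  by rewrite scaleNr -mulrC -scalerA -scalerN -su scalerA mulVf ?scale1r// gt_eqF.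
pose T := [set w | exists s' t' : R, [/\ 0 < s', 0 < t' & w = s' *: u + t' *: v]].
have Tb w q : T w -> represents w q -> boundary Omega q.
  by move=> [s' [t' [s'0 t'0 ->]]] wq; apply: SB; rewrite SE; exists s', t'.
(* Representatives come with arbitrary signs. The sector is convex and [phi] does not vanish on it,
   so one sign eps serves for all of it. *)
have [eps eps0 epsT] : exists2 eps : R, eps != 0 & forall w, T w -> Cb (eps *: w).
  have : (forall w, T w -> 0 < form phi w) \/ (forall w, T w -> 0 < form (- phi) w).
    apply: lform_sign.
    - move=> _ _ [s1 [t1 [s10 t10 ->]]] [s2 [t2 [s20 t20 ->]]].
      by exists (s1 + s2), (t1 + t2); rewrite !addr_gt0// !scalerDl addrACA.
    - move=> k _ k0 [s1 [t1 [s10 t10 ->]]].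
      by exists (k * s1), (k * t1); rewrite !mulr_gt0// scalerDr !scalerA.
    - move=> _ [s1 [t1 [s10 t10 ->]]]; set w := _ + _.
      have := represents_class (seg0 _ _ s10 t10); set q := proj_class _ => wq.
      have [cq _] := Tb w _ (ex_intro _ s1 (ex_intro _ t1 (And3 s10 t10 erefl))) wq.
      have q0 := chart_closure oc cq; apply/eqP => w0; apply: q0.
      have [k k0 qE] := (representsP _ wq).1 (represents_vec q).
      by rewrite /hyperplane/= qE lformZ w0 mulr0.
  have key w : T w -> form phi w != 0 -> Cb ((form phi w)^-1 *: w).
    move=> Tw w0; have w00 : w != 0 by apply: contraNneq w0 => ->; rewrite lform0.
    have wq := represents_class w00.
    by have [] := lift_boundary oc (Tb _ _ Tw wq); rewrite (liftE wq w0).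
  case=> Tpos; [exists 1|exists (-1)]; rewrite ?oppr_eq0 ?oner_eq0// => w Tw; have w0 := Tpos _ Tw.
    rewrite scale1r -[w]scale1r -(mulfV (lt0r_neq0 w0)) -scalerA.
    by apply: (closed_coneZ pc); [exact: ltW|apply: key; rewrite // gt_eqF].
  rewrite lformNl oppr_gt0 in w0.
  have -> : -1 *: w = (- form phi w) *: ((form phi w)^-1 *: w).
    by rewrite scalerA mulNr mulfV// lt_eqF.
  by apply: (closed_coneZ pc); [rewrite oppr_ge0 ltW|apply: key; rewrite // lt_eqF].
have endpoint w : (forall k : R, 0 < k -> T (w + k *: (u + v))) -> Cb (eps *: w).
  move=> wT; apply: (closed_cone_cvg pc (F := \oo) (f := fun n => eps *: (w + n.+1%:R^-1 *: (u +
    v)))).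
    rewrite -[w in X in _ --> X]addr0 -(scale0r (u + v)); apply: cvgZl_tmp.
    by apply: cvgD; [exact: cvg_cst|apply: cvgZr_tmp; exact: cvg_harmonic].
  by apply: nearW => n; apply: epsT; apply: wT; rewrite invr_gt0.
have Cu : Cb (eps *: u).
  apply: endpoint => k k0; exists (1 + k), k; split; rewrite ?addr_gt0//.
  by rewrite scalerDl scale1r scalerDr addrA.
have Cv : Cb (eps *: v).
  apply: endpoint => k k0; exists k, (1 + k); split; rewrite ?addr_gt0//.
  by rewrite scalerDl scale1r scalerDr addrCA.
have [l l0 aE] := (representsP _ zp).1 ap.
pose c := l / eps; have aE' : a = (c * s) *: (eps *: u) + (c * t) *: (eps *: v).
  rewrite aE scalerDr !scalerA /c; congr (_ *: _ + _ *: _); field; exact: eps0.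
have c0 : 0 < c.
  rewrite ltNge; apply/negP => c0; move/eqP: a0; apply.
  apply: (closed_cone_anti pc) => //.
  rewrite aE' opprD -(scaleNr (c * s)) -(scaleNr (c * t)) -(mulNr c s) -(mulNr c t).
  have nc0 : 0 <= - c by rewrite oppr_ge0.
  apply: closed_coneD; apply: (closed_coneZ pc) => //.
    exact: mulr_ge0 nc0 (ltW s0).
  exact: mulr_ge0 nc0 (ltW t0).
have ext w b : 0 < b -> Cb w -> Cb (a - b *: w) -> exists t', w = t' *: a.
  move=> b0 Cw /(aext _ (closed_coneZ pc (ltW b0) Cw))[t' bE]; exists (b^-1 * t').
  by rewrite -scalerA -bE scalerA mulVf ?scale1r// gt_eqF.
have [t1 uE] : exists t', eps *: u = t' *: a.
  apply: (ext _ (c * s)) => //; first exact: mulr_gt0.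
  by rewrite aE' addrC addKr; apply: (closed_coneZ pc) => //; rewrite mulr_ge0// ltW.
have [t2 vE] : exists t', eps *: v = t' *: a.
  apply: (ext _ (c * t)) => //; first exact: mulr_gt0.
  by rewrite aE' addrK; apply: (closed_coneZ pc) => //; rewrite mulr_ge0// ltW.
have rep w q t' : represents w q -> eps *: w = t' *: a -> p = q.
  move=> wq wE; have t'0 : t' != 0.
    apply: contraNneq (represents_neq0 (representsZ eps0 wq)) => t'0.
    by rewrite wE t'0 scale0r.
  by apply: (represents_unique (representsZ t'0 ap)); rewrite -wE; exact: representsZ.
by apply: xy; rewrite -(rep _ _ _ ux uE) -(rep _ _ _ vy vE).
Qed.

Lemma exposed_cone_over : exposed_boundary Omega -> exposed_cone Co.
Proof.
move=> hexp a Ca nCa a0 aext.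
have ap := represents_class a0; set p := proj_class a0 in ap.
have pB : boundary Omega p by exact: (boundary_of_cone oc) ap.
have [F [[x xB FE] [psi [psi0 _ psiO] psiF]] Fp] := hexp _ pB.
(* No boundary segment contains p, so the exposed face through p is {p}. *)
have noseg S : is_open_segment S -> S `<=` boundary Omega -> ~ S p.
  by move=> S1 S2; exact: (boundary_extreme_no_segment Ca nCa a0 aext S1 S2 ap).
have xp : x = p.
  by move: Fp; rewrite FE => -[_ [//|[S [S1 S2 Sx Sp]]]]; have := noseg S S1 S2 Sp.
have Fp1 q : F q -> q = p.
  rewrite FE xp => -[_ [//|[S [S1 S2 Sp Sq]]]]; by have := noseg S S1 S2 Sp.
have formq (chi : 'rV[R]_d) v q : represents v q -> hyperplane chi q <-> form chi v = 0.
  move=> vq; have [k k0 qE] := (representsP _ vq).1 (represents_vec q).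
  rewrite /hyperplane/= qE lformZ; split=> [/eqP|->]; last by rewrite mulr0.
  by rewrite mulf_eq0 (negPf k0) => /eqP.
have CoN v : Co v -> form psi v != 0.
  move=> [_ [q Oq vq]]; apply/eqP => /(formq _ _ _ vq) hq.
  have : (hyperplane psi `&` Omega) q by split.
  by rewrite psiO.
have psia : form psi a = 0.
  apply/(formq _ _ _ ap).
  by have [] : (hyperplane psi `&` boundary Omega) p by rewrite psiF; exact: subset_closure.
have psiv v : Cb v -> form psi v = 0 -> exists t, v = t *: a.
  move=> Cv v0; have [->|vn0] := eqVneq v 0; first by exists 0; rewrite scale0r.
  have vq := represents_class vn0; set q := proj_class _ in vq.
  have nCv : ~ Co v by move=> /CoN; rewrite v0 eqxx.
  have : closure F q.
    by rewrite -psiF; split; [apply/(formq _ _ _ vq)|exact: (boundary_of_cone oc) vq].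
  move=> /(closure_projP _ vq) clq.
  (* Only membership of q in the closure of F = {p} is known. The equation a_i w_j = a_j w_i holds
     for all representatives w of p and is closed in w, so it passes to v. *)
  have wedge i j : a i 0 * v j 0 = a j 0 * v i 0.
    apply/eqP; rewrite -subr_eq0; apply: contraT => ne0.
    pose B := [set w : 'cV[R]_d | a i 0 * w j 0 - a j 0 * w i 0 != 0].
    have vB : nbhs v B.
      have hc : a i 0 * w j 0 - a j 0 * w i 0 @[w --> v] --> a i 0 * v j 0 - a j 0 * v i 0.
        by apply: cvgB; apply: cvgM; (exact: cvg_cst || exact: coord_continuous).
      have oN : open [set z : R | z != 0].
        rewrite (_ : [set z : R | z != 0] = ~` [set 0]).
          apply: closed_openC.
          exact: (accessible_closed_set1 (hausdorff_accessible (@Rhausdorff R))).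
        by apply/seteqP; split=> z /= => [/eqP|?]; [|apply/eqP].
      by apply: (hc [set z : R | z != 0]); apply: open_nbhs_nbhs.
    have [w [q' [Bw /Fp1 -> wp]]] := clq _ vB.
    have [k k0 wE] := (representsP _ ap).1 wp.
    by move: Bw; rewrite /B/= wE !mxE mulrCA [a j 0 * _]mulrCA -mulrBr [a j 0 * _]mulrC subrr
      mulr0 eqxx.
  have /cV0Pn[i ai] := a0.
  exists (v i 0 / a i 0); apply/colP => j; rewrite [RHS]mxE.
  by rewrite mulrAC -[v i 0 * _]mulrC -wedge mulrAC mulfV// mul1r.
have [pos|neg] := lform_sign (cone_add pc) (cone_scale pc) CoN.
  exists psi; split => //; apply: (form_nonneg_closed pc) => v /pos; exact: ltW.
exists (- psi); split => //.
- by rewrite oppr_eq0.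
- by apply: (form_nonneg_closed pc) => v /neg; exact: ltW.
- by rewrite lformNl psia oppr0.
- by move=> v Cv; rewrite lformNl => /eqP; rewrite oppr_eq0 => /eqP; exact: psiv.
Qed.

End Bridge.

(** * The Hilbert metric as a cone metric *)

Section Chords.
Context (R : realType) (d : nat) (Co : set 'cV[R]_d) (phi : 'rV[R]_d).
Hypothesis pc : proper_cone Co phi.
Local Notation Cb := (closed_cone Co).
Implicit Types (A B X Y Z : 'cV[R]_d).

(** The difference (1 - s)/(1 - t) Y - X is a nonnegative multiple of the boundary vector B; a
    smaller gauge would put that multiple in Co. *)
Lemma gauge_chord A B (s t : R) :
  Cb B -> ~ Co B -> 0 < s -> s <= t -> t < 1 ->
  Co ((1 - s) *: A + s *: B) -> Co ((1 - t) *: A + t *: B) ->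
  gauge Co ((1 - s) *: A + s *: B) ((1 - t) *: A + t *: B) = (1 - s) / (1 - t).
Proof.
move=> CB nCB s0 st t1; set X := _ + s *: B; set Y := _ + t *: B => CX CY.
have t10 : 0 < 1 - t by lra.
have [g1 g0 gmin] := gaugeP pc CX CY.
have E : ((1 - s) / (1 - t)) *: Y - X = ((t - s) / (1 - t)) *: B.
  rewrite /X /Y scalerDr !scalerA divfK ?gt_eqF// opprD addrACA subrr add0r -scalerBl.
  by congr (_ *: _); field; rewrite gt_eqF.
have c0 : 0 <= (t - s) / (1 - t) by rewrite divr_ge0//; lra.
apply/le_anti/andP; split; first by apply: gmin; rewrite E; exact: (closed_coneZ pc).
rewrite leNgt; apply/negP => glt.
have : Co (((t - s) / (1 - t)) *: B).
  rewrite -E -(subrK (gauge Co X Y *: Y) (((1 - s) / (1 - t)) *: Y)) -addrA -scalerBl.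
  by rewrite addrC; apply: g1; apply: (cone_scale pc); rewrite ?subr_gt0.
move: c0; rewrite le_eqVlt => /predU1P[<-|c0].
  by rewrite scale0r => /(cone_neq0 pc); rewrite eqxx.
move=> h; apply: nCB; rewrite -[B]scale1r -(mulVf (lt0r_neq0 c0)) -scalerA.
by apply: (cone_scale pc) => //; rewrite invr_gt0.
Qed.

Lemma hd_chord A B (s t : R) :
  Cb A -> ~ Co A -> Cb B -> ~ Co B -> 0 < s -> s <= t -> t < 1 ->
  Co ((1 - s) *: A + s *: B) -> Co ((1 - t) *: A + t *: B) ->
  hd Co ((1 - s) *: A + s *: B) ((1 - t) *: A + t *: B) =
  ln ((t * (1 - s)) / (s * (1 - t))) / 2.
Proof.
move=> CA nCA CB nCB s0 st t1 CX CY; rewrite /hd gauge_chord//.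
have swap (q : R) : (1 - q) *: A + q *: B = (1 - (1 - q)) *: B + (1 - q) *: A.
  by rewrite subKr addrC.
rewrite (swap s) (swap t) in CX CY *.
rewrite gauge_chord//; [|lra|lra|lra].
by congr (ln _ / _); field; rewrite !gt_eqF//; lra.
Qed.

Lemma gauge_not_interior X Y : Co X -> Co Y -> ~ Co (gauge Co X Y *: Y - X).
Proof.
move=> CX CY /(cone_small pc Y)[e e0 h].
have [_ _ /(_ (gauge Co X Y - e))] := gaugeP pc CX CY.
rewrite scalerBl addrAC => /(_ (closed_cone_Co pc h)); lra.
Qed.

(** With the gauges g of (X, Y) and h of (Y, X), the line leaves the cone at g Y - X and h X - Y,
    which are not in Co because the gauges are least. Solving for X and Y gives s = (g - 1)/(g h -
    1) and t = h s. *)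
Lemma exists_chord X Y : Co X -> Co Y -> form phi X = 1 -> form phi Y = 1 -> X != Y ->
  exists A B (s t : R), [/\ Cb A /\ ~ Co A, Cb B /\ ~ Co B, form phi A = 1 /\ form phi B = 1,
    [/\ 0 < s, s <= t & t < 1] & X = (1 - s) *: A + s *: B /\ Y = (1 - t) *: A + t *: B].
Proof.
move=> CX CY X1 Y1 XY.
have key U V : Co U -> Co V -> form phi U = 1 -> form phi V = 1 -> U != V ->
    let g := gauge Co U V in let B := (g - 1)^-1 *: (g *: V - U) in
    [/\ 1 < g, Cb B, ~ Co B & form phi B = 1].
  move=> CU CV U1 V1 UV g B; have [g1 g0 _] := gaugeP pc CU CV.
  have f0 := closed_cone_form pc g1; have fE : form phi (g *: V - U) = g - 1.
    by rewrite lformB lformZ U1 V1 mulr1.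
  have g10 : 0 < g - 1.
    rewrite lt_neqAle -fE f0 andbT eq_sym; apply: contraNneq UV => f00.
    have h := closed_cone_eq0 pc g1 f00; have gE : g = 1 by lra.
    by rewrite eq_sym -subr_eq0 -h -/g gE scale1r.
  have gV : 0 < (g - 1)^-1 by rewrite invr_gt0.
  split; first by lra.
  - by apply: (closed_coneZ pc) => //; exact: ltW.
  - move=> CB; apply: (gauge_not_interior CU CV); rewrite -/g.
    rewrite -[_ - _]scale1r -(mulfV (lt0r_neq0 g10)) -scalerA.
    exact: (cone_scale pc).
  - by rewrite lformZ fE mulVf// gt_eqF.
have [g1 CB nCB B1] := key X Y CX CY X1 Y1 XY.
have YX : Y != X by rewrite eq_sym.
have [h1 CA nCA A1] := key Y X CY CX Y1 X1 YX.
set g := gauge Co X Y in g1 CB nCB B1; set h := gauge Co Y X in h1 CA nCA A1.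
have gh : 0 < g * h - 1 by nra.
have gh0 := lt0r_neq0 gh.
have g0 : g - 1 != 0 by rewrite gt_eqF// subr_gt0.
have h0 : h - 1 != 0 by rewrite gt_eqF// subr_gt0.
exists ((h - 1)^-1 *: (h *: X - Y)), ((g - 1)^-1 *: (g *: Y - X)),
  ((g - 1) / (g * h - 1)), (h * (g - 1) / (g * h - 1)); split=> //.
- split; first by rewrite divr_gt0// subr_gt0.
  + by rewrite ler_pM2r ?invr_gt0// ler_peMl ?subr_ge0// ltW.
  + by rewrite ltr_pdivrMr//; nra.
split; apply/colP => i; rewrite !mxE; field; rewrite ?gh0 ?g0 ?h0//.
Qed.

End Chords.

Section HilbertDistance.
Context (R : realType) (d : nat) (Omega : set (proj_space R d)) (phi : 'rV[R]_d).
Hypothesis oc : convex_chart Omega phi.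
Local Notation Co := (cone_over Omega phi).
Local Notation Cb := (closed_cone Co).
Local Notation lift := (affine_coord phi).
Implicit Types (u v w : 'cV[R]_d) (p q x y : proj_space R d).
Let pc := cone_over_proper oc.

(** [is_hilbert_dist] may use any chart psi, and psi agrees with [phi] only up to sign on the lifts.
    As |e| = 1, this sign does not affect the distances in the cross ratio. *)
Lemma chart_sign (psi : 'rV[R]_d) : closure Omega `<=` affine_chart psi ->
  exists2 e : R, `|e| = 1 & forall p, closure Omega p -> 0 < e * form psi (lift p).
Proof.
move=> cl; pose T := [set v | Cb v /\ v != 0].
have T0 v : T v -> form psi v != 0.
  move=> [Cv v0]; have vp := represents_class v0; set p := proj_class _ in vp.
  have /cl/eqP := closed_cone_over_closure oc Cv vp.
  by have [k k0 ->] := (representsP _ vp).1 (represents_vec p);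
    rewrite lformZ mulf_eq0 negb_or => /andP[].
have Tlift p : closure Omega p -> T (lift p).
  by move=> cp; split; [exact: lift_closure|exact: represents_neq0 (lift_represents oc cp)].
have [pos|neg] : (forall v, T v -> 0 < form psi v) \/ (forall v, T v -> 0 < form (- psi) v).
  apply: lform_sign T0 => [u v [Cu u0] [Cv v0]|k v k0 [Cv v0]]; split.
  - exact: closed_coneD.
  - apply: contraNneq u0 => uv0; apply/eqP/(closed_cone_anti pc) => //.
    by rewrite -(addr0_eq uv0) in Cv.
  - by apply: (closed_coneZ pc) => //; exact: ltW.
  - by rewrite scaler_eq0 negb_or gt_eqF.
- by exists 1; rewrite ?normr1// => p /Tlift/pos; rewrite mul1r.
- by exists (-1); rewrite ?normrN ?normr1// => p /Tlift/neg; rewrite mulN1r -lformNl.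
Qed.

(** In the chart psi a point p has the coordinates e k_p lift(p) with k_p > 0. [hd] ignores positive
    factors, and the cross ratio depends only on the parameters s and t, so every admissible chart
    and chord gives the same value. *)
Lemma is_hilbert_dist_hd x y r : Omega x -> Omega y -> is_hilbert_dist Omega x y r ->
  r = hd Co (lift x) (lift y).
Proof.
move=> Ox Oy [psi [a [b [s [t []]]]]] cl [ba bb] [s0 st t1] [XE YE] ->.
have [e e1 epos] := chart_sign cl.
have e0 : e != 0 by rewrite -normr_gt0 e1.
pose k p := (e * form psi (lift p))^-1.
have kpos p : closure Omega p -> 0 < k p by move=> cp; rewrite invr_gt0 epos.
have kE p : closure Omega p -> affine_coord psi p = e *: (k p *: lift p).
  move=> cp; have pp := lift_represents oc cp.
  rewrite (liftE pp) ?scalerA /k; last first.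
    by have := epos p cp; apply: contraTneq => ->; rewrite mulr0 ltxx.
  by rewrite invfM mulrA mulfV// mul1r.
have cx := subset_closure Ox; have cy := subset_closure Oy.
have [ca _] := ba; have [cb _] := bb.
move: XE YE; rewrite !kE//.
have [Ca nCa] := lift_boundary oc ba; have [Cb' nCb] := lift_boundary oc bb.
have scaled p : 0 < k p -> Cb (lift p) -> ~ Co (lift p) -> Cb (k p *: lift p) /\ ~ Co (k p *:
  lift p).
  move=> kp Cp nCp; split; first by apply: (closed_coneZ pc) => //; exact: ltW.
  move=> h; apply: nCp; rewrite -[lift p]scale1r -(mulVf (lt0r_neq0 kp)) -scalerA.
  by apply: (cone_scale pc) => //; rewrite invr_gt0.
have [CA nCA] := scaled a (kpos a ca) Ca nCa; have [CB nCB] := scaled b (kpos b cb) Cb' nCb.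
rewrite ![_ *: (e *: _)]scalerA ![_ * e]mulrC -!scalerA -!scalerDr.
move=> /(scalerI e0) XE /(scalerI e0) YE.
have CX : Co (k x *: lift x) by apply: (cone_scale pc) (kpos x cx) (cone_over_lift oc Ox).
have CY : Co (k y *: lift y) by apply: (cone_scale pc) (kpos y cy) (cone_over_lift oc Oy).
rewrite -(hdZl pc (kpos x cx) (cone_over_lift oc Ox) (cone_over_lift oc Oy)).
rewrite -(hdZr pc (kpos y cy) CX (cone_over_lift oc Oy)).
have dist (u v : 'cV[R]_d) : `|e *: u - e *: v| = `|u - v| by rewrite -scalerBr normrZ e1 mul1r.
rewrite !dist; move: CX CY; rewrite XE YE.
set A := k a *: _ in CA nCA XE YE *; set B := k b *: _ in CB nCB XE YE *.
move=> CX CY; rewrite (hd_chord pc)// mulrC; congr (ln _ / _).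
have AB : 0 < `|A - B|.
  rewrite normr_gt0 subr_eq0; apply/eqP => AB; apply: nCA.
  by move: CX; rewrite -AB -scalerDl subrK scale1r.
have AB0 := lt0r_neq0 AB.
have eA (q : R) : 0 <= q -> `|A - ((1 - q) *: A + q *: B)| = q * `|A - B|.
  move=> q0; have -> : A - ((1 - q) *: A + q *: B) = q *: (A - B).
    by move: A B {CA nCA XE YE CB nCB CX CY AB AB0} => A B; apply/colP => i; rewrite !mxE; ring.
  by rewrite normrZ ger0_norm.
have eB (q : R) : q <= 1 -> `|B - ((1 - q) *: A + q *: B)| = (1 - q) * `|A - B|.
  move=> q1; have -> : B - ((1 - q) *: A + q *: B) = (1 - q) *: (B - A).
    by move: A B {CA nCA XE YE CB nCB CX CY AB AB0 eA} => A B; apply/colP => i; rewrite !mxE; ring.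
  by rewrite normrZ (distrC B A) ger0_norm// subr_ge0.
rewrite !eA ?eB; try lra.
by field; rewrite AB0 !gt_eqF//; lra.
Qed.

Lemma is_hilbert_dist_exists x y : (1 < d)%N -> Omega x -> Omega y ->
  exists r, is_hilbert_dist Omega x y r.
Proof.
move=> d1 Ox Oy.
have cx := subset_closure Ox; have cy := subset_closure Oy.
have Cx := cone_over_lift oc Ox; have Cy := cone_over_lift oc Oy.
have X1 := form_lift oc cx; have Y1 := form_lift oc cy.
have main Z : Co Z -> form phi Z = 1 -> lift x != Z -> (lift y = Z \/ lift y = lift x) ->
    exists r, is_hilbert_dist Omega x y r.
  move=> CZ Z1 XZ yZ.
  have [A [B [s [t [[CA nCA] [CB nCB] [A1 B1] [s0 st t1] [XE ZE]]]]]] := exists_chord pc Cx CZ X1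
    Z1 XZ.
  have A0 : A != 0 by apply: contra_eq_neq A1 => ->; rewrite lform0 eq_sym oner_eq0.
  have B0 : B != 0 by apply: contra_eq_neq B1 => ->; rewrite lform0 eq_sym oner_eq0.
  have Aa := represents_class A0; have Bb := represents_class B0.
  set a := proj_class A0 in Aa; set b := proj_class B0 in Bb.
  have la : lift a = A by rewrite (liftE Aa) ?A1 ?invr1 ?scale1r ?oner_eq0.
  have lb : lift b = B by rewrite (liftE Bb) ?B1 ?invr1 ?scale1r ?oner_eq0.
  have Ba := boundary_of_cone oc CA nCA Aa; have Bb' := boundary_of_cone oc CB nCB Bb.
  case: yZ => yZ.
    eexists; exists phi, a, b, s, t; split => //; first exact: chart_closure oc.
    by rewrite la lb yZ.
  eexists; exists phi, a, b, s, s; split => //.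
  - exact: chart_closure oc.
  - by split => //; exact: le_lt_trans t1.
  - by rewrite la lb yZ.
have [xy|xy] := eqVneq (lift x) (lift y); last by apply: (main (lift y)) => //; left.
(* For x = y a chord through x is still required: d > 1 provides a direction v not proportional to
   x, and Z below is x moved slightly along it. *)
have [v vX] : exists v, forall k, v <> k *: lift x.
  have /cV0Pn[i Xi] := represents_neq0 (lift_represents oc cx).
  have [j ij] : exists j : 'I_d, j != i.
    have d0 : (0 < d)%N by exact: ltnW.
    have [i0|i0] := eqVneq i (Ordinal d0); last by exists (Ordinal d0); rewrite eq_sym.
    by exists (Ordinal d1); rewrite i0.
  exists (delta_mx j 0) => k kE.
  have : (delta_mx j 0 : 'cV[R]_d) i 0 = k * lift x i 0 by rewrite kE mxE.
  rewrite mxE eq_sym (negPf ij)/= => /esym/eqP; rewrite mulf_eq0 (negPf Xi) orbF => /eqP k0.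
  have : (delta_mx j 0 : 'cV[R]_d) j 0 = 0 by rewrite kE k0 scale0r mxE.
  by rewrite mxE !eqxx => /eqP; rewrite oner_eq0.
have [e e0 CZ] := cone_small pc v Cx.
have fZ := cone_form pc CZ; set Z := _ - _ in CZ fZ.
apply: (main ((form phi Z)^-1 *: Z)); last by right.
- by apply: (cone_scale pc) => //; rewrite invr_gt0.
- by rewrite lformZ mulVf// gt_eqF.
- apply/eqP => XZ; apply: (vX ((1 - form phi Z) / e)).
  have : form phi Z *: lift x = Z by rewrite XZ scalerA mulfV ?scale1r// gt_eqF.
  rewrite {2}/Z => h; rewrite mulrC -scalerA scalerBl scale1r h opprB addrC subrK.
  by rewrite scalerA mulVf ?scale1r// gt_eqF.
Qed.

Lemma hilbert_distE x y : (1 < d)%N -> Omega x -> Omega y ->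
  hilbert_dist Omega x y = hd Co (lift x) (lift y).
Proof.
move=> d1 Ox Oy; apply: (is_hilbert_dist_hd Ox Oy).
by have [r rP] := is_hilbert_dist_exists d1 Ox Oy; apply: xgetPex; exists r.
Qed.

End HilbertDistance.

(** * Projective automorphisms and rays *)

Lemma middle_of_three (R : realDomainType) (x y z : R) :
  [\/ x <= y <= z \/ z <= y <= x, y <= x <= z \/ z <= x <= y |
      x <= z <= y \/ y <= z <= x].
Proof.
have [h1|h1] := leP x y; have [h2|h2] := leP y z; have [h3|h3] := leP x z;
  try (by apply: Or31; lra); try (by apply: Or32; lra); by apply: Or33; lra.
Qed.

Section Action.
Context (R : realType) (d : nat).
Implicit Types (g h : PGL R d) (p q : proj_space R d) (v : 'cV[R]_d).

Definition PGL_mx g : 'M[R]_d := val (repr g).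

Lemma PGL_mx_unit g : PGL_mx g \in unitmx.
Proof. exact: Pilot.Defs.GL_unit. Qed.

Lemma represents_act g v p : represents v p -> represents (PGL_mx g *m v) (PGL_act g p).
Proof.
move=> vp; have [k k0 pE] := (representsP _ vp).1 (represents_vec p).
have gp : represents (PGL_mx g *m vec p) (PGL_act g p) by exact: represents_class.
apply/(representsP _ gp); exists k^-1; first by rewrite invr_eq0.
by rewrite pE -scalemxAr scalerA mulVf ?scale1r.
Qed.

Lemma PGL_mx_mul g h : exists2 k : R, k != 0 & PGL_mx (g * h)%g = k *: (PGL_mx g *m PGL_mx h).
Proof. exact: repr_PGL (GL_mul (repr g) (repr h)). Qed.

Lemma PGL_mx_inv g : exists2 k : R, k != 0 & PGL_mx (g^-1)%g = k *: invmx (PGL_mx g).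
Proof. exact: repr_PGL (GL_inv (repr g)). Qed.

Lemma PGL_act_mul g h p : PGL_act (g * h)%g p = PGL_act g (PGL_act h p).
Proof.
have vp := represents_vec p; have [k k0 kE] := PGL_mx_mul g h.
apply: (represents_unique (represents_act (g * h)%g vp)).
have := represents_act g (represents_act h vp); rewrite mulmxA => ghp.
by rewrite kE -scalemxAl; exact: representsZ.
Qed.

Lemma PGL_actK g p : PGL_act g^-1%g (PGL_act g p) = p.
Proof.
have vp := represents_vec p; have [k k0 kE] := PGL_mx_inv g.
have := represents_act g^-1%g (represents_act g vp).
rewrite kE -scalemxAl mulKmx ?PGL_mx_unit// => h.
by apply: (represents_unique h); exact: representsZ.
Qed.

Lemma PGL_actKV g p : PGL_act g (PGL_act g^-1%g p) = p.
Proof. by rewrite -{1}[g]invgK PGL_actK. Qed.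

Variable Omega : set (proj_space R d).

Lemma Aut_act g p : Aut Omega g -> Omega p -> Omega (PGL_act g p).
Proof. by move=> gO Op; rewrite -gO; exists p. Qed.

Lemma Aut_inv g : Aut Omega g -> Aut Omega g^-1%g.
Proof.
move=> gO; apply/seteqP; split=> [_ [p Op <-]|p Op].
  by move: Op; rewrite -{1}gO => -[q Oq <-]; rewrite PGL_actK.
by exists (PGL_act g p); [exact: Aut_act|exact: PGL_actK].
Qed.

Lemma Aut_mul g h : Aut Omega g -> Aut Omega h -> Aut Omega (g * h)%g.
Proof.
move=> gO hO; apply/seteqP; split=> [_ [p Op <-]|p Op].
  by rewrite PGL_act_mul; do 2 apply: Aut_act => //.
exists (PGL_act h^-1%g (PGL_act g^-1%g p)).
  by apply: Aut_act; [exact: Aut_inv|apply: Aut_act => //; exact: Aut_inv].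
by rewrite PGL_act_mul PGL_actKV PGL_actKV.
Qed.

Variable phi : 'rV[R]_d.
Hypothesis oc : convex_chart Omega phi.
Local Notation Co := (cone_over Omega phi).
Local Notation lift := (affine_coord phi).
Let pc := cone_over_proper oc.

(** A matrix of g is determined up to a scalar. Since [phi] composed with it has no zero on Co, it
    has constant sign there, and the matrix or its negative preserves the cone. *)
Lemma Aut_cone g : Aut Omega g -> exists a : 'M[R]_d,
  [/\ cone_aut Co a, exists2 k : R, k != 0 & a = k *: PGL_mx g &
   forall p, Omega p -> exists2 c : R, 0 < c & lift (PGL_act g p) = c *: (a *m lift p)].
Proof.
move=> gO.
have formg v : form (phi *m PGL_mx g) v = form phi (PGL_mx g *m v) by rewrite /form mulmxA.
have g0 v : Co v -> form (phi *m PGL_mx g) v != 0.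
  move=> [_ [p Op vp]]; rewrite formg; have Ogp := Aut_act gO Op.
  have [k k0 ->] := (representsP _ (lift_represents oc (subset_closure Ogp))).1 (represents_act g
    vp).
  by rewrite lformZ (form_lift oc (subset_closure Ogp)) mulr1.
have [a [[k k0 aE] apos]] : exists a : 'M[R]_d, (exists2 k : R, k != 0 & a = k *: PGL_mx g) /\
    forall v, Co v -> 0 < form phi (a *m v).
  have [pos|neg] := lform_sign (cone_add pc) (cone_scale pc) g0.
    exists (PGL_mx g); split; first by exists 1; rewrite ?oner_eq0 ?scale1r.
    by move=> v /pos; rewrite formg.
  exists (- PGL_mx g); split; first by exists (-1); rewrite ?oppr_eq0 ?oner_eq0 ?scaleN1r.
  by move=> v /neg; rewrite lformNl formg mulNmx lformN.
have ua : a \in unitmx by rewrite aE unitmxZ ?unitfE// PGL_mx_unit.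
have ag v p : represents v p -> represents (a *m v) (PGL_act g p).
  by move=> vp; rewrite aE -scalemxAl; apply: representsZ => //; exact: represents_act.
have aC v : Co v -> Co (a *m v).
  move=> Cv; split; first exact: apos.
  by have [_ [p Op vp]] := Cv; exists (PGL_act g p); [exact: Aut_act|exact: ag].
exists a; split; [|by exists k|].
- split=> // v; split; last exact: aC.
  move=> [av0 [q + avq]]; rewrite -{1}gO => -[p Op pq].
  have := ag _ _ (lift_represents oc (subset_closure Op)); rewrite pq => aq.
  have [l l0 avE] := (representsP _ aq).1 avq.
  have Cp := cone_over_lift oc Op.
  have vE : v = l *: lift p by apply: (can_inj (mulKmx ua)); rewrite -scalemxAr.
  rewrite vE; apply: (cone_scale pc) => //.
  by move: av0; rewrite avE lformZ pmulr_lgt0// apos.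
- move=> p Op; have Cp := cone_over_lift oc Op.
  have gp := ag _ _ (lift_represents oc (subset_closure Op)).
  have h0 := apos _ Cp; exists (form phi (a *m lift p))^-1; first by rewrite invr_gt0.
  by rewrite (liftE gp)// gt_eqF.
Qed.

Hypothesis d1 : (1 < d)%N.

Lemma hilbert_dist_act g p q : Aut Omega g -> Omega p -> Omega q ->
  hilbert_dist Omega (PGL_act g p) (PGL_act g q) = hilbert_dist Omega p q.
Proof.
move=> gO Op Oq.
rewrite (hilbert_distE oc d1 (Aut_act gO Op) (Aut_act gO Oq)) (hilbert_distE oc d1 Op Oq).
have [a [ca _ la]] := Aut_cone gO.
have [c c0 ->] := la p Op; have [c' c'0 ->] := la q Oq.
have Cp := cone_over_lift oc Op; have Cq := cone_over_lift oc Oq.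
have [_ aC] := ca.
have Cap : Co (a *m lift p) by exact/aC.
have Caq : Co (a *m lift q) by exact/aC.
by rewrite (hdZl pc c0 Cap (cone_scale pc c'0 Caq)) (hdZr pc c'0 Cap Caq) (hd_aut pc ca Cp Cq).
Qed.

Lemma cone_ray_aut (Y Z : R -> 'cV[R]_d) a : cone_aut Co a -> cone_ray Co phi Y ->
  (forall t, 0 <= t -> exists2 c : R, 0 < c & Z t = c *: (a *m Y t)) ->
  (forall t, 0 <= t -> form phi (Z t) = 1) -> cone_ray Co phi Z.
Proof.
move=> ca [Y1 Y2 Y3 Y4] ZY Z1; have [_ aC] := ca.
have ZC t : 0 <= t -> Co (Z t).
  by move=> t0; have [c c0 ->] := ZY t t0; apply: (cone_scale pc) => //; apply/aC;
    have [] := Y1 t t0.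
split.
- by move=> t t0; split; [exact: ZC|exact: Z1].
- move=> s t s0 t0; have [c c0 ->] := ZY s s0; have [c' c'0 ->] := ZY t t0.
  have [Cs _] := Y1 s s0; have [Ct _] := Y1 t t0.
  have Cas : Co (a *m Y s) by exact/aC.
  have Cat : Co (a *m Y t) by exact/aC.
  by rewrite (hdZl pc c0 Cas (cone_scale pc c'0 Cat)) (hdZr pc c'0 Cas Cat) (hd_aut pc ca Cs Ct) Y2.
- move=> s u x y s0 u0 x0 y0; have [c c0 ->] := ZY s s0; have [c' c'0 ->] := ZY u u0.
  have -> : x *: (c *: (a *m Y s)) + y *: (c' *: (a *m Y u)) =
      a *m ((x * c) *: Y s + (y * c') *: Y u).
    by rewrite mulmxDr -!scalemxAr !scalerA.
  move=> /aC Cz; have [t t0 [k k0 tE]] := Y3 s u (x * c) (y * c') s0 u0 (mulr_ge0 x0 (ltW c0))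
    (mulr_ge0 y0 (ltW c'0)) Cz.
  exists t => //; have [b b0 ->] := ZY t t0; exists (b * k); first exact: mulr_gt0.
  by rewrite tE -scalemxAr scalerA.
- move=> s t u s0 st tu; have t0 := le_trans s0 st; have u0 := le_trans t0 tu.
  have [x [y [x0 y0 tE]]] := Y4 s t u s0 st tu.
  have [b b0 ->] := ZY t t0; have [c c0 ->] := ZY s s0; have [c' c'0 ->] := ZY u u0.
  exists (b * x / c), (b * y / c'); split.
  + by rewrite !mulr_ge0 ?invr_ge0// ltW.
  + by rewrite !mulr_ge0 ?invr_ge0// ltW.
  + by rewrite tE mulmxDr -!scalemxAr scalerDr !scalerA !mulfVK ?gt_eqF.
Qed.

(** In the sector spanned by u and v, signed so that [phi] is positive, the points are ordered by
    the slope t/s. The definition of a ray does not say that the slope is monotone in time; the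
    isometry forces it. *)
Lemma proj_ray_cone_ray (c : R -> proj_space R d) : proj_geodesic_ray Omega c ->
  cone_ray Co phi (fun t => lift (c t)).
Proof.
move=> [cO c_iso [x [y [u [v [Ox By ux vy cE]]]]]].
have Y1 t : 0 <= t -> Co (lift (c t)) /\ form phi (lift (c t)) = 1.
  move=> /cO Oct; split; first exact: (cone_over_lift oc).
  exact: (form_lift oc (subset_closure Oct)).
have Y2 s t : 0 <= s -> 0 <= t -> hd Co (lift (c s)) (lift (c t)) = `|s - t|.
  by move=> s0 t0; rewrite -(hilbert_distE oc d1) ?c_iso//; exact: cO.
have seg0 (s t : R) : 0 < s -> 0 <= t -> s *: u + t *: v != 0.
  move=> s0 t0; apply/eqP => /eqP; rewrite addr_eq0 => /eqP sE.
  have [_ nOy] := By; apply: nOy; rewrite (interior_id _).1; last exact: chart_open oc.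
  have uE : u = - (t / s) *: v.
    apply: (scalerI (lt0r_neq0 s0)); rewrite sE scalerA mulrN mulrCA mulfV ?gt_eqF//.
    by rewrite mulr1 scaleNr.
  have k0 : - (t / s) != 0.
    by apply: contraTneq (represents_neq0 ux) => k0; rewrite uE k0 scale0r eqxx.
  have := representsZ k0 vy; rewrite -uE => uy.
  by rewrite -(represents_unique ux uy).
pose T := [set w | exists s t : R, [/\ 0 < s, 0 <= t & w = s *: u + t *: v]].
have Tc w p : T w -> represents w p -> exists2 r, 0 <= r & c r = p.
  move=> [s [t [s0 t0 ->]]] wp.
  have : (c @` `[0, +oo[) p by rewrite cE; exists s, t.
  by move=> [r /=]; rewrite in_itv/= andbT => r0 <-; exists r.
have T0 w : T w -> form phi w != 0.
  move=> Tw; have wn0 : w != 0 by have [s [t [s0 t0 ->]]] := Tw; exact: seg0.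
  have wp := represents_class wn0; have [r r0 rE] := Tc _ _ Tw wp.
  have Op : Omega (proj_class wn0) by rewrite -rE; exact: cO.
  have [k k0 ->] := (representsP _ (lift_represents oc (subset_closure Op))).1 wp.
  by rewrite lformZ (form_lift oc (subset_closure Op)) mulr1.
have [e e0 ePos] : exists2 e : R, e != 0 & forall w, T w -> 0 < form phi (e *: w).
  have [pos|neg] : (forall w, T w -> 0 < form phi w) \/ (forall w, T w -> 0 < form (- phi) w).
    apply: lform_sign T0 => [_ _ [s1 [t1 [s10 t10 ->]]] [s2 [t2 [s20 t20 ->]]]|k _ k0 [s1 [t1
      [s10 t10 ->]]]].
      by exists (s1 + s2), (t1 + t2); rewrite addr_gt0// addr_ge0// !scalerDl addrACA.
    by exists (k * s1), (k * t1); rewrite mulr_gt0// mulr_ge0 ?(ltW k0)// scalerDr !scalerA.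
  by exists 1; rewrite ?oner_eq0// => w /pos; rewrite scale1r.
  by exists (-1); rewrite ?oppr_eq0 ?oner_eq0// => w /neg; rewrite scaleN1r lformN lformNl.
pose u' := e *: u; pose v' := e *: v.
have E (s t : R) : s *: u' + t *: v' = e *: (s *: u + t *: v).
  by rewrite scalerDr !scalerA ![e * _]mulrC.
clearbody u' v'.
have inray (s t : R) : 0 < s -> 0 <= t -> exists2 r, 0 <= r & exists2 k, 0 < k &
    lift (c r) = k *: (s *: u' + t *: v').
  move=> s0 t0; have Tw : T (s *: u + t *: v) by exists s, t.
  have wp := represents_class (seg0 s t s0 t0).
  have [r r0 rE] := Tc _ _ Tw wp; exists r => //.
  have ewp := representsZ e0 wp; have h0 := ePos _ Tw.
  exists (form phi (e *: (s *: u + t *: v)))^-1; first by rewrite invr_gt0.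
  by rewrite rE E (liftE ewp)// gt_eqF.
have coord r : 0 <= r -> exists s t : R, [/\ 0 < s, 0 <= t & lift (c r) = s *: u' + t *: v'].
  move=> r0; have [s [t [s0 t0 rp]]] : half_open_segment u v (c r).
    by rewrite -cE; exists r => //=; rewrite in_itv/= r0.
  have Tw : T (s *: u + t *: v) by exists s, t.
  have h0 := ePos _ Tw; set k := form phi _ in h0.
  exists (s / k), (t / k); split; first exact: divr_gt0.
    by rewrite divr_ge0// ltW.
  rewrite E (liftE (representsZ e0 rp)) ?gt_eqF// -/k.
  rewrite [LHS]scalerA [X in X *: _ = _]mulrC -[LHS]scalerA; congr (e *: _).
  by rewrite scalerDr !scalerA [k^-1 * s]mulrC [k^-1 * t]mulrC.
have slope (t1 t2 t3 : R) : t1 <= t2 <= t3 \/ t3 <= t2 <= t1 ->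
    exists x y : R, [/\ 0 <= x, 0 <= y, x + y = 1 & t2 = x * t1 + y * t3].
  have [->|t13] := eqVneq t1 t3.
    move=> h; exists 1, 0; rewrite addr0 mul1r mul0r addr0; split => //.
    by case: h => /andP[]; lra.
  move=> h; exists ((t3 - t2) / (t3 - t1)), ((t2 - t1) / (t3 - t1)).
  have n0 : t3 - t1 != 0 by rewrite subr_eq0 eq_sym.
  have ge0 (z : R) : (0 <= z /\ t1 <= t3 \/ z <= 0 /\ t3 <= t1) -> 0 <= z / (t3 - t1).
    case=> -[z0 t]; first by rewrite divr_ge0// subr_ge0.
    by rewrite -mulrNN -invrN opprB divr_ge0 ?oppr_ge0 ?subr_ge0.
  split; [apply: ge0; lra|apply: ge0; lra|by field|by field].
have btw (r1 r2 r3 s1 t1 s2 t2 s3 t3 : R) : 0 < s1 -> 0 < s2 -> 0 < s3 ->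
    lift (c r1) = s1 *: u' + t1 *: v' -> lift (c r2) = s2 *: u' + t2 *: v' ->
    lift (c r3) = s3 *: u' + t3 *: v' ->
    t1 / s1 <= t2 / s2 <= t3 / s3 \/ t3 / s3 <= t2 / s2 <= t1 / s1 ->
    exists x y, [/\ 0 <= x, 0 <= y & lift (c r2) = x *: lift (c r1) + y *: lift (c r3)].
  move=> s10 s20 s30 -> -> -> /slope[a [b [a0 b0 ab tE]]].
  exists (a * s2 / s1), (b * s2 / s3); split.
  - by rewrite !mulr_ge0 ?invr_ge0// ltW.
  - by rewrite !mulr_ge0 ?invr_ge0// ltW.
  rewrite !scalerDr !scalerA addrACA -!scalerDl; congr (_ *: _ + _ *: _).
    by rewrite !mulfVK ?gt_eqF// -mulrDl ab mul1r.
  have -> : t2 = s2 * (a * (t1 / s1) + b * (t3 / s3)) by rewrite -tE mulrC divfK ?gt_eqF.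
  by ring.
split => //.
- move=> s t a b s0 t0 a0 b0 Cz.
  have [s1 [t1 [s10 t10 E1]]] := coord s s0; have [s2 [t2 [s20 t20 E2]]] := coord t t0.
  have zE : a *: lift (c s) + b *: lift (c t) = (a * s1 + b * s2) *: u' + (a * t1 + b * t2) *: v'.
    by rewrite E1 E2 !scalerDr !scalerA addrACA -!scalerDl.
  rewrite zE; apply: inray; last by rewrite addr_ge0// mulr_ge0.
  rewrite lt0r addr_ge0 ?mulr_ge0// ?(ltW s10) ?(ltW s20)// andbT.
  rewrite paddr_eq0 ?mulr_ge0// ?(ltW s10) ?(ltW s20)//.
  rewrite !mulf_eq0 (gt_eqF s10) (gt_eqF s20) !orbF; apply/negP => /andP[/eqP aE /eqP bE].
  by have := cone_neq0 pc Cz; rewrite aE bE !scale0r addr0 eqxx.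
- move=> r1 r2 r3 r10 r12 r23; have r20 := le_trans r10 r12; have r30 := le_trans r20 r23.
  have [s1 [t1 [s10 t10 E1]]] := coord r1 r10.
  have [s2 [t2 [s20 t20 E2]]] := coord r2 r20.
  have [s3 [t3 [s30 t30 E3]]] := coord r3 r30.
  have [[C1 _] [C2 _] [C3 _]] := And3 (Y1 r1 r10) (Y1 r2 r20) (Y1 r3 r30).
  have add (p q r a b : R) : 0 <= p -> 0 <= q -> 0 <= r -> 0 <= a -> 0 <= b ->
      lift (c q) = a *: lift (c p) + b *: lift (c r) -> `|p - q| + `|q - r| <= `|p - r|.
    move=> p0 q0 r0 a0 b0 qE; rewrite -!Y2//.
    have := hd_segment pc (Y1 _ p0).1 (Y1 _ r0).1 a0 b0; rewrite -qE; apply.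
    exact: (Y1 _ q0).1.
  (* Whichever point is in the middle by slope, [add] makes its distances to the other two add up;
     compared with the times, this identifies it with the point in the middle by time. *)
  have cases : [\/ (t1 / s1 <= t2 / s2 <= t3 / s3 \/ t3 / s3 <= t2 / s2 <= t1 / s1),
      (t2 / s2 <= t1 / s1 <= t3 / s3 \/ t3 / s3 <= t1 / s1 <= t2 / s2) |
      (t1 / s1 <= t3 / s3 <= t2 / s2 \/ t2 / s2 <= t3 / s3 <= t1 / s1)].
    exact: middle_of_three.
  case: cases => h.
  + exact: (btw _ _ _ _ _ _ _ _ _ s10 s20 s30 E1 E2 E3 h).
  + have [a [b [a0 b0 qE]]] := btw _ _ _ _ _ _ _ _ _ s20 s10 s30 E2 E1 E3 h.
    have := add r2 r1 r3 a b r20 r10 r30 a0 b0 qE.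
    rewrite ger0_norm ?subr_ge0// ler0_norm ?subr_le0 ?(le_trans r12)// ler0_norm ?subr_le0// => k.
    have -> : r2 = r1 by lra.
    by exists 1, 0; rewrite scale1r scale0r addr0.
  + have [a [b [a0 b0 qE]]] := btw _ _ _ _ _ _ _ _ _ s10 s30 s20 E1 E3 E2 h.
    have := add r1 r3 r2 a b r10 r30 r20 a0 b0 qE.
    rewrite ler0_norm ?subr_le0 ?(le_trans r12)// ger0_norm ?subr_ge0// ler0_norm ?subr_le0// => k.
    have -> : r2 = r3 by lra.
    by exists 0, 1; rewrite scale1r scale0r add0r.
Qed.

End Action.

(** * Uniform contraction *)

Section UniformRegularity.
Context (R : realType) (d : nat) (Omega : set (proj_space R d)) (phi : 'rV[R]_d).
Hypothesis oc : convex_chart Omega phi.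
Hypothesis d1 : (1 < d)%N.
Hypothesis hexp : exposed_boundary Omega.
Local Notation Co := (cone_over Omega phi).
Local Notation lift := (affine_coord phi).
Local Notation dist := (hilbert_dist Omega).
Let pc := cone_over_proper oc.
Implicit Types (c : R -> proj_space R d) (gamma : nat -> PGL R d) (g : PGL R d)
  (p q x : proj_space R d).

Lemma hilbert_ge0 p q : Omega p -> Omega q -> 0 <= dist p q.
Proof.
by move=> Op Oq; rewrite (hilbert_distE oc d1 Op Oq); apply: (hd_ge0 pc);
  exact: (cone_over_lift oc).
Qed.

Lemma hilbert_sym p q : Omega p -> Omega q -> dist p q = dist q p.
Proof.
by move=> Op Oq; rewrite (hilbert_distE oc d1 Op Oq) (hilbert_distE oc d1 Oq Op) hdC.
Qed.

Lemma hilbert_trans q p p' : Omega p -> Omega q -> Omega p' -> dist p p' <= dist p q + dist q p'.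
Proof.
move=> Op Oq Op'; rewrite (hilbert_distE oc d1 Op Oq) (hilbert_distE oc d1 Oq Op').
by rewrite (hilbert_distE oc d1 Op Op'); apply: (hd_trans pc); exact: (cone_over_lift oc).
Qed.

Lemma hilbert_refl p : Omega p -> dist p p = 0.
Proof.
by move=> Op; rewrite (hilbert_distE oc d1 Op Op); apply: (hdxx pc); exact: (cone_over_lift oc).
Qed.

Lemma ler_norm_mulmx m n k (a : 'M[R]_(m, n)) (b : 'M[R]_(n, k)) :
  `|a *m b| <= n%:R * (`|a| * `|b|).
Proof.
apply: mx_norm_le => [|i j]; first by rewrite !mulr_ge0.
rewrite mxE; apply: le_trans (ler_norm_sum _ _ _) _.
rewrite -[n in n%:R]card_ord -sum1_card natr_sum mulr_suml; apply: ler_sum => l _.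
by rewrite mul1r normrM ler_pM// ler_coord_norm.
Qed.

(** Since e is an order unit, a e <= K |a e| e and e <= K |a^-1 e| a e, so the displacement is at
    most half of log(|a| |a^-1|) up to a constant. That product does not change when a is
    rescaled. *)
Lemma displacement_le x0 : Omega x0 -> exists2 K : R, 0 < K &
  forall g, Aut Omega g ->
    expR (2 * dist x0 (PGL_act g x0)) <= K * (`|PGL_mx g| * `|invmx (PGL_mx g)|).
Proof.
move=> Ox; have Ce := cone_over_lift oc Ox; set e := lift x0 in Ce.
have [K K0 KP] := cone_unit_bound pc Ce.
have e0 : 0 < `|e| by rewrite normr_gt0 (cone_neq0 pc).
have dR : 0 < d%:R :> R by rewrite ltr0n ltnW.
exists (K * (d%:R * `|e|) * (K * (d%:R * `|e|))) => [|g gO].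
  by rewrite !mulr_gt0.
have [a [ca [k k0 aE] la]] := Aut_cone oc gO.
have Ogx := Aut_act gO Ox.
rewrite (hilbert_distE oc d1 Ox Ogx); have [b b0 ->] := la x0 Ox.
have [ua aC] := ca; have Cae : Co (a *m e) by exact/aC.
rewrite (hdZr pc b0 Ce Cae).
pose s := K * `|invmx a *m e|; pose t := K * `|a *m e|.
have h1 : closed_cone Co (t *: e - a *m e) by exact: KP.
have h2 : closed_cone Co (s *: (a *m e) - e).
  have := (cone_aut_closed _ ca).2 (KP (invmx a *m e)).
  by rewrite mulmxBr -scalemxAr mulKVmx.
have := hd_le pc Ce Cae h2 h1; rewrite ler_pdivlMr// mulrC => hle.
have s0 : 0 < s.
  rewrite mulr_gt0// normr_gt0; apply: contraTneq e0 => h.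
  by rewrite -[e](mulKVmx ua) h mulmx0 normr0 ltxx.
have t0 : 0 < t by rewrite mulr_gt0// normr_gt0 (cone_neq0 pc).
have stp : s * t \is Num.pos by rewrite posrE mulr_gt0.
rewrite -ler_expR (lnK stp) in hle.
apply: le_trans hle _.
have ai : invmx a = k^-1 *: invmx (PGL_mx g) by rewrite aE invmxZ// -aE.
have -> : `|PGL_mx g| * `|invmx (PGL_mx g)| = `|a| * `|invmx a|.
  rewrite ai aE !normrZ normfV mulrACA mulfV ?mul1r//.
  by rewrite normr_eq0.
have b1 := ler_norm_mulmx (invmx a) e; have b2 := ler_norm_mulmx a e.
have -> : K * (d%:R * `|e|) * (K * (d%:R * `|e|)) * (`|a| * `|invmx a|) =
   (K * (d%:R * (`|invmx a| * `|e|))) * (K * (d%:R * (`|a| * `|e|))) by ring.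
by rewrite ler_pM ?(ltW s0) ?(ltW t0)// ler_wpM2l ?(ltW K0).
Qed.

(** Tracking gives k <= 2 r + displacement, and [displacement_le] with the last clause of
    [mu_ratio_nearly_rank1] gives 2 displacement <= ln (K d) + L. So L = mu_(1,d) grows at least
    like 2 k, and the errors exp(- C L) become small. *)
Lemma regular_nearly_rank1 x0 (r C1 N1 C2 N2 s : R) : Omega x0 -> 0 < s ->
  exists J : R, forall c gamma, proj_geodesic_ray Omega c ->
    (forall n, Aut Omega (gamma n)) -> tracks Omega r x0 gamma c ->
    strongly_uniformly_regular_with 1 C1 N1 gamma ->
    strongly_uniformly_regular_with d.-1 C2 N2 gamma ->
    forall n k : nat, J <= k%:R ->
      nearly_rank1 s (PGL_mx ((gamma n)^-1 * gamma (n + k)%N)%g) /\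
      nearly_rank1 s (invmx (PGL_mx ((gamma n)^-1 * gamma (n + k)%N)%g)).
Proof.
move=> Ox s0; have [K K0 KP] := displacement_le Ox.
have dR : 0 < d%:R :> R by rewrite ltr0n ltnW.
have rk : 0 < rank1_cst R d.
  rewrite /rank1_cst mulr_gt0 ?addr_gt0 ?mulr_gt0//.
  by rewrite ltr0n muln_gt0 (ltnW d1).
(* L >= L0 brings the rank one error below s for both C1 and C2. Absolute values are taken because J
   is chosen before the signs of the constants are known. *)
pose L0 := `|ln (rank1_cst R d / s)| * (`|C1^-1| + `|C2^-1|).
have L00 : 0 <= L0 by rewrite mulr_ge0 ?addr_ge0.
(* The first terms bring k beyond N1 and N2; the others come from 2 k <= 4 r + ln (K d) + L and the
   wish L >= L0. *)
exists (`|N1| + `|N2| + 1 + (L0 + `|ln (K * d%:R)|) / 2 + 2 * `|r|).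
move=> c gamma [cO c_iso _] gO tr [_ C10 N10 reg1] [_ C20 N20 reg2] n k Jk.
set g := ((gamma n)^-1 * gamma (n + k)%N)%g.
have gA : Aut Omega g by apply: Aut_mul; [exact: Aut_inv|].
have kN : N1 < k%:R /\ N2 < k%:R.
  have := ler_norm N1; have := ler_norm N2; have := normr_ge0 (ln (K * d%:R)).
  have := normr_ge0 r; have := normr_ge0 N1; have := normr_ge0 N2.
  by move: Jk L00; split; lra.
have h1 := reg1 n k kN.1; have h2 := reg2 n k kN.2; rewrite -/g in h1 h2.
have d11 : d.-1.+1 = d by rewrite prednK// ltnW.
rewrite /mu d11 in h1 h2.
pose L := ln (sigma 1 (PGL_mx g) / sigma d (PGL_mx g)).
have [n1 n2 n3] := mu_ratio_nearly_rank1 (erefl L) d1 (PGL_mx_unit g) C10 C20 h1 h2.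
have tr' i : dist (PGL_act (gamma i) x0) (c i%:R) < r.
  have Oi : Omega (c i%:R) by exact: cO.
  rewrite -(hilbert_dist_act oc d1 (Aut_inv (gO i)) (Aut_act (gO i) Ox) Oi) PGL_actK.
  exact: tr.
have hk : k%:R <= 2 * r + dist x0 (PGL_act g x0).
  have On : Omega (c n%:R) by exact: cO.
  have Onk : Omega (c (n + k)%:R) by exact: cO.
  have Gn := Aut_act (gO n) Ox; have Gnk := Aut_act (gO (n + k)%N) Ox.
  have := c_iso n%:R (n + k)%:R (ler0n _ _) (ler0n _ _).
  rewrite natrD opprD addrA subrr sub0r normrN ger0_norm//; rewrite -natrD => <-.
  have i1 := hilbert_trans On Gn Onk; have i2 := hilbert_trans Gn Gnk Onk.
  have := tr' n; have := tr' (n + k)%N; rewrite (hilbert_sym Gn On) => t1 t2.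
  have -> : dist x0 (PGL_act g x0) = dist (PGL_act (gamma n) x0) (PGL_act (gamma (n + k)%N) x0).
    rewrite -(hilbert_dist_act oc d1 (Aut_inv (gO n)) Gn Gnk) PGL_actK.
    by rewrite /g PGL_act_mul.
  apply: le_trans i1 _; apply: le_trans (lerD (ltW t2) i2) _.
  apply: le_trans (lerD (lexx r) (lerD (lexx _) (ltW t1))) _.
  move: (dist (PGL_act (gamma n) x0) _) => D.
  have -> : r + (D + r) = 2 * r + D by ring.
  exact: lexx.
have LL : L0 <= L.
  have := KP g gA; set D := dist _ _ in hk *; clearbody D.
  have Kd : 0 < K * d%:R by rewrite mulr_gt0.
  move=> /le_trans/(_ (ler_wpM2l (ltW K0) n3)); rewrite mulrA -{1}[K * d%:R]lnK ?posrE//.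
  rewrite -expRD ler_expR => hD.
  have := ler_norm (ln (K * d%:R)); have := ler_norm r; have := normr_ge0 r.
  have := normr_ge0 N1; have := normr_ge0 N2.
  by move: Jk hk hD; lra.
have fin C : 0 < C -> `|C^-1| <= `|C1^-1| + `|C2^-1| -> rank1_cst R d * expR (- (C * L)) <= s.
  move=> C0 CC; rewrite -ler_pdivlMl// -[_ * s]lnK ?posrE ?mulr_gt0 ?invr_gt0// ler_expR.
  have -> : (rank1_cst R d)^-1 * s = (rank1_cst R d / s)^-1 by rewrite invf_div mulrC.
  rewrite lnV ?posrE ?divr_gt0// lerN2; apply: le_trans (ler_norm _) _.
  rewrite -ler_pdivrMl// mulrC; apply: le_trans LL; rewrite /L0 ler_wpM2l//.
  by apply: le_trans CC; exact: ler_norm.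
split.
- by apply: nearly_rank1_le n1; apply: fin => //; rewrite lerDl.
- by apply: nearly_rank1_le n2; apply: fin => //; rewrite lerDr.
Qed.

Lemma exists_tracking_modulus x0 (r C1 N1 C2 N2 : R) : Omega x0 ->
  exists J : R -> R, forall c gamma, proj_geodesic_ray Omega c ->
    (forall n, Aut Omega (gamma n)) -> tracks Omega r x0 gamma c ->
    strongly_uniformly_regular_with 1 C1 N1 gamma ->
    strongly_uniformly_regular_with d.-1 C2 N2 gamma ->
    forall m : nat, let Y t := lift (PGL_act (gamma m)^-1%g (c t)) in
      cone_ray Co phi Y /\ tracked_ray Co (lift x0) r J Y m.
Proof.
move=> Ox.
have /choice[J JP] (s : R) : exists J : R, 0 < s ->
    forall c gamma, proj_geodesic_ray Omega c ->
    (forall n, Aut Omega (gamma n)) -> tracks Omega r x0 gamma c ->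
    strongly_uniformly_regular_with 1 C1 N1 gamma ->
    strongly_uniformly_regular_with d.-1 C2 N2 gamma ->
    forall n k : nat, J <= k%:R ->
      nearly_rank1 s (PGL_mx ((gamma n)^-1 * gamma (n + k)%N)%g) /\
      nearly_rank1 s (invmx (PGL_mx ((gamma n)^-1 * gamma (n + k)%N)%g)).
  have [s0|] := pselect (0 < s); last by exists 0.
  by have [J JP] := regular_nearly_rank1 r C1 N1 C2 N2 Ox s0; exists J => _.
exists J => c gamma ray gO tr reg1 reg2 m Y.
have [cO c_iso _] := ray.
have Am := Aut_inv (gO m).
have YO t : 0 <= t -> Omega (PGL_act (gamma m)^-1%g (c t)) by move=> t0; apply: Aut_act => //;
  exact: cO.
split.
  have [a [ca _ la]] := Aut_cone oc Am.
  apply: (cone_ray_aut oc ca (proj_ray_cone_ray oc d1 ray)) => t t0.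
    by have [b b0 bE] := la _ (cO t t0); exists b.
  exact: (form_lift oc (subset_closure (YO t t0))).
split.
  rewrite -(hilbert_distE oc d1 Ox (YO _ (ler0n _ m))); exact/ltW/tr.
have /choice[G GP] (n : nat) : exists a : 'M[R]_d, [/\ cone_aut Co a,
    exists2 k : R, k != 0 & a = k *: PGL_mx ((gamma m)^-1 * gamma n)%g &
    forall p, Omega p -> exists2 b : R, 0 < b &
      lift (PGL_act ((gamma m)^-1 * gamma n)%g p) = b *: (a *m lift p)].
  by apply: (Aut_cone oc); exact: Aut_mul.
exists G => n; have [ca [k k0 aE] la] := GP n.
have Gn := Aut_act (gO n) Ox.
split => //.
  have [b b0 bE] := la x0 Ox.
  have Ce := cone_over_lift oc Ox; have [_ aC] := ca.
  have CGe : Co (G n *m lift x0) by exact/aC.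
  have CY := cone_over_lift oc (YO _ (ler0n R n)).
  rewrite -(hdZl pc b0 CGe CY) -bE PGL_act_mul.
  rewrite -(hilbert_distE oc d1 (Aut_act Am Gn) (YO _ (ler0n _ n))).
  rewrite (hilbert_dist_act oc d1 Am Gn (cO _ (ler0n _ n))).
  rewrite -(hilbert_dist_act oc d1 (Aut_inv (gO n)) Gn (cO _ (ler0n _ n))) PGL_actK.
  exact/ltW/tr.
move=> s s0 Jnm.
have invG : invmx (G n) = k^-1 *: invmx (PGL_mx ((gamma m)^-1 * gamma n)%g).
  by have [ua _] := ca; rewrite aE invmxZ// -aE.
rewrite invG aE; suff [h1 h2] : nearly_rank1 s (PGL_mx ((gamma m)^-1 * gamma n)%g) /\
    nearly_rank1 s (invmx (PGL_mx ((gamma m)^-1 * gamma n)%g)).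
  by split; exact: nearly_rank1Z.
have key := JP s s0 c gamma ray gO tr reg1 reg2.
(* Regularity concerns increasing indices. For n < m the element is the inverse of one it covers,
   and the two conclusions are exchanged. *)
have [mn|nm] := leqP m n.
  have := key m (n - m)%N; rewrite subnKC//; apply.
  by move: Jnm; rewrite -natrB// ger0_norm.
have := key n (m - n)%N; rewrite subnKC ?(ltnW nm)//.
have -> : ((gamma m)^-1 * gamma n)%g = ((gamma n)^-1 * gamma m)^-1%g.
  by have := invgF (gamma n)^-1%g (gamma m)^-1%g; rewrite !invgK => ->.
case; first by move: Jnm; rewrite distrC -natrB ?(ltnW nm)// ger0_norm.
set g := ((gamma n)^-1 * gamma m)%g => h1 h2.
have [l l0 lE] := PGL_mx_inv g.
have ui : l *: invmx (PGL_mx g) \in unitmx by rewrite -lE PGL_mx_unit.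
by rewrite lE invmxZ// invmxK; split; exact: nearly_rank1Z.
Qed.

Lemma exists_contraction_constant x0 (r C1 N1 C2 N2 : R) : Omega x0 ->
  exists2 D : R, 1 <= D & forall c gamma, proj_geodesic_ray Omega c ->
    (forall n, Aut Omega (gamma n)) -> tracks Omega r x0 gamma c ->
    strongly_uniformly_regular_with 1 C1 N1 gamma ->
    strongly_uniformly_regular_with d.-1 C2 N2 gamma ->
    forall p q s t, Omega p -> Omega q ->
      almost_nearest dist c p s -> almost_nearest dist c q t ->
      dist p q <= dist p (c s) - D -> `|s - t| <= D.
Proof.
move=> Ox; have [J JP] := exists_tracking_modulus r C1 N1 C2 N2 Ox.
apply: contrapT => /forall2NP nD.
pose bad (D : R) (w : (R -> proj_space R d) * (nat -> PGL R d) * proj_space R d * proj_space R d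
  * R * R) :=
  let: (c, gamma, p, q, s, t) := w in
  [/\ [/\ proj_geodesic_ray Omega c, forall n, Aut Omega (gamma n), tracks Omega r x0 gamma c,
     strongly_uniformly_regular_with 1 C1 N1 gamma & strongly_uniformly_regular_with d.-1 C2 N2
       gamma],
   Omega p /\ Omega q, almost_nearest dist c p s /\ almost_nearest dist c q t,
   dist p q <= dist p (c s) - D & D < `|s - t| ].
(* D = 2 k + 8 leaves room for an integer m between s and t at distance at least k from both, the
   integer part of the midpoint, and it exceeds the saving k required by [no_long_shortcut]. *)
have /choice[w wP] (k : nat) : exists w, bad (k + k + 8)%:R w.
  have [h|h] := nD (k + k + 8)%:R; first by exfalso; apply: h; rewrite ler1n addnS.
  apply: contrapT => nw; apply: h => c gamma ray gO tr reg1 reg2 p q s t Op Oq ps qt pq.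
  rewrite leNgt; apply/negP => st; apply: nw.
  by exists (c, gamma, p, q, s, t).
have /choice[m mP] (k : nat) : exists m : nat,
    let: (_, _, _, _, s, t) := w k in
    [/\ (s <= m%:R <= t) \/ (t <= m%:R <= s), k%:R <= `|s - m%:R| & k%:R <= `|t - m%:R| ].
  move: (wP k); case: (w k) => [[[[[c gamma] p] q] s] t] [_ _ [[s0 _] [t0 _]] _ st].
  exists (Num.truncn ((s + t) / 2)).
  have st0 : 0 <= (s + t) / 2 by lra.
  have /andP[] := truncn_itv st0; move=> + M2; rewrite -[X in _ < X]natr1 in M2.
  move: (Num.truncn _)%:R st M2 => M; rewrite !natrD => st M2 M1.
  have k0 : 0 <= k%:R :> R by [].
  have [h|h] := leP s t.
    have {}st : k%:R + k%:R + 8 < t - s by move: st; rewrite distrC ger0_norm ?subr_ge0.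
    split; first by left; apply/andP; split; lra.
      by rewrite distrC; apply: le_trans (ler_norm _); lra.
    by apply: le_trans (ler_norm _); lra.
  have {}st : k%:R + k%:R + 8 < s - t by move: st; rewrite ger0_norm// subr_ge0 ltW.
  split; first by right; apply/andP; split; lra.
    by apply: le_trans (ler_norm _); lra.
  by rewrite distrC; apply: le_trans (ler_norm _); lra.
have [U [UU sU]] := ultraFilterLemma (@eventually_filter).
pose cc k := (w k).1.1.1.1.1; pose gg k := (w k).1.1.1.1.2.
pose pp k := (w k).1.1.1.2; pose qq k := (w k).1.1.2; pose ss k := (w k).1.2; pose tt k := (w k).2.
have wP' k : bad (k + k + 8)%:R (cc k, gg k, pp k, qq k, ss k, tt k).
  by move: (wP k); rewrite /cc /gg /pp /qq /ss /tt; case: (w k) => [[[[[? ?] ?] ?] ?] ?].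
have mP' k : [/\ (ss k <= (m k)%:R <= tt k) \/ (tt k <= (m k)%:R <= ss k),
    k%:R <= `|ss k - (m k)%:R| & k%:R <= `|tt k - (m k)%:R| ].
  by move: (mP k); rewrite /ss /tt; case: (w k) => [[[[[? ?] ?] ?] ?] ?].
pose G k := (gg k (m k))^-1%g.
have GA k : Aut Omega (G k) by have [[_ gO _ _ _] _ _ _ _] := wP' k; exact: Aut_inv.
pose Y k t := lift (PGL_act (G k) (cc k t)).
have YP k : cone_ray Co phi (Y k) /\ tracked_ray Co (lift x0) r J (Y k) (m k).
  have [[ray gO tr reg1 reg2] _ _ _ _] := wP' k.
  exact: (JP _ _ ray gO tr reg1 reg2 (m k)).
have cO k t : 0 <= t -> Omega (cc k t) by have [[[+ _ _] _ _ _ _] _ _ _ _] := wP' k; apply.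
have pO k : Omega (pp k) by have [_ [Op _] _ _ _] := wP' k; exact: Op.
have qO k : Omega (qq k) by have [_ [_ Oq] _ _ _] := wP' k; exact: Oq.
have hdE k p q : Omega p -> Omega q ->
    hd Co (lift (PGL_act (G k) p)) (lift (PGL_act (G k) q)) = dist p q.
  move=> Op Oq; rewrite -(hilbert_distE oc d1 (Aut_act (GA k) Op) (Aut_act (GA k) Oq)).
  exact: (hilbert_dist_act oc d1 (GA k) Op Oq).
have esc (f : nat -> R) : (forall k, k%:R <= `|f k - (m k)%:R|) -> escapes U m f.
  move=> fm B; apply: sU; apply: filterS (nbhs_infty_ger B) => k /= Bk.
  exact: le_trans (fm k).
have near_P k p s : Omega p -> almost_nearest dist (cc k) p s ->
    nearly_nearest Co Y k (lift (PGL_act (G k) p)) s.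
  move=> Op [s0 h] t t0; rewrite /Y (hdE k _ _ Op (cO k s s0)) (hdE k _ _ Op (cO k t t0)).
  exact: h.
have liftC k p : Omega p -> Co (lift (PGL_act (G k) p)) /\ form phi (lift (PGL_act (G k) p)) = 1.
  move=> Op; have Ogp := Aut_act (GA k) Op; split; first exact: (cone_over_lift oc).
  exact: (form_lift oc (subset_closure Ogp)).
apply: (no_long_shortcut pc (exposed_cone_over oc hexp) sU (cone_over_lift oc Ox)
  (Y := Y) (m := m) (r := r) (J := J) _ _ (s := ss) (t := tt)
  (p := fun k => lift (PGL_act (G k) (pp k))) (q := fun k => lift (PGL_act (G k) (qq k)))).
- by move=> k; have [] := YP k.
- by move=> k; have [] := YP k.
- by move=> k; have [_ _ [[s0 _] _] _ _] := wP' k; exact: s0.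
- by move=> k; have [_ _ [_ [t0 _]] _ _] := wP' k; exact: t0.
- by apply: esc => k; have [] := mP' k.
- by apply: esc => k; have [] := mP' k.
- by move=> k; have [] := mP' k.
- by move=> k; have [] := liftC k _ (pO k).
- by move=> k; have [] := liftC k _ (pO k).
- by move=> k; have [] := liftC k _ (qO k).
- by move=> k; have [] := liftC k _ (qO k).
- by move=> k; have [_ _ [n1 _] _ _] := wP' k; exact: near_P (pO k) n1.
- by move=> k; have [_ _ [_ n2] _ _] := wP' k; exact: near_P (qO k) n2.
- move=> k; have [_ _ [[s0 _] _] h _] := wP' k.
  rewrite /Y (hdE k _ _ (pO k) (qO k)) (hdE k _ _ (pO k) (cO k _ s0)).
  by apply: le_trans h _; rewrite lerD2l lerN2 ler_nat -addnA leq_addr.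
Qed.

End UniformRegularity.

(** * Tracked strongly regular rays are Morse *)

Theorem theorem1p8 (R : realType) (d : nat) (Omega : set (proj_space R d))
    (hd : (1 < d)%N) (hconv : properly_convex Omega) (hdiv : divisible Omega)
    (hexp : exposed_boundary Omega) :
  (forall (c : R -> proj_space R d) (gamma : nat -> PGL R d)
      (x0 : proj_space R d) (r : R),
    proj_geodesic_ray Omega c -> Omega x0 ->
    (forall n, Aut Omega (gamma n)) -> tracks Omega r x0 gamma c ->
    strongly_uniformly_regular 1 gamma ->
    strongly_uniformly_regular d.-1 gamma ->
    exists2 M : R -> R -> R, morse_gauge M & morse Omega M (c @` `[0, +oo[)) /\
  (forall (x0 : proj_space R d) (r C1 N1 C2 N2 : R), Omega x0 ->
    exists2 M : R -> R -> R, morse_gauge M &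
      forall (c : R -> proj_space R d) (gamma : nat -> PGL R d),
        proj_geodesic_ray Omega c ->
        (forall n, Aut Omega (gamma n)) -> tracks Omega r x0 gamma c ->
        strongly_uniformly_regular_with 1 C1 N1 gamma ->
        strongly_uniformly_regular_with d.-1 C2 N2 gamma ->
        morse Omega M (c @` `[0, +oo[)).
Proof.
have [nO oO [phi [_ cl cvx _ bnd]]] := hconv.
have oc : convex_chart Omega phi by [].
suff uniform : forall (x0 : proj_space R d) (r C1 N1 C2 N2 : R), Omega x0 ->
    exists2 M : R -> R -> R, morse_gauge M &
      forall (c : R -> proj_space R d) (gamma : nat -> PGL R d),
        proj_geodesic_ray Omega c ->
        (forall n, Aut Omega (gamma n)) -> tracks Omega r x0 gamma c ->
        strongly_uniformly_regular_with 1 C1 N1 gamma ->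
        strongly_uniformly_regular_with d.-1 C2 N2 gamma ->
        morse Omega M (c @` `[0, +oo[).
  split=> // c gamma x0 r ray Ox gO tr [C1 [N1 reg1]] [C2 [N2 reg2]].
  have [M MP Mmorse] := uniform x0 r C1 N1 C2 N2 Ox.
  by exists M => //; exact: (Mmorse c gamma).
move=> x0 r C1 N1 C2 N2 Ox.
have [D D1 DP] := exists_contraction_constant oc hd hexp r C1 N1 C2 N2 Ox.
(* D was obtained before c and gamma, so this gauge depends only on x0, r and the regularity
   constants. *)
exists (contracting_gauge D) => [lam a l0 a0|c gamma ray gO tr reg1 reg2].
  by apply: contracting_gauge_ge0 => //; exact: le_trans D1.
move=> lam a q al be lam1 a0 [albe qO qq] ellal ellbe u uI.
have [cO c_iso _] := ray.
have on_ray p : (c @` `[0, +oo[) p -> exists2 s, 0 <= s & p = c s.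
  by move=> [s /=]; rewrite in_itv/= andbT => s0 <-; exists s.
have in_seg t : al <= t <= be -> t \in `[al, be] by rewrite in_itv.
suff [s s0 sM] : exists2 s, 0 <= s & hilbert_dist Omega (q u) (c s) < contracting_gauge D lam a.
  by exists (c s) => //; exists s => //=; rewrite in_itv/= s0.
have {}uI : al <= u <= be by move: uI; rewrite in_itv.
exact: (@contracting_morse R (proj_space R d) Omega (hilbert_dist Omega) c D lam a q al be
  (hilbert_ge0 oc hd) (hilbert_sym oc hd)
  (fun p p' p'' Op Op' Op'' => hilbert_trans oc hd Op Op' Op'') (hilbert_refl oc hd)
  cO c_iso D1 (DP c gamma ray gO tr reg1 reg2) lam1 a0 albe
  (fun t tI => qO t (in_seg t tI)) (fun s t sI tI => qq s t (in_seg s sI) (in_seg t tI))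
  (on_ray _ ellal) (on_ray _ ellbe) u uI).
Qed.
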